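(* Let $\{X(t),t\in\mathbb{Z}\}$ be a linear time series with $\operatorname{E}|X(0)|^3<\infty$ whose spectral density is positive almost everywhere on $[0,2\pi)$. If its bispectrum is real-valued but not almost everywhere zero, then $\{X(t),t\in\mathbb{Z}\}$ is reversible.
   Context: A time series $\{X(t),t\in\mathbb{Z}\}$ is linear if it has a moving average representation $X(t)=\sum_{k=-\infty}^{\infty}c(k)Z(t-k)$ with $\sum_k c(k)^2<\infty$, where the random variables $Z(t)$, $t\in\mathbb{Z}$, are i.i.d. with $\operatorname{E}Z(t)=0$, $\operatorname{E}Z(t)^2<\infty$. It is reversible if $(X_t,X_{t+1},\dots,X_{t+k})$ and $(X_{t+k},X_{t+k-1},\dots,X_t)$ have the same distribution for all $k\in\mathbb{N}$, $t\in\mathbb{Z}$. For a stationary time series with finite third absolute moment, a function $B(\omega_1,\omega_2)$ defined a.e. on $[0,2\pi)\times[0,2\pi)$ is called the bispectrum if $B$ is Lebesgue integrable and $\operatorname{cum}(X(0),X(t_1),X(t_2))=\int_0^{2\pi}\int_0^{2\pi}\exp(i(t_1\omega_1+t_2\omega_2))B(\omega_1,\omega_2)\,d\omega_1d\omega_2$ for all $t_1,t_2\in\mathbb{Z}$, where $\operatorname{cum}$ denotes the joint third-order cumulant. *)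

(* Defs.v *)
From HB Require Import structures.
From mathcomp Require Import all_boot all_order all_algebra.
From mathcomp Require Import all_classical all_reals all_analysis.
Import Order.TTheory GRing.Theory Num.Theory.
Import numFieldTopology.Exports numFieldNormedType.Exports.
Local Open Scope classical_set_scope.
Local Open Scope ring_scope.

(** Real-valued expectation of a real function on a probability space
    (only used for integrable functions). *)
Definition Ex {d} {T : measurableType d} {R : realType} (P : probability T R)
  (f : T -> R) : R := fine ('E_P[f])%E.

Definition leb (R : realType) := @lebesgue_measure R.
Definition leb2 (R : realType) := (@lebesgue_measure R \x @lebesgue_measure R)%E.
Arguments leb R : clear implicits.
Arguments leb2 R : clear implicits.

Definition I2pi (R : realType) : set R := `[0%R, (2 * pi)%R[.
Arguments I2pi R : clear implicits.
Definition Sq2pi (R : realType) : set (R * R)%type := I2pi R `*` I2pi R.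
Arguments Sq2pi R : clear implicits.

Definition mutually_independent {d} {T : measurableType d} {R : realType}
  (P : probability T R) (Z : int -> T -> R) : Prop :=
  forall (s : seq int) (A : int -> set R), uniq s ->
    (forall i, i \in s -> measurable (A i)) ->
    P (\bigcap_(i in [set i | i \in s]) (Z i @^-1` A i)) =
    (\prod_(i <- s) P (Z i @^-1` A i))%E.

Definition identically_distributed {d} {T : measurableType d} {R : realType}
  (P : probability T R) (Z : int -> T -> R) : Prop :=
  forall (i j : int) (A : set R), measurable A ->
    P (Z i @^-1` A) = P (Z j @^-1` A).

Definition iid_innovations {d} {T : measurableType d} {R : realType}
  (P : probability T R) (Z : int -> {RV P >-> R}) : Prop :=
  [/\ mutually_independent P (fun i => Z i : T -> R),
      identically_distributed P (fun i => Z i : T -> R),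
      P.-integrable setT (fun w => ((Z 0 w) ^+ 2)%:E),
      P.-integrable setT (fun w => (Z 0 w)%:E) &
      Ex P (Z 0) = 0].

Definition square_summable {R : realType} (c : int -> R) : Prop :=
  cvg (series (fun n : nat => c (n%:Z) ^+ 2 + c (- (n.+1)%:Z) ^+ 2) @ \oo).

Definition ma_partial_sum {d} {T : measurableType d} {R : realType}
  (P : probability T R) (c : int -> R) (Z : int -> {RV P >-> R})
  (t : int) (n : nat) (w : T) : R :=
  \sum_(0 <= i < n.+1) c (i%:Z) * Z (t - i%:Z) w
  + \sum_(1 <= i < n.+1) c (- i%:Z) * Z (t + i%:Z) w.

Definition linear_time_series {d} {T : measurableType d} {R : realType}
  (P : probability T R) (X : int -> {RV P >-> R}) : Prop :=
  exists (c : int -> R) (Z : int -> {RV P >-> R}),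
    [/\ iid_innovations P Z, square_summable c &
      forall t : int,
        (\int[P]_w (((X t w - ma_partial_sum P c Z t n w) ^+ 2)%:E))%E
          @[n --> \oo] --> 0%E].

Definition autocov {d} {T : measurableType d} {R : realType}
  (P : probability T R) (X : int -> {RV P >-> R}) (h : int) : R :=
  Ex P (fun w => X 0 w * X h w) - Ex P (X 0) * Ex P (X h).

(** f is a spectral density of X:  f is Lebesgue integrable on [0,2pi) and
    gamma(h) = int_0^{2pi} exp(i h w) f(w) dw for all h, split into real
    and imaginary parts (f real-valued). *)
Definition is_spectral_density {d} {T : measurableType d} {R : realType}
  (P : probability T R) (X : int -> {RV P >-> R}) (f : R -> R) : Prop :=
  (leb R).-integrable (I2pi R) (fun w => (f w)%:E) /\
  forall h : int,
    autocov P X h = fine (\int[leb R]_(w in I2pi R) (cos (h%:~R * w) * f w)%:E)%E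
    /\ 0 = fine (\int[leb R]_(w in I2pi R) (sin (h%:~R * w) * f w)%:E)%E.

Definition cum3 {d} {T : measurableType d} {R : realType}
  (P : probability T R) (U V W : T -> R) : R :=
  Ex P (fun w => U w * V w * W w)
  - Ex P U * Ex P (fun w => V w * W w)
  - Ex P V * Ex P (fun w => U w * W w)
  - Ex P W * Ex P (fun w => U w * V w)
  + 2 * Ex P U * Ex P V * Ex P W.

(** B = Br + i Bi is a bispectrum of X: Br, Bi Lebesgue integrable on
    [0,2pi)^2 and for all t1 t2,
    cum(X0, X t1, X t2) = int int exp(i(t1 w1 + t2 w2)) B(w1,w2) dw1 dw2,
    written as its real and imaginary parts. *)
Definition is_bispectrum {d} {T : measurableType d} {R : realType}
  (P : probability T R) (X : int -> {RV P >-> R}) (Br Bi : (R * R)%type -> R) : Prop :=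
  [/\ (leb2 R).-integrable (Sq2pi R) (fun w => (Br w)%:E),
      (leb2 R).-integrable (Sq2pi R) (fun w => (Bi w)%:E) &
  forall t1 t2 : int,
    let th := fun w : (R * R)%type => t1%:~R * w.1 + t2%:~R * w.2 in
    cum3 P (X 0) (X t1) (X t2) =
      fine (\int[leb2 R]_(w in Sq2pi R)
              (cos (th w) * Br w - sin (th w) * Bi w)%:E)%E
    /\ 0 = fine (\int[leb2 R]_(w in Sq2pi R)
              (sin (th w) * Br w + cos (th w) * Bi w)%:E)%E].

Definition reversible {d} {T : measurableType d} {R : realType}
  (P : probability T R) (X : int -> {RV P >-> R}) : Prop :=
  forall (k : nat) (t : int) (A : set (k.+1.-tuple R)), measurable A ->
    P [set w | [tuple X (t + j%:Z) w | j < k.+1] \in A] =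
    P [set w | [tuple X (t + k%:Z - j%:Z) w | j < k.+1] \in A].

(* Main.v *)
(** The argument takes place in the time domain. Write [s2] and [kappa3] for the
    second and third moments of the innovations and [u_k = E[U Z_k] / s2].
    Cubing: an element [U] of the closed span of [Z] with a third moment
    satisfies [E U^3 = kappa3 * sum_k u_k^3]. So [kappa3 <> 0], as otherwise all
    cumulants, hence all Fourier coefficients of the bispectrum, would vanish.
    Spanning: cosine polynomials in the shift acting on [X] have transfer
    functions dense in [L2] of the spectral density, which is positive almost
    everywhere; therefore [Z_0] lies in the closed span of [X].
    Reversal: a real bispectrum makes the third moments of [X] invariant under
    [t |-> -t]. Approximate [Z_0] by a combination [U] of the [X_t] and let [U']
    be the same combination of the [X_(-t)]. Then [sum u'_k^2] and [sum u'_k^3]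
    are both close to 1, which forces one coefficient to be close to 1: the
    time-reversed [Z_0] is some [Z_m]. Comparing coefficients gives
    [c(h) = c(- h - m)], so the reversed series has the same moving average
    representation over a relabelled i.i.d. sequence. *)

Require Import Defs.
From HB Require Import structures.
From mathcomp Require Import all_boot all_order all_algebra.
From mathcomp Require Import all_classical all_reals all_analysis.
From mathcomp Require Import measurable_realfun zify ring lra.
Import Order.TTheory GRing.Theory Num.Theory.
Import numFieldTopology.Exports numFieldNormedType.Exports.
Local Open Scope classical_set_scope.
Local Open Scope ring_scope.
Set Implicit Arguments.
Unset Strict Implicit.
Unset Printing Implicit Defensive.

(** * Integrals and the L2 seminorm *)

(** The filter [c] is never inverted and no complex transfer function appears. Autocovariances see
    the spectral density only through cosines, so it can be folded from [0, 2 pi) onto (0, pi),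
    where the cosine is injective and its polynomials separate points. A transfer function [y] with
    [y * sqrt F] close to a constant makes the filtered series [Y] almost white noise, and averaging
    [Y] against its own coefficients, read backwards, recovers [Z 0]. Third moments are not
    continuous in L2, and this shapes the cubing step. Independence is used only through bounded
    functions of one innovation or of a finite sum, where L2 limits are harmless. Fourier sums keep
    a bounded third absolute moment by a Jensen inequality, and truncation joins the two. The
    density of cosine polynomials and the uniqueness of Fourier coefficients on the square come from
    one multiplicative class theorem, applied to two algebras of functions. Almost sure
    representations by measurable functions of the whole innovation sequence turn equality of
    coefficients into equality of joint laws; stationarity and the final reversal are both instances
    of this. *)

Section L2.
Context d (T : measurableType d) (R : realType).
Variables (mu : {measure set T -> \bar R}) (D : set T).
Hypothesis mD : measurable D.
Implicit Types f g : T -> R.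

Definition mem_L1 f := mu.-integrable D (EFin \o f).
(** Measurability is a separate component because [f ^+ 2] can be measurable when [f] is not.
    Functions are not identified almost everywhere, and [norm2] may take a junk value outside this
    class, so the estimates carry membership explicitly. *)
Definition mem_L2 f := measurable_fun D f /\ mem_L1 (fun x => f x ^+ 2).
Definition norm2 f := Num.sqrt (Rintegral mu D (fun x => f x ^+ 2)).
Notation L1 := mem_L1.
Notation L2 := mem_L2.
Notation I := (Rintegral mu D).
Notation n2 := norm2.

Lemma L1_meas f : L1 f -> measurable_fun D f.
Proof. by move=> /measurable_int /measurable_EFinP. Qed.

Lemma L1_le f g : measurable_fun D f -> L1 g -> (forall x, D x -> `|f x| <= g x) -> L1 f.
Proof.
move=> mf ig fg; apply: (le_integrable mD) ig => //; first exact/measurable_EFinP.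
by move=> x Dx /=; rewrite lee_fin (le_trans (fg x Dx))// ler_norm.
Qed.

Lemma L1_eq f g : (forall x, D x -> f x = g x) -> L1 f -> L1 g.
Proof. by move=> fg; apply: eq_integrable => // x; rewrite inE => /fg /= ->. Qed.

Lemma L1D f g : L1 f -> L1 g -> L1 (fun x => f x + g x).
Proof. by move=> i1 i2; have := integrableD mD i1 i2; apply: eq_integrable. Qed.

Lemma L1Z a f : L1 f -> L1 (fun x => a * f x).
Proof. by move=> i1; have := integrableZl mD a i1; apply: eq_integrable. Qed.

Lemma L1N f : L1 f -> L1 (fun x => - f x).
Proof. by move=> /(L1Z (-1)); apply: L1_eq => x _; rewrite mulN1r. Qed.

Lemma L1B f g : L1 f -> L1 g -> L1 (fun x => f x - g x).
Proof. by move=> i1 /L1N i2; exact: L1D. Qed.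

Lemma L1_norm f : L1 f -> L1 (fun x => `|f x|).
Proof. exact: integrable_norm. Qed.

Lemma L1_0 : L1 (fun=> 0).
Proof. exact: integrable0. Qed.

Lemma L1_sum (J : Type) (s : seq J) (F : J -> T -> R) :
  (forall j, L1 (F j)) -> L1 (fun x => \sum_(j <- s) F j x).
Proof.
move=> h; elim: s => [|j s ih].
  by apply: L1_eq L1_0 => x _; rewrite big_nil.
by apply: L1_eq (L1D (h j) ih) => x _; rewrite big_cons.
Qed.

Lemma Rint_eq f g : (forall x, D x -> f x = g x) -> I f = I g.
Proof. by move=> fg; apply: eq_Rintegral => x; rewrite inE => /fg. Qed.

Lemma RintD f g : L1 f -> L1 g -> I (fun x => f x + g x) = I f + I g.
Proof. exact: RintegralD. Qed.

Lemma RintB f g : L1 f -> L1 g -> I (fun x => f x - g x) = I f - I g.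
Proof. exact: RintegralB. Qed.

Lemma RintZ a f : L1 f -> I (fun x => a * f x) = a * I f.
Proof. exact: RintegralZl. Qed.

Lemma Rint0 : I (fun=> 0) = 0.
Proof. by rewrite Rintegral_cst// mul0r. Qed.

Lemma Rint_sum (J : Type) (s : seq J) (F : J -> T -> R) :
  (forall j, L1 (F j)) -> I (fun x => \sum_(j <- s) F j x) = \sum_(j <- s) I (F j).
Proof.
move=> h; elim: s => [|j s ih].
  by rewrite big_nil -[RHS]Rint0; apply: Rint_eq => x _; rewrite big_nil.
rewrite big_cons -ih -RintD//; last exact: L1_sum.
by apply: Rint_eq => x _; rewrite big_cons.
Qed.

Lemma Rint_ge0 f : (forall x, D x -> 0 <= f x) -> 0 <= I f.
Proof. exact: Rintegral_ge0. Qed.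

Lemma Rint_le f g : L1 f -> L1 g -> (forall x, D x -> f x <= g x) -> I f <= I g.
Proof. exact: le_Rintegral. Qed.

Lemma Rint_norm f : L1 f -> `|I f| <= I (fun x => `|f x|).
Proof. exact: le_normr_Rintegral. Qed.

Lemma L2_meas f : L2 f -> measurable_fun D f. Proof. by case. Qed.
Lemma L2_sqr f : L2 f -> L1 (fun x => f x ^+ 2). Proof. by case. Qed.
Hint Resolve L2_meas L2_sqr : core.

Lemma L2M f g : L2 f -> L2 g -> L1 (fun x => f x * g x).
Proof.
move=> lf lg; apply: (L1_le (g := fun x => f x ^+ 2 + g x ^+ 2)).
- by apply: measurable_funM; auto.
- by apply: L1D; auto.
- by move=> x _; rewrite ler_norml; apply/andP; split; nra.
Qed.

Lemma L2_eq f g : (forall x, D x -> f x = g x) -> L2 f -> L2 g.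
Proof.
move=> fg [mf lf]; split.
  by apply: eq_measurable_fun mf => x; rewrite inE; exact: fg.
by apply: L1_eq lf => x /fg ->.
Qed.

Lemma L2D f g : L2 f -> L2 g -> L2 (fun x => f x + g x).
Proof.
move=> lf lg; split; first by apply: measurable_funD; auto.
apply: (L1_eq (f := fun x => f x ^+ 2 + (2 * (f x * g x) + g x ^+ 2))).
  by move=> x _; ring.
by apply: L1D; auto; apply: L1D; auto; apply: L1Z; exact: L2M.
Qed.

Lemma L2Z a f : L2 f -> L2 (fun x => a * f x).
Proof.
move=> lf; split; first by apply: measurable_funM; auto; exact: measurable_cst.
apply: (L1_eq (f := fun x => a ^+ 2 * f x ^+ 2)); first by move=> x _; ring.
by apply: L1Z; auto.
Qed.

Lemma L2N f : L2 f -> L2 (fun x => - f x).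
Proof. by move=> /(L2Z (-1)); apply: L2_eq => x _; rewrite mulN1r. Qed.

Lemma L2B f g : L2 f -> L2 g -> L2 (fun x => f x - g x).
Proof. by move=> lf /L2N lg; exact: L2D. Qed.

Lemma L2_0 : L2 (fun=> 0).
Proof.
split; first exact: measurable_cst.
by apply: L1_eq L1_0 => x _; rewrite expr0n.
Qed.

Lemma L2_sum (J : Type) (s : seq J) (F : J -> T -> R) :
  (forall j, L2 (F j)) -> L2 (fun x => \sum_(j <- s) F j x).
Proof.
move=> h; elim: s => [|j s ih].
  by apply: L2_eq L2_0 => x _; rewrite big_nil.
by apply: L2_eq (L2D (h j) ih) => x _; rewrite big_cons.
Qed.

Lemma L2_bounded f g M : measurable_fun D f -> (forall x, D x -> `|f x| <= M) ->
  L2 g -> L2 (fun x => f x * g x).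
Proof.
move=> mf fM lg; split; first by apply: measurable_funM; auto.
apply: (L1_le (g := fun x => M ^+ 2 * g x ^+ 2)).
- by apply: measurable_funX; apply: measurable_funM; auto.
- by apply: L1Z; auto.
- move=> x Dx; rewrite normrX normrM exprMn [`|g x| ^+ 2]real_normK ?num_real// ler_wpM2r ?sqr_ge0//.
  have fx := fM x Dx; have M0 : 0 <= M := le_trans (normr_ge0 _) fx.
  by rewrite ler_sqr ?nnegrE.
Qed.

Lemma norm2_ge0 f : 0 <= n2 f. Proof. exact: sqrtr_ge0. Qed.

Lemma sqr_norm2 f : n2 f ^+ 2 = I (fun x => f x ^+ 2).
Proof. by rewrite sqr_sqrtr// Rint_ge0// => x _; exact: sqr_ge0. Qed.

Lemma norm2_eq f g : (forall x, D x -> f x = g x) -> n2 f = n2 g.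
Proof. by move=> fg; congr Num.sqrt; apply: Rint_eq => x /fg ->. Qed.

(* The quadratic [a |-> I ((a f + g)^2)] is nonnegative, so its discriminant is not positive. *)
Lemma cauchy_schwarz f g : L2 f -> L2 g -> `|I (fun x => f x * g x)| <= n2 f * n2 g.
Proof.
move=> lf lg.
have q a : 0 <= a ^+ 2 * n2 f ^+ 2 + 2 * a * I (fun x => f x * g x) + n2 g ^+ 2.
  rewrite !sqr_norm2 -!RintZ; [|exact: L2M|by auto].
  rewrite -!RintD; auto; first last.
  - by apply: L1Z; exact: L2M.
  - by apply: L1Z; auto.
  - by apply: L1D; apply: L1Z; [auto|exact: L2M].
  apply: Rint_ge0 => x _.
  by rewrite (_ : _ + _ = (a * f x + g x) ^+ 2) ?sqr_ge0//; ring.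
set c := I _ in q *.
have := norm2_ge0 f; have := norm2_ge0 g; move: (n2 f) (n2 g) q => u v q v0 u0.
suff: `|c| ^+ 2 <= (u * v) ^+ 2 by rewrite ler_sqr// nnegrE mulr_ge0.
rewrite real_normK ?num_real//.
have [u00|un0] := eqVneq u 0.
  have {}q a : 0 <= 2 * a * c + v ^+ 2 by have := q a; rewrite u00; nra.
  have -> : c = 0; last by rewrite expr0n sqr_ge0.
  apply/eqP/contraT => cn0.
  (* Were [c] nonzero, the remaining affine function of [a] would take the value -1 at this
     point. *)
  have := q (- (v ^+ 2 + 1) / (2 * c)); rewrite (_ : _ + _ = - 1) ?lerNgt; last by field.
  by lra.
have up : 0 < u ^+ 2 by rewrite exprn_gt0// lt_neqAle eq_sym un0.
(* The minimiser of the quadratic in [a]. *)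
have := q (- c / u ^+ 2); rewrite (_ : _ + _ + _ = v ^+ 2 - c ^+ 2 / u ^+ 2); last by field.
by rewrite subr_ge0 ler_pdivrMr// exprMn mulrC.
Qed.

Lemma norm2_triangle f g : L2 f -> L2 g -> n2 (fun x => f x + g x) <= n2 f + n2 g.
Proof.
move=> lf lg.
have : n2 (fun x => f x + g x) ^+ 2 <= (n2 f + n2 g) ^+ 2; last first.
  by rewrite ler_sqr// nnegrE ?addr_ge0 ?norm2_ge0.
have cs := le_trans (ler_norm _) (cauchy_schwarz lf lg).
rewrite sqr_norm2 sqrrD !sqr_norm2.
rewrite (_ : I _ = I (fun x => f x ^+ 2) + 2 * I (fun x => f x * g x) + I (fun x => g x ^+ 2)).
  by nra.
rewrite -RintZ -?RintD; [|auto..|exact: L2M]; first last.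
- by apply: L1Z; exact: L2M.
- by apply: L1D; auto; apply: L1Z; exact: L2M.
by apply: Rint_eq => x _; ring.
Qed.

Lemma norm2Z a f : L2 f -> n2 (fun x => a * f x) = `|a| * n2 f.
Proof.
move=> lf; rewrite /norm2 (_ : I _ = a ^+ 2 * I (fun x => f x ^+ 2)).
  by rewrite sqrtrM ?sqr_ge0// sqrtr_sqr.
by rewrite -RintZ; auto; apply: Rint_eq => x _; ring.
Qed.

Lemma norm2_distC f g : n2 (fun x => f x - g x) = n2 (fun x => g x - f x).
Proof. by congr Num.sqrt; apply: Rint_eq => x _; ring. Qed.

Lemma norm2_dist h f g : L2 f -> L2 g -> L2 h ->
  n2 (fun x => f x - g x) <= n2 (fun x => f x - h x) + n2 (fun x => h x - g x).
Proof.
move=> lf lg lh; rewrite (norm2_eq (g := fun x => (f x - h x) + (h x - g x))).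
  by apply: norm2_triangle; exact: L2B.
by move=> x _; ring.
Qed.

Lemma norm2_sub f g : L2 f -> L2 g -> n2 f <= n2 g + n2 (fun x => f x - g x).
Proof.
move=> lf lg; rewrite (norm2_eq (g := fun x => g x + (f x - g x))).
  by apply: norm2_triangle => //; exact: L2B.
by move=> x _; ring.
Qed.

End L2.
Arguments Rint_eq {d T R mu D f g}.
Arguments norm2_eq {d T R mu D f g}.

(** * Limit theorems for real-valued integrals, and truncation *)

Section Convergence.
Context d (T : measurableType d) (R : realType).
Variables (mu : {measure set T -> \bar R}) (D : set T).
Hypothesis mD : measurable D.
Implicit Types f g : T -> R.
Notation L1 := (mem_L1 mu D).
Notation I := (Rintegral mu D).

Lemma Rint_dct (g : nat -> T -> R) f h : (forall n, measurable_fun D (g n)) -> L1 h ->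
  (forall n x, D x -> `|g n x| <= h x) ->
  (forall x, D x -> g n x @[n --> \oo] --> f x) ->
  L1 f /\ I (g n) @[n --> \oo] --> I f.
Proof.
move=> mg lh gh gf.
have mf : measurable_fun D f by exact: measurable_fun_cvg mg gf.
have [] := @dominated_convergence _ _ _ mu D mD (fun n x => (g n x)%:E) (EFin \o f) (EFin \o h).
- by move=> n; exact/measurable_EFinP.
- exact/measurable_EFinP.
- by apply: aeW => x Dx; apply: cvg_EFin; [exact: nearW|exact: gf].
- by [].
- by apply: aeW => x n Dx; rewrite /= lee_fin; exact: gh.
move=> lf _ cv; split=> //.
have fi : (\int[mu]_(x in D) (f x)%:E \is a fin_num)%E by exact: integrable_fin_num.
by apply: fine_cvg; rewrite /Rintegral fineK.
Qed.

(** Integrability of the limit is part of the conclusion: this is how a third moment is obtained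
    from uniformly bounded truncated ones. *)
Lemma Rint_fatou (g : nat -> T -> R) f M : (forall n, L1 (g n)) ->
  (forall n x, D x -> 0 <= g n x) ->
  (forall x, D x -> g n x @[n --> \oo] --> f x) ->
  (forall n, I (g n) <= M) -> L1 f /\ I f <= M.
Proof.
move=> lg g0 gf gM.
have mg n : measurable_fun D (g n) by exact: L1_meas (lg n).
have mf : measurable_fun D f by exact: measurable_fun_cvg mg gf.
have f0 x : D x -> 0 <= f x.
  move=> Dx; rewrite -(cvg_lim _ (gf x Dx))//.
  by apply: limr_ge; [apply/cvg_ex; exists (f x); exact: gf|apply: nearW => n; exact: g0].
have le : (\int[mu]_(x in D) (f x)%:E <= M%:E)%E.
  have := @fatou _ _ _ mu D mD (fun n x => (g n x)%:E).
  rewrite (eq_integral (fun x => (f x)%:E)); last first.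
    move=> x; rewrite inE => Dx.
    have h : (g n x)%:E @[n --> \oo] --> (f x)%:E.
      by apply: cvg_EFin; [exact: nearW|exact: gf].
    by have [-> _] := cvg_limn_einf_sup h.
  move=> h; apply: le_trans (h _ _) _.
  - by move=> n; exact/measurable_EFinP.
  - by move=> n x Dx; rewrite lee_fin g0.
  apply: (le_trans (limn_einf_sup _)); rewrite limn_esup_lim.
  apply: lime_le; first exact: is_cvg_esups.
  apply: nearW => n; apply: ge_ereal_sup => _ [k _ <-].
  have fk : (\int[mu]_(x in D) (g k x)%:E \is a fin_num)%E.
    by apply: integrable_fin_num => //; exact: lg.
  by rewrite -(fineK fk) lee_fin; exact: gM.
have lf : L1 f.
  apply/integrableP; split; first exact/measurable_EFinP.
  rewrite (eq_integral (fun x => (f x)%:E)); first by rewrite (le_lt_trans le) ?ltry.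
  by move=> x; rewrite inE => Dx; rewrite /= ger0_norm// f0.
split => //; rewrite -lee_fin /Rintegral fineK//.
exact: integrable_fin_num.
Qed.

(** A cut-off factor: it keeps values up to level [K] exactly, so identities proved for bounded
    functions extend to unbounded ones by dominated convergence ([Rint_trunc]). *)
Definition trunc (K y : R) : R := (`|y| <= K)%R%:R.

Lemma measurable_trunc K : measurable_fun setT (trunc K).
Proof.
rewrite (_ : trunc K = \1_(`[- K, K]%classic)); first exact: measurable_indic.
by apply/funext => y; rewrite indicE mem_setE in_itv/= -ler_norml.
Qed.

Lemma trunc_bound K y : `|trunc K y| <= 1.
Proof. by rewrite /trunc normr_nat; case: (`|y| <= K)%R; rewrite ?ler01. Qed.

Lemma trunc_ge0 K y : 0 <= trunc K y. Proof. exact: ler0n. Qed.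

Lemma trunc_cvg y : trunc n%:R y @[n --> \oo] --> (1 : R).
Proof.
apply/cvgrPdist_lt => e e0.
exists (Num.truncn `|y|).+1 => // n /= yn; rewrite /trunc (_ : (`|y| <= n%:R) = true) ?subrr ?normr0//.
apply: le_trans (ltW (truncnS_gt _)) _; by rewrite ler_nat.
Qed.

Lemma Rint_trunc f h : L1 f -> measurable_fun D h ->
  I (fun x => trunc n%:R (h x) * f x) @[n --> \oo] --> I f.
Proof.
move=> lf mh; apply: (Rint_dct (h := fun x => `|f x|) _ (L1_norm lf) _ _).2.
- move=> n; apply: measurable_funM; last exact: L1_meas lf.
  exact: measurableT_comp (measurable_trunc _) mh.
- by move=> n x _; rewrite normrM ler_piMl// trunc_bound.
- move=> x _; rewrite -[X in _ --> X]mul1r; apply: cvgM; last exact: cvg_cst.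
  exact: trunc_cvg.
Qed.

Lemma L1_bounded f g M : measurable_fun D f -> (forall x, D x -> `|f x| <= M) ->
  L1 g -> L1 (fun x => f x * g x).
Proof.
move=> mf fM lg; apply: (L1_le mD (g := fun x => M * `|g x|)).
- by apply: measurable_funM => //; exact: L1_meas lg.
- by apply: L1Z => //; exact: L1_norm.
- by move=> x Dx; rewrite normrM ler_wpM2r// fM.
Qed.

Lemma Rint_ae_eq f g : L1 f -> L1 g -> {ae mu, forall x, D x -> f x = g x} -> I f = I g.
Proof.
move=> lf lg fg; congr fine; apply: ae_eq_integral => //.
- exact: measurable_int lf.
- exact: measurable_int lg.
- by apply: filterS fg => x /= fgx Dx; rewrite fgx.
Qed.

End Convergence.

(** * Independence *)

Section Independence.
Context d (T : measurableType d) (R : realType) (P : probability T R).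

(* The joint law of [X] and [Y] is the product of the marginals, so Fubini applies. *)
Lemma indep_integral d1 d2 (T1 : measurableType d1) (T2 : measurableType d2)
  (X : T -> T1) (Y : T -> T2) (f : T1 -> R) (g : T2 -> R) :
  measurable_fun setT X -> measurable_fun setT Y ->
  (forall A B, measurable A -> measurable B ->
    P (X @^-1` A `&` Y @^-1` B) = (P (X @^-1` A) * P (Y @^-1` B))%E) ->
  measurable_fun setT f -> measurable_fun setT g ->
  mem_L1 P setT (f \o X) -> mem_L1 P setT (g \o Y) ->
  mem_L1 P setT (fun w => f (X w) * g (Y w)) /\
  Rintegral P setT (fun w => f (X w) * g (Y w)) = Rintegral P setT (f \o X) * Rintegral P setT (g \o Y).
Proof.
move=> mX mY XY mf mg lf lg.
pose X' : {mfun T >-> T1} := HB.pack X (isMeasurableFun.Build _ _ _ _ X mX).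
pose Y' : {mfun T >-> T2} := HB.pack Y (isMeasurableFun.Build _ _ _ _ Y mY).
pose V w := (X w, Y w).
have mV : measurable_fun setT V by apply: measurable_fun_pair.
pose V' : {mfun T >-> (T1 * T2)%type} := HB.pack V (isMeasurableFun.Build _ _ _ _ V mV).
pose m1 := distribution P X'; pose m2 := distribution P Y'.
pose m := distribution P V'.
have mE A : measurable A -> (m1 \x m2)%E A = m A.
  by move=> mA; apply: product_measure_unique.
pose h (z : T1 * T2) := (f z.1 * g z.2)%R.
have mh : measurable_fun setT h.
  by apply: measurable_funM; apply: measurableT_comp.
have i1 : m1.-integrable setT (EFin \o f).
  by apply: integrable_pushforward => //; exact/measurable_EFinP.
have i2 : m2.-integrable setT (EFin \o g).
  by apply: integrable_pushforward => //; exact/measurable_EFinP.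
have ih : (m1 \x m2)%E.-integrable setT (EFin \o h).
  apply/integrable12ltyP; first exact/measurable_EFinP.
  have -> : (\int[m1]_x \int[m2]_y `|(EFin \o h) (x, y)| =
      \int[m1]_x ((`|f x|)%:E * \int[m2]_y (`|g y|)%:E))%E.
    apply: eq_integral => x _; rewrite -ge0_integralZl//.
    - by apply: eq_integral => y _; rewrite /= normrM EFinM.
    - by apply/measurable_EFinP/measurableT_comp.
  rewrite ge0_integralZr//; [|by apply/measurable_EFinP/measurableT_comp|exact: integral_ge0].
  move/integrableP : i1 => [_]; move/integrableP : i2 => [_] /= k2 k1.
  by apply: lte_mul_pinfty => //; rewrite ?ge0_fin_numE ?integral_ge0.
have im : m.-integrable setT (EFin \o h).
  move/integrableP : ih => [mh' ih]; apply/integrableP; split => //.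
  by rewrite -(@eq_measure_integral _ _ _ _ _ (m1 \x m2)%E)// => A mA _; exact: mE.
have iV : mem_L1 P setT (h \o V).
  move/integrableP : im => [_]; rewrite ge0_integral_pushforward//; last first.
    by apply/measurableT_comp => //; exact/measurable_EFinP.
  move=> ioo; apply/integrableP; split => //.
  by apply/measurable_EFinP; apply: measurableT_comp.
split => //.
rewrite /Rintegral.
transitivity (fine (\int[m]_z (h z)%:E)).
  by rewrite (@integral_pushforward _ _ _ _ _ V)//; exact/measurable_EFinP.
rewrite -(@eq_measure_integral _ _ _ _ _ (m1 \x m2)%E); last by move=> A mA _; exact: mE.
rewrite -(integral12_prod_meas1 ih).
have f2 : (\int[m2]_y (g y)%:E \is a fin_num)%E by exact: integrable_fin_num.
have -> : (\int[m1]_x fubini_F m2 (EFin \o h) x =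
    \int[m1]_x ((f x)%:E * \int[m2]_y (g y)%:E))%E.
  apply: eq_integral => x _; rewrite -integralZl//.
rewrite -(fineK f2) integralZr//.
have f1 : (\int[m1]_y (f y)%:E \is a fin_num)%E by exact: integrable_fin_num.
rewrite fineM// fineK//.
congr (fine _ * fine _); rewrite /m1 /m2.
  by rewrite (@integral_pushforward _ _ _ _ _ X)//; exact/measurable_EFinP.
by rewrite (@integral_pushforward _ _ _ _ _ Y)//; exact/measurable_EFinP.
Qed.

End Independence.

Section Cylinders.
Context (R : realType).

(** A pi-system generating the product sigma-algebra of the coordinates in [D]. The index sets are
    lists because independence is stated for lists. *)
Definition cyl (D : set int) : set (set (int -> R)) :=
  [set C | exists (s : seq int) (A : int -> set R), [/\ forall i, i \in s -> D i, forall i, measurable (A i) &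
    C = [set z : int -> R | forall i, i \in s -> A i (z i)]]].

(* A measurable function on [cylT D] depends only on the coordinates in [D]. *)
Definition cylT (D : set int) := g_sigma_algebraType (cyl D).

Lemma cyl_setI D : setI_closed (cyl D).
Proof.
move=> _ _ [s [A [sD mA ->]]] [s' [A' [sD' mA' ->]]].
exists (s ++ s'), (fun i => (if i \in s then A i else setT) `&`
  (if i \in s' then A' i else setT)); split.
- by move=> i; rewrite mem_cat => /orP[]; auto.
- by move=> i; apply: measurableI; case: ifP.
- apply/seteqP; split => z /=.
    by move=> [h h'] i _; split; case: ifP; auto.
  move=> h; split => i si; have /h : i \in s ++ s' by rewrite mem_cat si ?orbT.
    by rewrite si => -[].
  by rewrite si => -[].
Qed.

Lemma cylTT D : cyl D setT.
Proof.
exists [::], (fun=> setT); split => //.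
by apply/seteqP; split.
Qed.

Lemma measurable_coord D i : D i ->
  measurable_fun setT (fun z : cylT D => (z : int -> R) i).
Proof.
move=> Di _ B mB; rewrite setTI; apply: sub_sigma_algebra.
exists [:: i], (fun=> B); split => //.
- by move=> j; rewrite inE => /eqP ->.
- apply/seteqP; split => z /= h; last by apply: h; rewrite inE.
  by move=> j; rewrite inE => /eqP ->.
Qed.

Lemma measurable_to_cyl d (T : measurableType d) (Z : int -> T -> R) D :
  (forall i, D i -> measurable_fun setT (Z i)) ->
  measurable_fun setT ((fun w => Z ^~ w) : T -> cylT D).
Proof.
move=> measurable_innov; apply: (@measurability _ _ T (cylT D) setT _ (cyl D)) => //.
move=> _ [_ [s [A [sD mA ->]]] <-]; rewrite setTI.
rewrite (_ : _ @^-1` _ = \bigcap_(i in [set i | i \in s]) (Z i @^-1` A i)); last first.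
  by apply/seteqP; split.
apply: fin_bigcap_measurable => [|i /sD Di]; first exact: finite_seq.
by rewrite -[X in measurable X]setTI; exact: measurable_innov.
Qed.

End Cylinders.

Section IID.
Context d (T : measurableType d) (R : realType) (P : probability T R).
Variable Z : int -> {RV P >-> R}.
Hypothesis Zind : mutually_independent P (fun i => Z i : T -> R).
Hypothesis Zid : identically_distributed P (fun i => Z i : T -> R).

Lemma measurable_innov i : measurable_fun setT (Z i : T -> R).
Proof. exact: measurable_funPT. Qed.

Lemma measurable_preimage_innov i (A : set R) : measurable A -> measurable (Z i @^-1` A).
Proof. by move=> mA; rewrite -[X in measurable X]setTI; exact: measurable_innov. Qed.

(** A cylinder may list a coordinate twice, with the same constraint each time, while independence
    is stated for duplicate-free lists; hence [undup]. *)
Lemma P_cyl (s : seq int) (A : int -> set R) : (forall i, measurable (A i)) ->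
  P [set w | forall i, i \in s -> A i (Z i w)] =
  (\prod_(i <- undup s) P (Z i @^-1` A i))%E.
Proof.
move=> mA; rewrite -(Zind (undup_uniq s))//.
congr (P _); apply/seteqP; split => w /= h i; first by rewrite /= mem_undup; exact: h.
by rewrite -mem_undup => /h.
Qed.

(** As functions of [C] both sides are finite measures that agree on the pi-system of cylinders,
    hence on its sigma-algebra. *)
Lemma cyl_indep (D : set int) j (C : set (cylT R D)) B : ~ D j ->
  measurable C -> measurable B ->
  P ((fun w => Z ^~ w) @^-1` C `&` Z j @^-1` B) =
  (P ((fun w => (Z ^~ w : cylT R D)) @^-1` C) * P (Z j @^-1` B))%E.
Proof.
move=> Dj mC mB.
pose ze w : cylT R D := Z ^~ w.
have mze : measurable_fun setT ze by apply: measurable_to_cyl => i _; exact: measurable_innov.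
pose ze' : {mfun T >-> cylT R D} := HB.pack ze (isMeasurableFun.Build _ _ _ _ ze mze).
pose E := Z j @^-1` B; have mE : measurable E by exact: measurable_preimage_innov.
pose m1 := measure_function_pushforward__canonical__measure_function_Measure
  (mrestr P mE) mze.
have pE : P E \is a fin_num by exact: fin_num_measure.
pose r : {nonneg R} := NngNum (fine_ge0 (measure_ge0 P E)).
pose m2 := mscale r (distribution P ze').
suff : m1 C = m2 C by rewrite /m1 /m2 /mscale /distribution /pushforward /mrestr /= fineK// muleC.
refine (@measure_unique _ R (cylT R D) (cyl D) (fun=> setT) _ _ _ _ m1 (mscale r (distribution P ze')) _ _ C mC) => //.
- exact: cyl_setI.
- by move=> _; exact: cylTT.
- by rewrite bigcup_const.
- move=> _ [s [A [sD mA ->]]].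
  rewrite /= /mscale /distribution /pushforward /mrestr /r /= fineK//.
  (* Adding the constraint [B] at the new index [j] turns the intersection into a single cylinder
     event. *)
  pose A' i := if i == j then B else A i.
  have mA' i : measurable (A' i) by rewrite /A'; case: ifP.
  have js : j \notin s by apply/negP => /sD.
  transitivity (P [set w | forall i, i \in j :: s -> A' i (Z i w)]).
    congr (P _); apply/seteqP; split => w /=.
      move=> [h Ew] i; rewrite inE /A'; case: ifPn => [/eqP -> _//|ij /=]; exact: h.
    move=> h; split; last by have := h j; rewrite inE eqxx /A' eqxx; apply.
    move=> i si; have := h i; rewrite inE si orbT /A'.
    by case: eqP => [ij|_]; [rewrite -ij si in js|apply].
  rewrite P_cyl//= (negbTE js) big_cons /A' eqxx.
  congr (_ * _)%E; rewrite [RHS](P_cyl s mA) !big_seq; apply: eq_bigr => i; rewrite mem_undup.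
  by case: eqP => // -> si; rewrite si in js.
- move=> _; rewrite /m1 /= /pushforward /mrestr preimage_setT setTI.
  by rewrite (le_lt_trans (probability_le1 _ _)) ?ltry.
Qed.

(** An injective relabelling keeps the variables distinct, hence independent, so both sequences give
    cylinders the same product probability; the pi-system argument extends this to all events. *)
Lemma cyl_law (rho rho' : int -> int) (C : set (cylT R setT)) : cancel rho rho' ->
  measurable C ->
  P ((fun w => Z ^~ w) @^-1` C) = P ((fun w i => Z (rho i) w) @^-1` C).
Proof.
move=> irho mC.
pose ze w : cylT R setT := Z ^~ w.
have mze : measurable_fun setT ze by apply: measurable_to_cyl => i _; exact: measurable_innov.
pose ze' : {mfun T >-> cylT R setT} := HB.pack ze (isMeasurableFun.Build _ _ _ _ ze mze).
pose zr w : cylT R setT := (fun i => Z (rho i) w).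
have mzr : measurable_fun setT zr.
  by apply: (measurable_to_cyl (Z := fun i => Z (rho i))) => i _; exact: measurable_innov.
pose zr' : {mfun T >-> cylT R setT} := HB.pack zr (isMeasurableFun.Build _ _ _ _ zr mzr).
refine (@measure_unique _ R (cylT R setT) (cyl setT) (fun=> setT) _ _ _ _ (distribution P ze') (distribution P zr') _ _ C mC) => //.
- exact: cyl_setI.
- by move=> _; exact: cylTT.
- by rewrite bigcup_const.
- move=> _ [s [A [_ mA ->]]]; rewrite /distribution /pushforward/= [LHS]P_cyl//.
  (* The same event, read as a constraint on the original sequence at the relabelled indices. *)
  transitivity (P [set w | forall i, i \in map rho s -> (A \o rho') i (Z i w)]).
    rewrite P_cyl; last by move=> i; exact: mA.
    rewrite [RHS](perm_big (map rho (undup s))); last first.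
      apply: uniq_perm; rewrite ?map_inj_uniq ?undup_uniq//; first exact: can_inj irho.
      by move=> i; rewrite mem_undup; apply/mapP/mapP => -[j js ->]; exists j => //; rewrite mem_undup in js *.
    rewrite big_map; apply: eq_bigr => i _ /=; rewrite irho; exact: Zid.
  congr (P _); apply/seteqP; split => w /= h i.
    by move=> si; have := h _ (map_f rho si); rewrite irho.
  by move=> /mapP[j js ->]; rewrite irho; exact: h.
- by move=> _; rewrite /distribution /pushforward/=; rewrite (le_lt_trans (probability_le1 _ _)) ?ltry.
Qed.

End IID.

Section EqLaw.
Context d (T : measurableType d) (R : realType) (P : probability T R).

Lemma eq_law_integral d1 (T1 : measurableType d1) (X Y : T -> T1) (f : T1 -> R) :
  measurable_fun setT X -> measurable_fun setT Y ->
  (forall A, measurable A -> P (X @^-1` A) = P (Y @^-1` A)) ->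
  measurable_fun setT f -> mem_L1 P setT (f \o X) ->
  mem_L1 P setT (f \o Y) /\ Rintegral P setT (f \o X) = Rintegral P setT (f \o Y).
Proof.
move=> mX mY XY mf lf.
have e (h : T1 -> \bar R) :
    (\int[pushforward P X]_y h y = \int[pushforward P Y]_y h y)%E.
  by apply: eq_measure_integral => A mA _; exact: XY.
have iY : mem_L1 P setT (f \o Y).
  apply/integrableP; split.
    by apply/measurable_EFinP; exact: measurableT_comp.
  have := @ge0_integral_pushforward _ _ _ _ R Y mY P setT (fun y => (`|f y|)%:E).
  rewrite preimage_setT /= => <-//; last first.
    by apply/measurable_EFinP; exact: measurableT_comp.
  rewrite -e ge0_integral_pushforward//; last first.
    by apply/measurable_EFinP; exact: measurableT_comp.
  by move/integrableP : lf => [].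
split => //; rewrite /Rintegral; congr fine.
transitivity (\int[pushforward P X]_y (f y)%:E)%E.
  by rewrite (@integral_pushforward _ _ _ _ _ X)//; exact/measurable_EFinP.
rewrite e.
by rewrite (@integral_pushforward _ _ _ _ _ Y)//; exact/measurable_EFinP.
Qed.

End EqLaw.

(** * The closed span of the innovations *)

Section Innovations.
Context d (T : measurableType d) (R : realType) (P : probability T R).
Variable Z : int -> {RV P >-> R}.
Hypothesis iidZ : iid_innovations P Z.

Let mT : measurable [set: T] := measurableT.
Notation L1 := (mem_L1 P setT).
Notation L2 := (mem_L2 P setT).
Notation E := (Rintegral P setT).
Notation n2 := (norm2 P setT).

Hint Resolve measurable_innov : core.

Lemma innov_transfer i (g : R -> R) : measurable_fun setT g -> L1 (g \o Z 0) ->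
  L1 (g \o Z i) /\ E (g \o Z i) = E (g \o Z 0).
Proof.
move=> mg lg; have [_ Zid _ _ _] := iidZ.
have [|l e] := eq_law_integral (measurable_innov Z 0) (measurable_innov Z i) _ mg lg => //.
by move=> A mA; exact: Zid.
Qed.

Definition s2 := E (fun w => Z 0 w ^+ 2).

Lemma L2_innov i : L2 (Z i).
Proof.
have [_ _ l _ _] := iidZ; split => //.
by have [] := @innov_transfer i (fun x => x ^+ 2) _ l.
Qed.

Lemma L1_innov i : L1 (Z i).
Proof. by have [_ _ _ l _] := iidZ; have [] := @innov_transfer i id _ l. Qed.

Lemma E_innov i : E (Z i) = 0.
Proof.
have [_ _ _ l e] := iidZ; have [//|_ ->] := @innov_transfer i id _ l.
by rewrite -[RHS]e /Ex unlock.
Qed.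

Lemma E_innov_sqr i : E (fun w => Z i w ^+ 2) = s2.
Proof. by have [_ _ l _ _] := iidZ; have [] := @innov_transfer i (fun x => x ^+ 2) _ l. Qed.

Lemma s2_ge0 : 0 <= s2. Proof. by apply: Rint_ge0 => w _; exact: sqr_ge0. Qed.

Lemma indep_innov (D : set int) j (f : cylT R D -> R) (g : R -> R) : ~ D j ->
  measurable_fun setT f -> measurable_fun setT g ->
  L1 (fun w => f (Z ^~ w)) -> L1 (g \o Z j) ->
  L1 (fun w => f (Z ^~ w) * g (Z j w)) /\
  E (fun w => f (Z ^~ w) * g (Z j w)) = E (fun w => f (Z ^~ w)) * E (g \o Z j).
Proof.
move=> Dj mf mg lf lg; have [Zind Zid _ _ _] := iidZ.
apply: (@indep_integral _ _ _ P _ _ (cylT R D) _ (fun w => Z ^~ w)) => //.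
- by apply: measurable_to_cyl => i _; exact: measurable_innov.
- by move=> A B mA mB; exact: cyl_indep.
Qed.

Lemma E_innov_mul i j : E (fun w => Z i w * Z j w) = s2 * (i == j)%:R.
Proof.
have [->|ij] := eqVneq i j.
  by rewrite mulr1 -(E_innov_sqr j); apply: Rint_eq => w _; rewrite expr2.
have [||||//|_ ->] := @indep_innov [set i] j (fun z => z i) id.
- by move=> /= /esym/eqP; rewrite (negbTE ij).
- exact: measurable_coord.
- exact: measurable_id.
- exact: L1_innov.
- exact: L1_innov.
by rewrite E_innov mul0r mulr0.
Qed.

Definition comb (s : seq int) (a : int -> R) (w : T) : R := \sum_(i <- s) a i * Z i w.

Lemma L2comb s a : L2 (comb s a).
Proof. by apply: L2_sum => // i; apply: L2Z => //; exact: L2_innov. Qed.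

Lemma comb_norm0 s a : s2 = 0 -> n2 (comb s a) = 0.
Proof.
move=> s0; have n2Z0 i : n2 (Z i) = 0 by rewrite /norm2 E_innov_sqr s0 sqrtr0.
have lZ i b : L2 (fun w => b * Z i w) by apply: L2Z => //; exact: L2_innov.
elim: s => [|i s ih]; first by rewrite /norm2 (Rint_eq (g := fun=> 0)) ?Rint0 ?sqrtr0// => w _; rewrite /comb big_nil expr0n.
apply/le_anti; rewrite norm2_ge0 andbT (norm2_eq (g := fun w => a i * Z i w + comb s a w)); last first.
  by move=> w _; rewrite /comb big_cons.
apply: le_trans (norm2_triangle mT (lZ i (a i)) (L2comb s a)) _.
by rewrite ih (norm2Z mT (a i) (L2_innov i)) n2Z0 mulr0 addr0.
Qed.

Definition cf (U : T -> R) k := E (fun w => U w * Z k w) / s2.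

Hypothesis s2_neq0 : s2 != 0.

Lemma s2_gt0 : 0 < s2. Proof. by rewrite lt_neqAle eq_sym s2_neq0 s2_ge0. Qed.

Lemma cfE U k : E (fun w => U w * Z k w) = s2 * cf U k.
Proof. by rewrite mulrC divfK. Qed.

Lemma E_comb U s a : L2 U -> E (fun w => U w * comb s a w) = s2 * \sum_(i <- s) a i * cf U i.
Proof.
move=> lU; rewrite (Rint_eq (g := fun w => \sum_(i <- s) a i * (U w * Z i w))); last first.
  by move=> w _; rewrite /comb big_distrr/=; apply: eq_bigr => i _; ring.
rewrite Rint_sum//; last by move=> i; apply: L1Z => //; apply: L2M => //; exact: L2_innov.
rewrite big_distrr/=; apply: eq_bigr => i _; rewrite RintZ//.
  by rewrite cfE; ring.
by apply: L2M => //; exact: L2_innov.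
Qed.

Lemma cf_comb s a k : uniq s -> cf (comb s a) k = if k \in s then a k else 0.
Proof.
move=> us; apply: (mulfI s2_neq0); rewrite -cfE.
rewrite (Rint_eq (g := fun w => \sum_(i <- s) a i * (Z i w * Z k w))); last first.
  by move=> w _; rewrite /comb big_distrl/=; apply: eq_bigr => i _; ring.
rewrite Rint_sum//; last first.
  by move=> i; apply: L1Z => //; apply: L2M => //; exact: L2_innov.
under eq_bigr => i _.
  rewrite RintZ//; last by apply: L2M => //; exact: L2_innov.
  rewrite E_innov_mul; over.
case: ifPn => ks.
  rewrite (bigD1_seq k)//= eqxx mulr1 big1 ?addr0; first by rewrite mulrC.
  by move=> i /negbTE ->; rewrite !mulr0.
rewrite mulr0 big_seq big1// => i si.
by case: eqP => [ik|]; [rewrite -ik si in ks|rewrite !mulr0].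
Qed.

Lemma norm2_comb s a : uniq s -> n2 (comb s a) ^+ 2 = s2 * \sum_(i <- s) a i ^+ 2.
Proof.
move=> us; rewrite sqr_norm2// (Rint_eq (g := fun w => comb s a w * comb s a w)); last first.
  by move=> w _; rewrite expr2.
rewrite E_comb; last exact: L2comb.
congr (_ * _); rewrite !big_seq; apply: eq_bigr => i si.
by rewrite cf_comb// si expr2.
Qed.

(** Completing the square in the coefficients: the last sum is the price of not using the Fourier
    coefficients. Optimality of the projection and Bessel's inequality are read off from it. *)
Lemma norm2_sub_comb U s a : L2 U -> uniq s ->
  n2 (fun w => U w - comb s a w) ^+ 2 =
  n2 U ^+ 2 - s2 * \sum_(i <- s) cf U i ^+ 2 + s2 * \sum_(i <- s) (a i - cf U i) ^+ 2.
Proof.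
move=> lU us; have lc := L2comb s a.
transitivity (n2 U ^+ 2 - 2 * E (fun w => U w * comb s a w) + n2 (comb s a) ^+ 2).
  rewrite !sqr_norm2// -RintZ//; last exact: L2M.
  rewrite -RintB//; [|exact: L2_sqr|by apply: L1Z => //; exact: L2M].
  rewrite -RintD//; [|apply: L1B => //; [exact: L2_sqr|by apply: L1Z => //; exact: L2M]|exact: L2_sqr].
  by apply: Rint_eq => w _; ring.
rewrite E_comb// norm2_comb//.
have -> : \sum_(i <- s) (a i - cf U i) ^+ 2 = \sum_(i <- s) a i ^+ 2
    - 2 * (\sum_(i <- s) a i * cf U i) + \sum_(i <- s) cf U i ^+ 2.
  by rewrite big_distrr/= -sumrB -big_split/=; apply: eq_bigr => i _; ring.
ring.
Qed.

(* Membership in the closed linear span of the innovations: the Fourier sums of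
   [U] converge to [U] along the finite sets of indices. *)
Definition clos U := L2 U /\ forall e, 0 < e -> exists2 s, uniq s &
  forall s', uniq s' -> {subset s <= s'} -> n2 (fun w => U w - comb s' (cf U) w) < e.

(** The Fourier sum over [s'] is the orthogonal projection on a span that contains [comb Z s a]. *)
Lemma norm2_proj_le U s a s' : L2 U -> uniq s -> uniq s' -> {subset s <= s'} ->
  n2 (fun w => U w - comb s' (cf U) w) <= n2 (fun w => U w - comb s a w).
Proof.
move=> lU us us' ss'; suff : n2 (fun w => U w - comb s' (cf U) w) ^+ 2 <= n2 (fun w => U w - comb s a w) ^+ 2.
  by rewrite ler_sqr// nnegrE norm2_ge0.
rewrite !norm2_sub_comb//.
rewrite [X in _ - _ + s2 * X]big1 ?mulr0 ?addr0; last first.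
  by move=> i _; rewrite subrr expr0n.
apply: ler_wpDr; first by rewrite mulr_ge0 ?s2_ge0// sumr_ge0// => i _; exact: sqr_ge0.
rewrite lerB// ler_wpM2l ?s2_ge0//.
have pe : perm_eq s' (s ++ [seq i <- s' | i \notin s]).
  apply: uniq_perm => //.
    rewrite cat_uniq us filter_uniq// andbT; apply/hasPn => i.
    by rewrite mem_filter => /andP[].
  by move=> i; rewrite mem_cat mem_filter; case: (boolP (i \in s)) => //= /ss'.
by rewrite (perm_big _ pe) big_cat/= lerDl sumr_ge0// => i _; exact: sqr_ge0.
Qed.

Lemma closP U : L2 U ->
  (forall e, 0 < e -> exists s a, uniq s /\ n2 (fun w => U w - comb s a w) < e) -> clos U.
Proof.
move=> lU h; split => // e /h [s [a [us lt]]]; exists s => // s' us' ss'.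
by apply: le_lt_trans lt; exact: norm2_proj_le.
Qed.

Lemma bessel U s : L2 U -> uniq s -> s2 * \sum_(i <- s) cf U i ^+ 2 <= n2 U ^+ 2.
Proof.
move=> lU us; have := sqr_ge0 (n2 (fun w => U w - comb s (cf U) w)).
rewrite norm2_sub_comb// [X in _ + s2 * X]big1 ?mulr0 ?addr0; last first.
  by move=> i _; rewrite subrr expr0n.
by rewrite subr_ge0.
Qed.

Lemma cf_le U k : L2 U -> s2 * cf U k ^+ 2 <= n2 U ^+ 2.
Proof. by move=> lU; have := @bessel U [:: k] lU isT; rewrite big_seq1. Qed.

Lemma cfD U V k : L2 U -> L2 V -> cf (fun w => U w + V w) k = cf U k + cf V k.
Proof.
move=> lU lV; rewrite /cf -mulrDl -RintD//; [|by apply: L2M => //; exact: L2_innov..].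
by congr (_ / _); apply: Rint_eq => w _; ring.
Qed.

Lemma cfZ a U k : L2 U -> cf (fun w => a * U w) k = a * cf U k.
Proof.
move=> lU; rewrite /cf mulrA -RintZ//; [|by apply: L2M => //; exact: L2_innov..].
by congr (_ / _); apply: Rint_eq => w _; ring.
Qed.

Lemma cfB U V k : L2 U -> L2 V -> cf (fun w => U w - V w) k = cf U k - cf V k.
Proof.
move=> lU lV; rewrite /cf -mulrBl -RintB//; [|by apply: L2M => //; exact: L2_innov..].
by congr (_ / _); apply: Rint_eq => w _; ring.
Qed.

Lemma closD U V : clos U -> clos V -> clos (fun w => U w + V w).
Proof.
move=> [lU hU] [lV hV]; apply: closP; first exact: L2D.
move=> e e0; have e20 : 0 < e / 2 by lra.
have [s us hs] := hU _ e20; have [s' us' hs'] := hV _ e20.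
pose r := undup (s ++ s'); have ur : uniq r by exact: undup_uniq.
exists r, (fun i => cf U i + cf V i); split => //.
have {}hs : n2 (fun w => U w - comb r (cf U) w) < e / 2.
  by apply: hs => // i si; rewrite mem_undup mem_cat si.
have {}hs' : n2 (fun w => V w - comb r (cf V) w) < e / 2.
  by apply: hs' => // i si; rewrite mem_undup mem_cat si orbT.
have := ltrD hs hs'; rewrite -splitr; apply: le_lt_trans.
rewrite (norm2_eq (g := fun w => (U w - comb r (cf U) w) + (V w - comb r (cf V) w))).
  by apply: norm2_triangle => //; apply: L2B => //; exact: L2comb.
move=> w _; rewrite /comb.
under eq_bigr do rewrite mulrDl.
by rewrite big_split/=; ring.
Qed.

Lemma closZ a U : clos U -> clos (fun w => a * U w).
Proof.
move=> [lU hU]; apply: closP; first exact: L2Z.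
move=> e e0; have a0 : 0 < `|a| + 1 by rewrite ltr_wpDl.
have [s us /(_ s us (fun _ => id)) hs] := hU _ (divr_gt0 e0 a0).
exists s, (fun i => a * cf U i); split => //.
rewrite (norm2_eq (g := fun w => a * (U w - comb s (cf U) w))).
  rewrite norm2Z//; last by apply: L2B => //; exact: L2comb.
  rewrite ltr_pdivlMr// in hs.
  apply: le_lt_trans hs; rewrite mulrC ler_wpM2l ?norm2_ge0//; lra.
move=> w _; rewrite /comb mulrBr big_distrr/=; congr (_ - _).
by apply: eq_bigr => i _; ring.
Qed.

End Innovations.

(** * Mean and Fourier coefficients of a moving average *)

Section LinearSeries.
Context d (T : measurableType d) (R : realType) (P : probability T R).
Variable Z : int -> {RV P >-> R}.
Hypothesis iidZ : iid_innovations P Z.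

Let mT : measurable [set: T] := measurableT.
Notation L1 := (mem_L1 P setT).
Notation L2 := (mem_L2 P setT).
Notation E := (Rintegral P setT).
Notation n2 := (norm2 P setT).
Notation cf := (cf Z).
Notation clos := (clos Z).

Lemma L2_cst a : L2 (fun=> a).
Proof. by split; [exact: measurable_cst|exact: finite_measure_integrable_cst]. Qed.

Lemma E_cst a : E (fun=> a) = a.
Proof.
rewrite Rintegral_cst// -[RHS]mulr1; congr (_ * _); exact: (congr1 fine (probability_setT P)).
Qed.

Lemma L2_L1 U : L2 U -> L1 U.
Proof. by move=> lU; apply: (L1_eq mT _ (L2M mT lU (L2_cst 1))) => w _; rewrite mulr1. Qed.

Lemma E_le_n2 U : L2 U -> `|E U| <= n2 U.
Proof.
move=> lU; have := cauchy_schwarz mT lU (L2_cst 1).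
have -> : n2 (fun=> 1) = 1 by rewrite /norm2 E_cst expr1n sqrtr1.
by rewrite mulr1; under Rint_eq do rewrite mulr1.
Qed.

Lemma E_comb0 s a : E (comb Z s a) = 0.
Proof.
rewrite Rint_sum//; last by move=> i; apply: L1Z => //; exact: L1_innov.
by rewrite big1// => i _; rewrite RintZ// ?E_innov ?mulr0//; exact: L1_innov.
Qed.

Variables (c : int -> R) (X : int -> {RV P >-> R}).
Hypothesis Xlim : forall t : int,
  (\int[P]_w (((X t w - ma_partial_sum P c Z t n w) ^+ 2)%:E))%E @[n --> \oo] --> 0%E.

Definition window (t : int) n : seq int :=
  [seq t - i%:Z | i <- index_iota 0 n.+1] ++ [seq t + i%:Z | i <- index_iota 1 n.+1].

Lemma window_uniq t n : uniq (window t n).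
Proof.
rewrite cat_uniq !map_inj_uniq ?iota_uniq//=; first last.
- by move=> i j /(addrI t)/oppr_inj [].
- by move=> i j /(addrI t) [].
rewrite andbT; apply/hasPn => _ /mapP[j + ->]; rewrite mem_index_iota => /andP[j1 _].
apply/negP => h; have /mapP[i _ tj] : t + j%:Z \in [seq t - i%:Z | i <- index_iota 0 n.+1] by exact: h.
have ji := addrI t tj.
have : (0 : int) < 0; last by rewrite ltxx.
apply: (@lt_le_trans _ _ j%:Z); first by rewrite ltz_nat.
by rewrite ji oppr_le0.
Qed.

Lemma ma_comb t n : ma_partial_sum P c Z t n = comb Z (window t n) (fun k => c (t - k)).
Proof.
apply/funext => w; rewrite /ma_partial_sum /comb /window big_cat !big_map.
by congr (_ + _); apply: eq_bigr => i _; congr (c _ * _); lia.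
Qed.

Lemma mem_window t n k : (`|t - k| <= n)%N -> k \in window t n.
Proof.
move=> kn; rewrite mem_cat; case: (lerP k t) => kt; apply/orP; [left|right].
  apply/mapP; exists `|t - k|%N; first by rewrite mem_index_iota; lia.
  lia.
apply/mapP; exists `|t - k|%N; first by rewrite mem_index_iota; lia.
lia.
Qed.

(** Convergence in the extended reals makes the squared errors finite only eventually, so square
    integrability of the difference comes together with [N]; square integrability of [X t] is
    deduced from it. *)
Lemma X_comb t e : 0 < e -> exists N, forall n, (N <= n)%N ->
  L2 (fun w => X t w - comb Z (window t n) (fun k => c (t - k)) w) /\
  n2 (fun w => X t w - comb Z (window t n) (fun k => c (t - k)) w) < e.
Proof.
move=> e0; have := Xlim t => /fine_cvgP[/= fin /cvgrPdist_lt/(_ (e ^+ 2) (exprn_gt0 _ e0))].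
move: fin => [N1 _ h1] [N2 _ h2].
exists (maxn N1 N2) => n; rewrite geq_max => /andP[n1 n2'].
have {}h1 := h1 n n1; have {}h2 := h2 n n2'.
have mD : measurable_fun setT (fun w => X t w - comb Z (window t n) (fun k => c (t - k)) w).
  apply: measurable_funB; first exact: measurable_funPT.
  exact: (L2_meas (L2comb iidZ _ _)).
rewrite -ma_comb in mD *; split.
  split => //; apply/integrableP; split.
    by apply/measurable_EFinP; apply: measurable_funX.
  rewrite (eq_integral (fun w => ((X t w - ma_partial_sum P c Z t n w) ^+ 2)%:E)); last first.
    by move=> w _; rewrite /= ger0_norm// sqr_ge0.
  by rewrite ltey_eq h1.
move: h2; rewrite /= sub0r normrN /norm2 => h2.
rewrite -(ger0_norm (ltW e0)) -sqrtr_sqr ltr_sqrt ?exprn_gt0//.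
apply: le_lt_trans h2; exact: ler_norm.
Qed.

Lemma L2X t : L2 (X t).
Proof.
have [N /(_ N (leqnn _))[l _]] := X_comb t ltr01.
apply: (L2_eq mT _ (L2D mT l (L2comb iidZ (window t N) (fun k => c (t - k))))) => //.
by move=> w _; rewrite subrK.
Qed.

(** Serves to exclude degenerate innovations, which would contradict a positive spectral density. *)
Lemma X_norm0 t : s2 Z = 0 -> n2 (X t) = 0.
Proof.
move=> s0; apply/le_anti/andP; split; last exact: norm2_ge0.
apply/ler_addgt0Pl => e e0; rewrite addr0.
have [N /(_ N (leqnn _))[l le]] := X_comb t e0.
apply: le_trans (ltW le); set S := comb Z _ _ in l *.
have lS : L2 S by exact: L2comb.
have := norm2_triangle mT l lS; rewrite (comb_norm0 iidZ _ _ s0) addr0.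
by apply: le_trans; rewrite (norm2_eq (g := X t))// => w _; rewrite subrK.
Qed.

Hypothesis s2_neq0 : s2 Z != 0.

Lemma clos_mean U : clos U -> E U = 0.
Proof.
move=> [lU h]; apply/eqP; rewrite -normr_eq0; apply/eqP/le_anti/andP; split => //.
apply/ler_addgt0Pl => e e0; rewrite addr0.
have [s us /(_ s us (fun _ => id)) hs] := h _ e0.
apply: le_trans (ltW hs).
have lc : L2 (comb Z s (cf U)) by exact: L2comb.
apply: le_trans (E_le_n2 (L2B mT lU lc)).
by rewrite RintB ?E_comb0 ?subr0//; exact: L2_L1.
Qed.

Lemma clos_X t : clos (X t).
Proof.
apply: (closP iidZ s2_neq0 (L2X t)) => e e0.
have [N /(_ N (leqnn _))[_ l]] := X_comb t e0.
by exists (window t N), (fun k => c (t - k)); split => //; exact: window_uniq.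
Qed.

Lemma cf_X t k : cf (X t) k = c (t - k).
Proof.
apply/eqP; rewrite -subr_eq0 -normr_eq0; apply/eqP/le_anti/andP; split => //.
apply/ler_addgt0Pl => e e0; rewrite addr0.
have s0 : 0 < s2 Z := s2_gt0 s2_neq0.
(* Bessel's inequality bounds [s2 Z] times the squared coefficient, hence the factor [sqrt s2] in
   the tolerance. *)
have e1 : 0 < e * Num.sqrt (s2 Z) by rewrite mulr_gt0// sqrtr_gt0.
have [N h] := X_comb t e1.
(* Far enough for the approximation and for the window to contain [k]. *)
pose n := maxn N `|t - k|%N.
have [lD hn] := h n (leq_maxl _ _).
set S := comb Z _ _ in lD hn.
have kw : k \in window t n by apply: mem_window; exact: leq_maxr.
have <- : cf S k = c (t - k) by rewrite cf_comb// ?kw//; exact: window_uniq.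
have lS : L2 S by exact: L2comb.
rewrite -cfB//; last exact: L2X.
have : s2 Z * cf (fun w => X t w - S w) k ^+ 2 <= (e * Num.sqrt (s2 Z)) ^+ 2.
  apply: le_trans (cf_le iidZ s2_neq0 k lD) _.
  by rewrite ler_sqr ?nnegrE ?norm2_ge0 ?(ltW hn)// ltW.
move: (cf _ k) => x; rewrite exprMn sqr_sqrtr ?(ltW s0)// mulrC ler_pM2r// => h2.
by rewrite -ler_sqr ?nnegrE ?(ltW e0)// real_normK ?num_real.
Qed.

End LinearSeries.

(** * From coefficients to joint laws *)

Section AlmostSure.
Context d (T : measurableType d) (R : realType) (P : probability T R).

Lemma ae_measure_eq (A B : set T) : measurable A -> measurable B ->
  {ae P, forall w, A w <-> B w} -> P A = P B.
Proof.
move=> mA mB [N [mN PN AB]].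
have le (C D : set T) : measurable C -> measurable D -> (forall w, ~ N w -> C w -> D w) -> (P C <= P D)%E.
  move=> mC mD CD; apply: (@le_trans _ _ (P (D `|` N))).
    apply: le_measure; rewrite ?inE//; first exact: measurableU.
    by move=> w Cw; case: (pselect (N w)) => Nw; [right|left; exact: CD].
  have -> // : P (D `|` N) = P D by rewrite measureU0.
by apply/le_anti/andP; split; apply: le => // w Nw; have := contra_not (@AB w) Nw;
  rewrite /= not_notE => -[].
Qed.

(** The squared errors have summable expectations, so their sum is integrable, hence finite almost
    surely, and its terms tend to 0. *)
Lemma ae_cvg (V : nat -> T -> R) U :
  (forall n, mem_L2 P setT (fun w => U w - V n w)) ->
  (forall n, Rintegral P setT (fun w => (U w - V n w) ^+ 2) <= 1 / (2 ^ n.+1)%:R) ->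
  {ae P, forall w, V n w @[n --> \oo] --> U w}.
Proof.
move=> lV hV.
pose g n w := ((U w - V n w) ^+ 2)%:E.
have g0 n w : (0 <= g n w)%E by rewrite lee_fin sqr_ge0.
have s0 m w : (0 <= \sum_(m <= n <oo) g n w)%E by apply: nneseries_ge0.
have mg n : measurable_fun setT (g n).
  by apply/measurable_EFinP; apply: measurable_funX; case: (lV n).
have ig : P.-integrable setT (fun w => \sum_(n <oo) g n w)%E.
  apply/integrableP; split; first by apply: ge0_emeasurable_sum.
  rewrite (eq_integral (fun w => \sum_(n <oo) g n w)%E); last by move=> w _; rewrite gee0_abs.
  rewrite integral_nneseries//.
  apply: le_lt_trans (ltry 1); apply: le_trans (epsilon_trick0 xpredT ler01).
  apply: lee_nneseries => [n _ _|n _]; first exact: integral_ge0.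
  have := hV n; rewrite -lee_fin; apply: le_trans.
  rewrite /Rintegral fineK//; apply: integrable_fin_num => //.
  exact: L2_sqr.
have := integrable_ae measurableT ig; apply: filterS => w /(_ Logic.I) fin.
have goo : (\sum_(0 <= n <oo) g n w < +oo)%E by rewrite ltey_eq fin.
(* The tails of a finite sum tend to 0, and each squared error is at most the tail that starts with
   it. *)
have /fine_cvgP[_] := nneseries_tail_cvg goo (fun k _ => g0 k w).
move=> /cvgrPdist_lt h; apply/cvgrPdist_lt => e e0.
have := h _ (exprn_gt0 2 e0); apply: filterS => n /=.
rewrite sub0r normrN => hn.
rewrite -ltr_sqr ?nnegrE ?(ltW e0)// real_normK ?num_real//.
apply: le_lt_trans hn; rewrite ger0_norm; last first.
  by rewrite fine_ge0.
rewrite -lee_fin fineK; last first.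
  rewrite ge0_fin_numE//.
  apply: le_lt_trans goo; rewrite [leRHS](nneseries_split 0 n)// leeDr// sume_ge0//.
have := @nneseries_lim_ge _ (fun n => g n w) xpredT n n.+1 (fun k _ _ => g0 k w).
by rewrite big_nat1.
Qed.

End AlmostSure.

Section Law.
Context d (T : measurableType d) (R : realType) (P : probability T R).
Variable Z : int -> {RV P >-> R}.
Hypothesis iidZ : iid_innovations P Z.
Hypothesis s2_neq0 : s2 Z != 0.
Let mT : measurable [set: T] := measurableT.
Notation cf := (cf Z).
Notation clos := (clos Z).

(* Both families are almost surely the same measurable function, once of the
   sequence [Z] and once of the equidistributed sequence [Z o rho]. *)
Lemma same_law m (X X' : 'I_m -> T -> R) (rho rho' : int -> int) :
  cancel rho rho' -> cancel rho' rho ->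
  (forall j, clos (X j)) -> (forall j, clos (X' j)) ->
  (forall j k, cf (X' j) (rho k) = cf (X j) k) ->
  forall A : set (m.-tuple R), measurable A ->
  P ((fun w => [tuple X j w | j < m]) @^-1` A) =
  P ((fun w => [tuple X' j w | j < m]) @^-1` A).
Proof.
move=> rK rK' cX cX' ecf A mA.
have lX j : mem_L2 P setT (X j) by case: (cX j).
have lX' j : mem_L2 P setT (X' j) by case: (cX' j).
have ri : injective rho := can_inj rK.
have comb_rho s a w : comb Z (map rho s) a w = \sum_(i <- s) a (rho i) * Z (rho i) w.
  by rewrite /comb big_map.
(* One index list must serve both families: a list good for [X] is merged with the preimage under
   [rho] of a list good for [X']. *)
have hs (jn : 'I_m * nat) : exists s : seq int,
    Rintegral P setT (fun w => (X jn.1 w - comb Z s (cf (X jn.1)) w) ^+ 2) <= 1 / (2 ^ jn.2.+1)%:R /\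
    Rintegral P setT (fun w => (X' jn.1 w - comb Z (map rho s) (cf (X' jn.1)) w) ^+ 2) <= 1 / (2 ^ jn.2.+1)%:R.
  case: jn => j n /=; set e := 1 / _; have e0 : 0 < e by rewrite divr_gt0// ltr0n expn_gt0.
  have se0 : 0 < Num.sqrt e by rewrite sqrtr_gt0.
  have [s us h] := (cX j).2 _ se0; have [s' us' h'] := (cX' j).2 _ se0.
  pose r := undup (s ++ map rho' s'); have ur : uniq r := undup_uniq _.
  have le V : norm2 P setT V < Num.sqrt e -> Rintegral P setT (fun w => V w ^+ 2) <= e.
    by move=> lt; rewrite -sqr_norm2// -(sqr_sqrtr (ltW e0)) ler_sqr ?nnegrE ?norm2_ge0// ltW.
  exists r; split; apply: le.
    by apply: h => // i si; rewrite mem_undup mem_cat si.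
  apply: h'; first by rewrite map_inj_uniq.
  move=> i si; rewrite -(rK' i) map_f// mem_undup mem_cat.
  by rewrite (map_f rho' si) orbT.
have [s hsj] := choice hs.
pose V j n (z : cylT R setT) := \sum_(i <- s (j, n)) cf (X j) i * (z : int -> R) i.
have mV j n : measurable_fun setT (V j n).
  rewrite /V; apply: measurable_sum => i.
  by apply: measurable_funM => //; exact: measurable_coord.
(* The upper limit exists and is measurable everywhere, and it equals the limit wherever the sums
   converge; its value elsewhere does not matter because the sums converge almost surely along both
   sequences. *)
pose Phi j z := fine (limn_esup (fun n => (V j n z)%:E)).
have mPhi j : measurable_fun setT (Phi j).
  apply: measurableT_comp => //; apply: measurable_fun_limn_esup => n.
  exact/measurable_EFinP.
have PhiE j z l : V j n z @[n --> \oo] --> l -> Phi j z = l.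
  move=> h; have h' : (V j n z)%:E @[n --> \oo] --> l%:E.
    by apply: cvg_EFin; [exact: nearW|].
  rewrite /Phi is_cvg_limn_esupE; last by apply/cvg_ex; exists l%:E.
  by rewrite (cvg_lim _ h').
pose ze w : cylT R setT := Z ^~ w.
pose zr w : cylT R setT := (fun i => Z (rho i) w).
have aX : {ae P, forall w, forall j, Phi j (ze w) = X j w}.
  apply: filter_forall => j; apply: (filterS (P := fun w => V j n (ze w) @[n --> \oo] --> X j w)).
    by move=> w /PhiE.
  apply: (ae_cvg (V := fun n w => V j n (ze w))) => n; last exact: (hsj (j, n)).1.
  by apply: L2B => //; exact: L2comb.
have aX' : {ae P, forall w, forall j, Phi j (zr w) = X' j w}.
  apply: filter_forall => j; apply: (filterS (P := fun w => V j n (zr w) @[n --> \oo] --> X' j w)).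
    by move=> w /PhiE.
  have e n w : V j n (zr w) = comb Z (map rho (s (j, n))) (cf (X' j)) w.
    by rewrite comb_rho; apply: eq_bigr => i _; rewrite ecf.
  apply: ae_cvg => n; last first.
    by have [_] := hsj (j, n); under Rint_eq do rewrite -e.
  apply: (L2_eq mT (f := fun w => X' j w - comb Z (map rho (s (j, n))) (cf (X' j)) w)).
    by move=> w _; rewrite e.
  by apply: L2B => //; exact: L2comb.
pose F (z : cylT R setT) := [tuple Phi j z | j < m].
have mtup (d1 : measure_display) (T1 : measurableType d1) (f : 'I_m -> T1 -> R) :
    (forall j, measurable_fun setT (f j)) -> measurable_fun setT (fun w => [tuple f j w | j < m]).
  move=> mf; apply/measurable_fun_tnthP => j.
  by apply: eq_measurable_fun (mf j) => w _; rewrite /= tnth_mktuple.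
have mF : measurable (F @^-1` A) by rewrite -[X in measurable X]setTI; exact: mtup.
have mze : measurable_fun setT ze by apply: measurable_to_cyl => i _; exact: measurable_innov.
have mzr : measurable_fun setT zr.
  by apply: (measurable_to_cyl (Z := fun i => Z (rho i))) => i _; exact: measurable_innov.
have [Zind Zid _ _ _] := iidZ.
transitivity (P (ze @^-1` (F @^-1` A))).
  apply: ae_measure_eq.
  - by rewrite -[X in measurable X]setTI; apply: mtup => // j; case: (lX j).
  - by rewrite -[X in measurable X]setTI; exact: mze.
  - apply: filterS aX => w h /=.
    by rewrite /F (_ : [tuple Phi j (ze w) | j < m] = [tuple X j w | j < m])//; apply: eq_mktuple.
transitivity (P (zr @^-1` (F @^-1` A))); first exact: (cyl_law Zind Zid rK).
apply: ae_measure_eq.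
- by rewrite -[X in measurable X]setTI; exact: mzr.
- by rewrite -[X in measurable X]setTI; apply: mtup => // j; case: (lX' j).
- apply: filterS aX' => w h /=.
  by rewrite /F (_ : [tuple Phi j (zr w) | j < m] = [tuple X' j w | j < m])//; apply: eq_mktuple.
Qed.

End Law.

(** * Third moments *)

Section Cubic.
Context d (T : measurableType d) (R : realType) (P : probability T R).
Variable Z : int -> {RV P >-> R}.
Hypothesis iidZ : iid_innovations P Z.
Hypothesis s2_neq0 : s2 Z != 0.

Let mT : measurable [set: T] := measurableT.
Notation L1 := (mem_L1 P setT).
Notation L2 := (mem_L2 P setT).
Notation E := (Rintegral P setT).
Notation n2 := (norm2 P setT).
Notation cf := (cf Z).
Notation clos := (clos Z).

Implicit Types U V W : T -> R.

Definition L3 (U : T -> R) := measurable_fun setT U /\ L1 (fun w => `|U w| ^+ 3).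

Lemma cube_add (x y : R) : `|x + y| ^+ 3 <= 8 * (`|x| ^+ 3 + `|y| ^+ 3).
Proof.
apply: (@le_trans _ _ ((`|x| + `|y|) ^+ 3)).
  by rewrite lerXn2r ?nnegrE ?addr_ge0// ler_normD.
have := normr_ge0 x; have := normr_ge0 y; move: `|x| `|y| => a b b0 a0.
rewrite !exprS expr0 !mulr1.
(* This gives [a^2 b + a b^2 <= a^3 + b^3], so that the constant 8 is generous. *)
have : 0 <= (a + b) * (a - b) ^+ 2 by rewrite mulr_ge0 ?addr_ge0// sqr_ge0.
have : 0 <= a * (a * a) by rewrite !mulr_ge0.
have : 0 <= b * (b * b) by rewrite !mulr_ge0.
rewrite expr2; nra.
Qed.

Lemma L3D U V : L3 U -> L3 V -> L3 (fun w => U w + V w).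
Proof.
move=> [mU lU] [mV lV]; split; first exact: measurable_funD.
apply: (L1_le mT (g := fun w => 8 * (`|U w| ^+ 3 + `|V w| ^+ 3))).
- apply: measurable_funX; apply: measurableT_comp => //; exact: measurable_funD.
- by apply: L1Z => //; exact: L1D.
- by move=> w _; rewrite ger0_norm ?exprn_ge0//; exact: cube_add.
Qed.

Lemma L3Z a U : L3 U -> L3 (fun w => a * U w).
Proof.
move=> [mU lU]; split; first by apply: measurable_funM => //; exact: measurable_cst.
apply: (L1_eq mT _ (L1Z mT (`|a| ^+ 3) lU)) => w _.
by rewrite normrM exprMn.
Qed.

Lemma L3_sum (J : Type) (s : seq J) (F : J -> T -> R) :
  (forall j, L3 (F j)) -> L3 (fun x => \sum_(j <- s) F j x).
Proof.
move=> h; elim: s => [|j s [m l]].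
  under eq_fun do rewrite big_nil.
  split; first exact: measurable_cst.
  by apply: (L1_eq mT _ (L1_0 P setT)) => w _; rewrite normr0 expr0n.
by under eq_fun do rewrite big_cons; apply: L3D.
Qed.

Lemma L3B U V : L3 U -> L3 V -> L3 (fun w => U w - V w).
Proof.
move=> lU /(L3Z (-1)) lV; have := L3D lU lV.
by under eq_fun do rewrite mulN1r.
Qed.

Lemma L3_prod U V W : L3 U -> L3 V -> L3 W -> L1 (fun w => U w * V w * W w).
Proof.
move=> [mU lU] [mV lV] [mW lW].
apply: (L1_le mT (g := fun w => `|U w| ^+ 3 + `|V w| ^+ 3 + `|W w| ^+ 3)).
- by apply: measurable_funM => //; exact: measurable_funM.
- by apply: L1D => //; exact: L1D.
- move=> w _; rewrite !normrM.
  have := normr_ge0 (U w); have := normr_ge0 (V w); have := normr_ge0 (W w).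
  move: `|U w| `|V w| `|W w| => a b c c0 b0 a0.
  have a3 : 0 <= a ^+ 3 by rewrite exprn_ge0.
  have b3 : 0 <= b ^+ 3 by rewrite exprn_ge0.
  have c3 : 0 <= c ^+ 3 by rewrite exprn_ge0.
  (* The product is at most the cube of the largest of the three factors. *)
  have m x : 0 <= x -> a <= x -> b <= x -> c <= x -> a * b * c <= x ^+ 3.
    move=> x0 ax bx cx; rewrite !exprS expr0 mulr1 mulrA.
    by rewrite ler_pM// ?mulr_ge0// ler_pM.
  case: (lerP a b) => ab; case: (lerP b c) => bc; case: (lerP a c) => ac;
    first [by have := @m a a0; lra | by have := @m b b0; lra | by have := @m c c0; lra].
Qed.

Lemma L3_cube U : L3 U -> L1 (fun w => U w ^+ 3).
Proof. by move=> l; apply: (L1_eq mT _ (L3_prod l l l)) => w _; rewrite !exprS expr0 mulr1 mulrA. Qed.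

Definition coord_comb (s : seq int) (a : int -> R) (D : set int) (z : cylT R D) : R :=
  \sum_(i <- s) a i * (z : int -> R) i.

(** Measurability for the coordinates in [D] alone is what makes [comb Z s a] independent of every
    [Z k] with [k] outside [s]. *)
Lemma measurable_coord_comb s a (D : set int) : (forall i, i \in s -> D i) ->
  measurable_fun setT (@coord_comb s a D).
Proof.
move=> sD; rewrite /coord_comb.
rewrite (_ : (fun z : cylT R D => _) = fun z : cylT R D =>
  \sum_(i <- s) (if i \in s then a i * (z : int -> R) i else 0)); last first.
  by apply/funext => z; apply: eq_big_seq => i ->.
apply: measurable_sum => i; case: (boolP (i \in s)) => si; last exact: measurable_cst.
by apply: measurable_funM => //; apply: measurable_coord; exact: sD.
Qed.

Lemma indep_comb s a k (f g : R -> R) : k \notin s -> measurable_fun setT f ->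
  measurable_fun setT g -> L1 (fun w => f (comb Z s a w)) -> L1 (g \o Z k) ->
  E (fun w => f (comb Z s a w) * g (Z k w)) = E (fun w => f (comb Z s a w)) * E (g \o Z k).
Proof.
move=> ks mf mg lf lg.
pose D : set int := [set i | i \in s].
refine (proj2 (@indep_innov _ _ _ P Z iidZ D k (f \o @coord_comb s a D) g _ _ _ _ _)) => //.
- by move=> /=; apply/negP.
- by apply: measurableT_comp => //; exact: measurable_coord_comb.
Qed.

(* Independence of [S] and [U - S], in the weak form needed for Jensen. *)
Lemma E_bounded_rest U s (b : R -> R) M : clos U -> uniq s -> measurable_fun setT b ->
  (forall x, `|b x| <= M) ->
  E (fun w => b (comb Z s (cf U) w) * (U w - comb Z s (cf U) w)) = 0.
Proof.
move=> [lU cU] us mb bM; set S := comb Z s (cf U).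
have lS : L2 S by exact: L2comb.
have mS : measurable_fun setT S by case: lS.
have M0 : 0 <= M by exact: le_trans (normr_ge0 _) (bM 0).
have mbS : measurable_fun setT (fun w => b (S w)) by exact: measurableT_comp.
have lb V : L2 V -> L1 (fun w => b (S w) * V w).
  move=> lV; apply: (L1_bounded mT mbS (M := M)) => //; exact: L2_L1.
apply/eqP; rewrite -normr_eq0; apply/eqP/le_anti/andP; split => //.
apply/ler_addgt0Pl => e e0; rewrite addr0.
have e1 : 0 < e / (M + 1) by rewrite divr_gt0// ltr_wpDl.
have [s' us' hs'] := cU _ e1.
(* With [s] as the initial segment, [Sr - S] combines only innovations outside [s], each centred and
   independent of [S]. *)
pose r := s ++ [seq i <- s' | i \notin s].
have ur : uniq r.
  rewrite cat_uniq us filter_uniq// andbT; apply/hasPn => i.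
  by rewrite mem_filter => /andP[].
have {}hs' : n2 (fun w => U w - comb Z r (cf U) w) < e / (M + 1).
  by apply: hs' => // i si; rewrite mem_cat mem_filter si andbT orbN.
set Sr := comb Z r (cf U) in hs'.
have lr : L2 Sr by exact: L2comb.
have z : E (fun w => b (S w) * (Sr w - S w)) = 0.
  rewrite (Rint_eq (g := fun w => \sum_(i <- [seq i <- s' | i \notin s]) cf U i * (b (S w) * Z i w))); last first.
    move=> w _; rewrite /Sr /comb /r big_cat/= -/(comb Z s (cf U) w) -/S [X in _ * X]addrAC subrr add0r big_distrr/=.
    by apply: eq_bigr => i _; ring.
  have lbZ i : L1 (fun w => b (S w) * Z i w) by apply: lb; exact: L2_innov.
  rewrite Rint_sum//; last by move=> i; exact: L1Z.
  rewrite big_filter big1// => i si.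
  rewrite RintZ// (@indep_comb s (cf U) i b id)//.
  - by rewrite E_innov// !mulr0.
  - apply: (L1_eq mT _ (lb _ (L2_cst P 1))) => w _; exact: mulr1.
  - exact: L1_innov.
rewrite (Rint_eq (g := fun w => b (S w) * (U w - Sr w) + b (S w) * (Sr w - S w))); last first.
  by move=> w _; ring.
rewrite RintD//; [|by apply: lb; exact: L2B..].
rewrite z addr0; have lD := L2B mT lU lr.
apply: le_trans (Rint_norm mT (lb _ lD)) _.
apply: (@le_trans _ _ (M * E (fun w => `|U w - Sr w|))).
  rewrite -RintZ//; last by apply: L1_norm => //; exact: L2_L1.
  apply: Rint_le => //; [by apply: L1_norm => //; exact: lb|by apply: L1Z => //; apply: L1_norm => //; exact: L2_L1|].
  by move=> w _; rewrite normrM ler_wpM2r.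
have lA : L2 (fun w => `|U w - Sr w|).
  split; first by apply: measurableT_comp => //; case: lD.
  by apply: (L1_eq mT _ (L2_sqr lD)) => w _; rewrite real_normK ?num_real.
have := le_trans (ler_norm _) (E_le_n2 lA).
have -> : n2 (fun w => `|U w - Sr w|) = n2 (fun w => U w - Sr w).
  by congr Num.sqrt; apply: Rint_eq => w _; rewrite real_normK ?num_real.
rewrite ltr_pdivlMr ?ltr_wpDl// in hs'.
move: (E _) (n2 _) (norm2_ge0 P setT (fun w => U w - Sr w)) hs' => x y y0 hs' xy.
apply: (@le_trans _ _ (M * y)); first by rewrite ler_wpM2l.
nra.
Qed.

(* |x|^3 lies above its tangent at y. *)
Lemma cube_tangent (x y : R) : `|y| ^+ 3 + 3 * (y * `|y|) * (x - y) <= `|x| ^+ 3.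
Proof.
rewrite !exprS !expr0 !mulr1.
case: (ger0P y) => y0; case: (ger0P x) => x0.
(* When the signs agree, the gap between the cube and its tangent is this product, up to sign. *)
- have : 0 <= (x + 2 * y) * (x - y) ^+ 2 by rewrite mulr_ge0 ?addr_ge0 ?sqr_ge0//; lra.
  by rewrite expr2; nra.
- have h1 : 0 <= - x * (x * x) by apply: mulr_ge0; nra.
  have h2 : 0 <= y * (y * y) by apply: mulr_ge0; nra.
  have h3 : 0 <= y * y * - x by apply: mulr_ge0; nra.
  by nra.
- have h1 : 0 <= x * (x * x) by apply: mulr_ge0; nra.
  have h2 : 0 <= - y * (y * y) by apply: mulr_ge0; nra.
  have h3 : 0 <= y * y * x by apply: mulr_ge0; nra.
  by nra.
- have : 0 <= - (x + 2 * y) * (x - y) ^+ 2 by rewrite mulr_ge0 ?sqr_ge0//; lra.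
  by rewrite expr2; nra.
Qed.

(** Jensen's inequality for the conditional expectation of [U] given the innovations in [s]. The
    tangent inequality at [S] is integrated; its linear term vanishes by [E_bounded_rest]. That [S]
    has a third moment is itself to be shown, so the tangent is first cut off in [S], and Fatou's
    lemma removes the cut. *)
Lemma L3_comb_le U s : clos U -> L3 U -> uniq s ->
  L3 (comb Z s (cf U)) /\ E (fun w => `|comb Z s (cf U) w| ^+ 3) <= E (fun w => `|U w| ^+ 3).
Proof.
move=> cU lU us; set S := comb Z s (cf U).
have lS : L2 S by exact: L2comb.
have mS : measurable_fun setT S by case: lS.
(* The truncated derivative of the cubed absolute value. *)
pose b n (y : R) := trunc n%:R y * (3 * (y * `|y|)).
have mb n : measurable_fun setT (b n).
  apply: measurable_funM; first exact: measurable_trunc.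
  by apply: measurable_funM => //; apply: measurable_funM => //; exact: measurableT_comp.
have bM n x : `|b n x| <= 3 * (n%:R * n%:R).
  rewrite /b /trunc; case: (lerP `|x| n%:R) => xn; last by rewrite mul0r normr0 !mulr_ge0.
  by rewrite mul1r !normrM normr_id (ger0_norm (ler0n R 3)) ler_wpM2l// ler_pM.
pose g n w := trunc n%:R (S w) * `|S w| ^+ 3.
have mg n : measurable_fun setT (g n).
  apply: measurable_funM; first exact: measurableT_comp (measurable_trunc _) mS.
  by apply: measurable_funX; exact: measurableT_comp.
have lg n : L1 (g n).
  apply: (L1_le mT (mg n) (L2_L1 (L2_cst P (n%:R ^+ 3)))) => w _.
  rewrite /g /trunc; case: (lerP `|S w| n%:R) => xn; last by rewrite mul0r normr0 exprn_ge0.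
  by rewrite mul1r ger0_norm ?exprn_ge0// lerXn2r ?nnegrE.
have [//|||h1 h2] := @Rint_fatou _ _ _ P setT mT g (fun w => `|S w| ^+ 3) (E (fun w => `|U w| ^+ 3)) lg.
- by move=> n w _; rewrite mulr_ge0 ?trunc_ge0// exprn_ge0.
- move=> w _; rewrite -[X in _ --> X]mul1r; apply: cvgM; last exact: cvg_cst.
  exact: trunc_cvg.
- move=> n; have lU2 : L2 U by case: cU.
  have lbU : L1 (fun w => b n (S w) * (U w - S w)).
    apply: (L1_bounded mT _ (M := 3 * (n%:R * n%:R))) => //.
    - exact: measurableT_comp.
    - by apply: L2_L1; exact: L2B.
  have := E_bounded_rest cU us (mb n) (bM n); rewrite -/S => z.
  rewrite -[leLHS]addr0 -z -RintD//; apply: Rint_le => //; [exact: L1D|by case: lU|].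
  move=> w _; rewrite /g /b /trunc; case: (lerP `|S w| n%:R) => xn; last first.
    by rewrite !mul0r addr0 exprn_ge0.
  by rewrite !mul1r; exact: cube_tangent.
- by split => //; split.
Qed.

(** The Fourier sum of [U] over the single index [k] is a nonzero multiple of [Z k] and inherits a
    third moment from [U]; equidistribution does the rest. *)
Lemma L3_innov U k j : clos U -> L3 U -> cf U k != 0 -> L3 (Z j).
Proof.
move=> cU lU c0; have [[_ l] _] := @L3_comb_le U [:: k] cU lU isT.
have lk : L1 (fun w => `|Z k w| ^+ 3).
  apply: (L1_eq mT _ (L1Z mT (`|cf U k| ^- 3) l)) => w _.
  rewrite /comb big_seq1; move: (cf U k) c0 => a a0.
  by rewrite normrM exprMn mulKf// expf_neq0// normr_eq0.
split; first exact: measurable_innov.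
have [_ Zid _ _ _] := iidZ.
have [|||||l' _] := @eq_law_integral _ _ _ P _ _ (Z k) (Z j) (fun x => `|x| ^+ 3) => //.
- by move=> A mA; exact: Zid.
- by apply: measurable_funX; exact: normr_measurable.
Qed.

End Cubic.

(** * The third moment as a sum of cubes *)

Section CubicFormula.
Context d (T : measurableType d) (R : realType) (P : probability T R).
Variable Z : int -> {RV P >-> R}.
Hypothesis iidZ : iid_innovations P Z.
Hypothesis s2_neq0 : s2 Z != 0.

Let mT : measurable [set: T] := measurableT.
Notation L1 := (mem_L1 P setT).
Notation L2 := (mem_L2 P setT).
Notation L3 := (L3 P).
Notation E := (Rintegral P setT).
Notation n2 := (norm2 P setT).
Notation cf := (cf Z).
Notation clos := (clos Z).
Implicit Types U V W : T -> R.

Lemma clos_Z k : clos (Z k).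
Proof.
apply: closP => //; first exact: L2_innov.
move=> e e0; exists [:: k], (fun=> 1); split => //.
by rewrite /norm2 (Rint_eq (g := fun=> 0)) ?Rint0 ?sqrtr0// => w _; rewrite /comb big_seq1 mul1r subrr expr0n.
Qed.

Lemma cf_Z k j : cf (Z k) j = (k == j)%:R.
Proof. by apply: (mulfI s2_neq0); rewrite -cfE// E_innov_mul. Qed.

(** Removes [Z k] from a Fourier sum whose coefficient there is 0, so that independence applies. *)
Lemma comb_filter s (a : int -> R) k : a k = 0 -> comb Z s a = comb Z [seq i <- s | i != k] a.
Proof.
move=> ak; apply/funext => w; rewrite /comb big_filter [LHS](bigID (fun i => i != k))/=.
rewrite [X in _ + X]big1 ?addr0// => i; rewrite negbK => /eqP ->.
by rewrite ak mul0r.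
Qed.

Lemma E_mul_bounded_dist V S (g : T -> R) M : L2 V -> L2 S -> measurable_fun setT g ->
  (forall w, `|g w| <= M) ->
  `|E (fun w => V w * g w) - E (fun w => S w * g w)| <= n2 (fun w => V w - S w) * M.
Proof.
move=> lV lS mg gM; have M0 : 0 <= M by exact: le_trans (normr_ge0 _) (gM point).
have lg : L2 g.
  have := L2_bounded mT mg (fun w _ => gM w) (L2_cst P 1).
  by apply: L2_eq => // w _; rewrite mulr1.
rewrite -RintB//; [|exact: L2M..].
rewrite (Rint_eq (g := fun w => (V w - S w) * g w)); last by move=> w _; rewrite mulrBl.
apply: le_trans (cauchy_schwarz mT (L2B mT lV lS) lg) _.
rewrite ler_wpM2l ?norm2_ge0//.
rewrite -(ger0_norm M0) -sqrtr_sqr /norm2 ler_wsqrtr// -[leRHS](E_cst P).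
apply: Rint_le => //; [exact: L2_sqr|by apply: L2_L1; exact: L2_cst|].
move=> w _; rewrite -[leLHS]real_normK ?num_real//.
by rewrite ler_sqr ?nnegrE.
Qed.

(** Factor [V^2 - S^2] as [(V - S) * (V + S)] and bound the norm of [V + S = 2 V - (V - S)]. *)
Lemma E_sqr_mul_bounded_dist V S (g : T -> R) M : L2 V -> L2 S -> measurable_fun setT g ->
  (forall w, `|g w| <= M) ->
  `|E (fun w => V w ^+ 2 * g w) - E (fun w => S w ^+ 2 * g w)| <=
  M * (n2 (fun w => V w - S w) * (2 * n2 V + n2 (fun w => V w - S w))).
Proof.
move=> lV lS mg gM; have M0 : 0 <= M by exact: le_trans (normr_ge0 _) (gM point).
have lb f : L1 f -> L1 (fun w => f w * g w).
  move=> lf; apply: (L1_eq mT _ (L1_bounded mT mg (fun w _ => gM w) lf)) => w _.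
  exact: mulrC.
have lD := L2B mT lV lS.
have lDg : L2 (fun w => g w * (V w - S w)) := L2_bounded mT mg (fun w _ => gM w) lD.
have lA : L2 (fun w => V w + S w) by exact: L2D.
rewrite -RintB//; [|by apply: lb; exact: L2_sqr..].
rewrite (Rint_eq (g := fun w => (g w * (V w - S w)) * (V w + S w))); last first.
  by move=> w _; ring.
apply: le_trans (cauchy_schwarz mT lDg lA) _.
rewrite mulrA; apply: ler_pM; rewrite ?norm2_ge0//.
  rewrite -ler_sqr ?nnegrE ?mulr_ge0 ?norm2_ge0//.
  rewrite sqr_norm2// exprMn sqr_norm2// -RintZ//; last exact: L2_sqr.
  apply: Rint_le => //; [exact: L2_sqr|by apply: L1Z => //; exact: L2_sqr|].
  move=> w _; rewrite exprMn ler_wpM2r ?sqr_ge0// -[leLHS]real_normK ?num_real//.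
  by rewrite ler_sqr ?nnegrE.
have -> : n2 (fun w => V w + S w) = n2 (fun w => 2 * V w + (- 1) * (V w - S w)).
  by apply: norm2_eq => w _; ring.
apply: le_trans (norm2_triangle mT (L2Z mT _ lV) (L2Z mT _ lD)) _.
by rewrite !norm2Z// normrN1 mul1r (ger0_norm (ler0n R 2)).
Qed.

Section Skip.
Variables (V : T -> R) (k : int) (g : R -> R) (M : R).
Hypotheses (cV : clos V) (Vk : cf V k = 0) (mg : measurable_fun setT g)
  (gM : forall x, `|g x| <= M).

Let lV : L2 V. Proof. by case: cV. Qed.
Let mgZ : measurable_fun setT (g \o Z k).
Proof. by apply: measurableT_comp => //; exact: measurable_innov. Qed.
Let lgZ : L1 (g \o Z k).
Proof.
apply: (L1_le mT mgZ (L2_L1 (L2_cst P M))) => w _; exact: gM.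
Qed.
Let M0 : 0 <= M. Proof. exact: le_trans (normr_ge0 _) (gM 0). Qed.

(** Since [cf V k = 0], the Fourier sums of [V] can avoid [Z k]; they are then centred and
    independent of [g (Z k)], and the identity passes to the L2 limit because [g] is bounded. *)
Lemma E_mul_innov : E (fun w => V w * g (Z k w)) = 0.
Proof.
apply/eqP; rewrite -normr_eq0; apply/eqP/le_anti/andP; split => //.
apply/ler_addgt0Pl => e e0; rewrite addr0.
have e1 : 0 < e / (M + 1) by rewrite divr_gt0// ltr_wpDl.
have [s us /(_ s us (fun _ => id)) hs] := cV.2 _ e1.
rewrite (comb_filter _ Vk) in hs.
set s' := [seq i <- s | i != k] in hs.
have z : E (fun w => comb Z s' (cf V) w * g (Z k w)) = 0.
  rewrite (@indep_comb _ _ _ _ Z iidZ s' (cf V) k id g)//.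
  - by rewrite E_comb0// mul0r.
  - by rewrite mem_filter eqxx.
  - by apply: L2_L1; exact: L2comb.
have := E_mul_bounded_dist lV (L2comb iidZ s' (cf V)) mgZ (fun w => gM (Z k w)).
rewrite z subr0 => h; apply: le_trans h _.
rewrite ltr_pdivlMr ?ltr_wpDl// in hs.
have := norm2_ge0 P setT (fun w => V w - comb Z s' (cf V) w).
move: (n2 _) hs => y hs y0; nra.
Qed.

Lemma E_sqr_mul_innov : E (fun w => V w ^+ 2 * g (Z k w)) = E (fun w => V w ^+ 2) * E (g \o Z k).
Proof.
set G := E (g \o Z k).
have GM : `|G| <= M.
  apply: le_trans (Rint_norm mT lgZ) _; rewrite -[leRHS](E_cst P).
  by apply: Rint_le => //; [exact: L1_norm|apply: L2_L1; exact: L2_cst|move=> w _; exact: gM].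
apply/eqP; rewrite -subr_eq0 -normr_eq0; apply/eqP/le_anti/andP; split => //.
apply/ler_addgt0Pl => e e0; rewrite addr0.
have C0 : 0 < 2 * (M + 1) * (2 * n2 V + 1).
  have := norm2_ge0 P setT V; move=> h; rewrite !mulr_gt0//; have := M0; lra.
pose e1 := Num.min 1 (e / (2 * (M + 1) * (2 * n2 V + 1))).
have e10 : 0 < e1 by rewrite lt_min ltr01 divr_gt0.
have [s us /(_ s us (fun _ => id)) hs] := cV.2 _ e10.
rewrite (comb_filter _ Vk) in hs.
set s' := [seq i <- s | i != k] in hs.
set S := comb Z s' (cf V) in hs.
have lS : L2 S by exact: L2comb.
have z : E (fun w => S w ^+ 2 * g (Z k w)) = E (fun w => S w ^+ 2) * G.
  rewrite (@indep_comb _ _ _ _ Z iidZ s' (cf V) k (fun x => x ^+ 2) g)//.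
  - by rewrite mem_filter eqxx.
  - exact: L2_sqr.
(* Centring [g] turns the factorisation into one expectation, which is 0 for [S] and
   L2-continuous. *)
pose g' w := g (Z k w) - G.
have mg' : measurable_fun setT g' by apply: measurable_funB => //; exact: measurable_cst.
have g'M w : `|g' w| <= 2 * M.
  have := ler_normB (g (Z k w)) G; have := gM (Z k w); rewrite /g'; move: GM; lra.
have := E_sqr_mul_bounded_dist lV lS mg' g'M.
have split U : L2 U -> E (fun w => U w ^+ 2 * g' w) =
    E (fun w => U w ^+ 2 * g (Z k w)) - E (fun w => U w ^+ 2) * G.
  move=> lU; have lUg : L1 (fun w => U w ^+ 2 * g (Z k w)).
    apply: (L1_eq mT _ (L1_bounded mT mgZ (fun w _ => gM (Z k w)) (L2_sqr lU))) => w _.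
    by rewrite mulrC.
  rewrite mulrC -RintZ//; last exact: L2_sqr.
  rewrite -RintB//; last by apply: L1Z => //; exact: L2_sqr.
  by apply: Rint_eq => w _; rewrite /g'; ring.
rewrite !split// z subrr subr0 => h; apply: le_trans h _.
have := norm2_ge0 P setT (fun w => V w - S w); have := norm2_ge0 P setT V.
move: hs; rewrite lt_min ltr_pdivlMr// => /andP[].
set x := n2 (fun w => V w - S w); set y := n2 V; have m0 := M0 => x1 xe y0 x0.
have le1 : 2 * M * (x * (2 * y + x)) <= 2 * M * (x * (2 * y + 1)).
  by rewrite ler_wpM2l ?mulr_ge0// ler_wpM2l// lerD2l ltW.
have le2 : 2 * M * (x * (2 * y + 1)) <= 2 * (M + 1) * (x * (2 * y + 1)).
  by rewrite ler_wpM2r ?mulr_ge0 ?addr_ge0 ?mulr_ge0//; lra.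
by apply: (le_trans le1); apply: (le_trans le2); lra.
Qed.

End Skip.

Section Cube.
Variable U : T -> R.
Hypotheses (cU : clos U) (lU3 : L3 U) (lZ3 : forall k, L3 (Z k)).
Let lU : L2 U. Proof. by case: cU. Qed.

Definition kappa3 := E (fun w => Z 0 w ^+ 3).

Lemma E_innov_cube k : E (fun w => Z k w ^+ 3) = kappa3.
Proof.
have [|_ ->//] := @innov_transfer _ _ _ P Z iidZ k (fun x => x ^+ 3) _ (L3_cube (lZ3 0)).
by apply: measurable_funX; exact: measurable_id.
Qed.

(** Write [U = V + u * Z k] with [cf V k = 0] and expand the square: the terms with [V] vanish as if
    [V] were independent of [Z k], leaving [u^2] times the third moment. *)
Lemma E_sqr_Z k : E (fun w => U w ^+ 2 * Z k w) = kappa3 * cf U k ^+ 2.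
Proof.
set u := cf U k.
pose V w := U w - u * Z k w.
have cV : clos V.
  have := closD iidZ s2_neq0 cU (closZ iidZ s2_neq0 (- u) (clos_Z k)).
  by rewrite /V; under eq_fun do rewrite mulNr.
have lV3 : L3 V by apply: L3B => //; exact: L3Z.
have Vk : cf V k = 0.
  rewrite cfB//; last by apply: L2Z => //; exact: L2_innov.
  by rewrite cfZ// ?cf_Z ?eqxx ?mulr1 ?subrr//; exact: L2_innov.
have mZk : measurable_fun setT (Z k : T -> R) by exact: measurable_innov.
have trM n (x : R) : `|trunc n%:R x * x| <= n%:R.
  rewrite /trunc; case: (lerP `|x| n%:R) => xn; last by rewrite mul0r normr0.
  by rewrite mul1r.
have trM2 n (x : R) : `|trunc n%:R x * x ^+ 2| <= n%:R * n%:R.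
  rewrite /trunc; case: (lerP `|x| n%:R) => xn; last by rewrite mul0r normr0 mulr_ge0.
  by rewrite mul1r normrX expr2 ler_pM.
have lV2Z : L1 (fun w => V w ^+ 2 * Z k w).
  by apply: (L1_eq mT _ (L3_prod lV3 lV3 (lZ3 k))) => w _; rewrite expr2.
have lVZ2 : L1 (fun w => V w * Z k w ^+ 2).
  by apply: (L1_eq mT _ (L3_prod lV3 (lZ3 k) (lZ3 k))) => w _; rewrite expr2 mulrA.
(* The identities for bounded [g] are applied to truncated powers of [Z k], and the truncation level
   goes to infinity. *)
have e1 : E (fun w => V w * Z k w ^+ 2) = 0.
  apply/esym/(cvg_unique _ _ (Rint_trunc mT lVZ2 mZk)) => //.
  rewrite (_ : (fun n : nat => _) = fun=> 0); first exact: cvg_cst.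
  apply/funext => n.
  have := @E_mul_innov V k (fun x => trunc n%:R x * x ^+ 2) _ cV Vk _ (trM2 n).
  rewrite (Rint_eq (g := fun w => trunc n%:R (Z k w) * (V w * Z k w ^+ 2))).
    apply; apply: measurable_funM; first exact: measurable_trunc.
    by apply: measurable_funX; exact: measurable_id.
  by move=> w _; ring.
have e2 : E (fun w => V w ^+ 2 * Z k w) = 0.
  apply/esym/(cvg_unique _ _ (Rint_trunc mT lV2Z mZk)) => //.
  rewrite (_ : (fun n : nat => _) = fun n => E (fun w => V w ^+ 2) * E (fun w => trunc n%:R (Z k w) * Z k w)).
    have := cvgM (cvg_cst (E (fun w => V w ^+ 2))) (Rint_trunc mT (L1_innov iidZ k) mZk).
    by rewrite E_innov// mulr0; apply.
  apply/funext => n.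
  have := @E_sqr_mul_innov V k (fun x => trunc n%:R x * x) _ cV Vk _ (trM n).
  rewrite (Rint_eq (g := fun w => trunc n%:R (Z k w) * (V w ^+ 2 * Z k w))).
    by apply; apply: measurable_funM; [exact: measurable_trunc|exact: measurable_id].
  by move=> w _; ring.
have l3 := L3_cube (lZ3 k).
rewrite (Rint_eq (g := fun w => V w ^+ 2 * Z k w + (2 * u * (V w * Z k w ^+ 2) + u ^+ 2 * Z k w ^+ 3))); last first.
  by move=> w _; rewrite /V; ring.
rewrite RintD//; last by apply: L1D => //; exact: L1Z.
rewrite RintD//; [|exact: L1Z..].
by rewrite !RintZ// e1 e2 E_innov_cube; ring.
Qed.

(** Summing [E_sqr_Z] evaluates [E (U^2 * S)] for a Fourier sum [S]. In the error
    [E (U^2 * (U - S))] the difference is small only in L2 while [U^2] need not be in L2; the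
    uniform third-moment bound of [L3_comb_le] compensates. *)
Lemma cube_formula e : 0 < e -> exists2 s, uniq s & forall s', uniq s' ->
  {subset s <= s'} -> `|E (fun w => U w ^+ 3) - kappa3 * \sum_(i <- s') cf U i ^+ 3| < e.
Proof.
move=> e0; pose M := E (fun w => `|U w| ^+ 3).
have M0 : 0 <= M by apply: Rint_ge0 => w _; rewrite exprn_ge0.
(* [16 * M] bounds the third absolute moment of [U - S], by [cube_add] and [L3_comb_le]; the [+ 1]
   keeps [N] positive. *)
pose N := 16 * M + 1; have N0 : 0 < N by rewrite /N; lra.
pose dl := Num.min 1 (e / (4 * N)).
have dl0 : 0 < dl by rewrite lt_min ltr01 divr_gt0// mulr_gt0.
have dl1 : dl <= 1 by rewrite ge_min lexx.
have dlN : dl * N <= e / 4.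
  rewrite -ler_pdivlMr//; apply: (@le_trans _ _ (e / (4 * N))); first by rewrite ge_min lexx orbT.
  by rewrite invfM mulrA.
have mU : measurable_fun setT U by case: lU.
have lU3' : L1 (fun w => `|U w| ^+ 3) by case: lU3.
have [K hK] : exists K : nat, M - E (fun w => trunc K%:R (U w) * `|U w| ^+ 3) < dl * (e / 4).
  have /cvgrPdist_lt/(_ (dl * (e / 4))) := Rint_trunc mT lU3' mU.
  case; first by rewrite mulr_gt0// divr_gt0.
  move=> K _ /(_ K (leqnn K)) /= h; exists K; apply: le_lt_trans h; exact: ler_norm.
pose K2 : R := K%:R ^+ 2; have K20 : 0 <= K2 by exact: sqr_ge0.
have e1 : 0 < e / (4 * (K2 + 1)) by rewrite divr_gt0// mulr_gt0// ltr_wpDl.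
have [s us hs] := cU.2 _ e1; exists s => // s' us' ss'.
have {}hs := hs s' us' ss'; set S := comb Z s' (cf U) in hs.
have lS : L2 S by exact: L2comb.
have [lS3 leS] := L3_comb_le iidZ cU lU3 us'; rewrite -/S in lS3 leS.
have lD := L2B mT lU lS; have lD3 := L3B lU3 lS3.
have lDn : L1 (fun w => `|U w - S w|) by apply: L1_norm => //; exact: L2_L1.
have [_ lD3'] := lD3.
have ES : E (fun w => U w ^+ 2 * S w) = kappa3 * \sum_(i <- s') cf U i ^+ 3.
  rewrite (Rint_eq (g := fun w => \sum_(i <- s') cf U i * (U w ^+ 2 * Z i w))); last first.
    by move=> w _; rewrite /S /comb big_distrr/=; apply: eq_bigr => i _; ring.
  have l i : L1 (fun w => U w ^+ 2 * Z i w).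
    by apply: (L1_eq mT _ (L3_prod lU3 lU3 (lZ3 i))) => w _; rewrite expr2.
  rewrite Rint_sum//; last by move=> i; exact: L1Z.
  rewrite big_distrr/=; apply: eq_bigr => i _; rewrite RintZ// E_sqr_Z.
  by move: (cf U i) => x; ring.
have lUUS : L1 (fun w => U w ^+ 2 * S w).
  by apply: (L1_eq mT _ (L3_prod lU3 lU3 lS3)) => w _; rewrite expr2.
have lUUD : L1 (fun w => U w ^+ 2 * (U w - S w)).
  by apply: (L1_eq mT _ (L3_prod lU3 lU3 lD3)) => w _; rewrite expr2.
rewrite -ES -RintB//; last exact: L3_cube.
rewrite (Rint_eq (g := fun w => U w ^+ 2 * (U w - S w))); last by move=> w _; ring.
apply: le_lt_trans (Rint_norm mT lUUD) _.
have ltr : L1 (fun w => trunc K%:R (U w) * `|U w| ^+ 3).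
  apply: (L1_bounded mT _ (M := 1)) => //; last by move=> w _; exact: trunc_bound.
  by apply: measurableT_comp => //; exact: measurable_trunc.
have lB : L1 (fun w => `|U w| ^+ 3 - trunc K%:R (U w) * `|U w| ^+ 3) by exact: L1B.
have D3 : E (fun w => `|U w - S w| ^+ 3) <= 16 * M.
  apply: (@le_trans _ _ (8 * (M + E (fun w => `|S w| ^+ 3)))); last by rewrite /M; lra.
  have [_ lS3'] := lS3.
  rewrite -RintD// -RintZ//; last exact: L1D.
  apply: Rint_le => //; first by apply: L1Z => //; exact: L1D.
  by move=> w _; have := cube_add (U w) (- S w); rewrite normrN.
(* Pointwise, with [x] for the size of [U] and [y] for that of [U - S]: if [x <= K] then
   [x^2 y <= K^2 y]; otherwise [x^2 y] is at most [x^3 / dl] when [dl y <= x], and at most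
   [dl^2 y^3 <= dl y^3] when not. *)
apply: (@le_lt_trans _ _ (K2 * E (fun w => `|U w - S w|)
   + dl^-1 * (M - E (fun w => trunc K%:R (U w) * `|U w| ^+ 3))
   + dl * E (fun w => `|U w - S w| ^+ 3))).
  rewrite -RintB// -!RintZ//; rewrite -!RintD//; [|by [exact: L1Z|apply: L1D => //; exact: L1Z]..].
  apply: Rint_le => //; [exact: L1_norm|by apply: L1D => //; [apply: L1D => //|]; exact: L1Z|].
  move=> w _; rewrite normrM normrX.
  set x := `|U w|; set y := `|U w - S w|.
  have x0 : 0 <= x := normr_ge0 _; have y0 : 0 <= y := normr_ge0 _.
  have z0 : 0 <= dl * y ^+ 3 by rewrite mulr_ge0 ?exprn_ge0// ltW.
  rewrite /trunc -/x; case: (lerP x K%:R) => xK.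
    rewrite mul1r subrr mulr0 addr0.
    apply: (@le_trans _ _ (K2 * y)); last by rewrite lerDl.
    by rewrite ler_wpM2r// ler_sqr ?nnegrE.
  rewrite mul0r subr0.
  have k0 : 0 <= K2 * y by rewrite mulr_ge0.
  case: (lerP (dl * y) x) => yx.
    have : x ^+ 2 * y <= dl^-1 * x ^+ 3.
      rewrite mulrC ler_pdivlMl// mulrA [x ^+ 3]exprS; apply: ler_wpM2r => //.
      exact: sqr_ge0.
    by lra.
  have x30 : 0 <= dl^-1 * x ^+ 3 by rewrite mulr_ge0 ?exprn_ge0// invr_ge0 ltW.
  have : x ^+ 2 * y <= dl * y ^+ 3.
    apply: (@le_trans _ _ ((dl * y) ^+ 2 * y)).
      have dy : 0 <= dl * y by rewrite mulr_ge0// ltW.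
      by rewrite ler_wpM2r// ler_sqr ?nnegrE// ltW.
    rewrite exprMn -mulrA -exprSr ler_wpM2r ?exprn_ge0//.
    by rewrite expr2 ler_piMr// ltW.
  by lra.
have lA : L2 (fun w => `|U w - S w|).
  split; first by apply: measurableT_comp => //; case: lD.
  by apply: (L1_eq mT _ (L2_sqr lD)) => w _; rewrite real_normK ?num_real.
have n1 := le_trans (ler_norm _) (E_le_n2 lA).
have nE : n2 (fun w => `|U w - S w|) = n2 (fun w => U w - S w).
  by congr Num.sqrt; apply: Rint_eq => w _; rewrite real_normK ?num_real.
have t1 : K2 * E (fun w => `|U w - S w|) <= e / 4.
  apply: (@le_trans _ _ ((K2 + 1) * (e / (4 * (K2 + 1))))); last first.
    by rewrite le_eqVlt; apply/orP; left; apply/eqP; field; lra.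
  by apply: ler_pM => //; [apply: Rint_ge0|lra|rewrite (le_trans n1)// nE ltW].
have t2 : dl^-1 * (M - E (fun w => trunc K%:R (U w) * `|U w| ^+ 3)) <= e / 4.
  by rewrite ler_pdivrMl// ltW.
have t3 : dl * E (fun w => `|U w - S w| ^+ 3) <= e / 4.
  apply: le_trans dlN; rewrite ler_wpM2l ?(ltW dl0)// /N; lra.
lra.
Qed.

End Cube.
End CubicFormula.

(** * Time reversal *)

Section Reversal.
Context d (T : measurableType d) (R : realType) (P : probability T R).
Variable Z : int -> {RV P >-> R}.
Hypothesis iidZ : iid_innovations P Z.
Hypothesis s2_neq0 : s2 Z != 0.
Variables (c : int -> R) (X : int -> {RV P >-> R}).
Hypothesis Xlim : forall t : int,
  (\int[P]_w (((X t w - ma_partial_sum P c Z t n w) ^+ 2)%:E))%E @[n --> \oo] --> 0%E.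
Hypothesis X3 : P.-integrable setT (fun w => (`|X 0 w| ^+ 3)%:E).

Let mT : measurable [set: T] := measurableT.
Notation L1 := (mem_L1 P setT).
Notation L2 := (mem_L2 P setT).
Notation L3 := (L3 P).
Notation E := (Rintegral P setT).
Notation n2 := (norm2 P setT).
Notation cf := (cf Z).
Notation clos := (clos Z).
Implicit Types U V W : T -> R.

Let lX t : L2 (X t) := L2X iidZ Xlim t.
Let cX t : clos (X t) := clos_X iidZ Xlim s2_neq0 t.
Let mX t : measurable_fun setT (X t : T -> R). Proof. exact: measurable_funPT. Qed.

Lemma measurable_tuple_X m (t : 'I_m -> int) : measurable_fun setT (fun w => [tuple X (t j) w | j < m]).
Proof.
apply/measurable_fun_tnthP => j.
by apply: eq_measurable_fun (mX (t j)) => w _; rewrite /= tnth_mktuple.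
Qed.

(** Shifting time by [s] moves the coefficients by the translation [k |-> k + s], so [same_law]
    applies. *)
Lemma stationary_law m (t : 'I_m -> int) (s : int) (f : m.-tuple R -> R) :
  measurable_fun setT f -> L1 (fun w => f [tuple X (t j) w | j < m]) ->
  L1 (fun w => f [tuple X (t j + s) w | j < m]) /\
  E (fun w => f [tuple X (t j) w | j < m]) = E (fun w => f [tuple X (t j + s) w | j < m]).
Proof.
move=> mf lf.
have h := @eq_law_integral _ _ _ P _ _ (fun w => [tuple X (t j) w | j < m])
  (fun w => [tuple X (t j + s) w | j < m]) f.
apply: h => //; [exact: measurable_tuple_X|exact: (@measurable_tuple_X m (fun j => t j + s))|].
move=> A mA.
apply: (@same_law _ _ _ P Z iidZ m (fun j => X (t j)) (fun j => X (t j + s))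
  (fun k => k + s) (fun k => k - s)) => //.
- by move=> k; rewrite addrK.
- by move=> k; rewrite subrK.
- by move=> j k; rewrite !(cf_X iidZ Xlim s2_neq0); congr c; lia.
Qed.

Lemma L3X t : L3 (X t).
Proof.
split; first exact: mX.
have mf : measurable_fun setT (fun x : 1.-tuple R => `|tnth x ord0| ^+ 3).
  by apply: measurable_funX; apply: measurableT_comp => //; exact: measurable_tnth.
have [|l _] := @stationary_law 1 (fun=> 0) t _ mf.
  by apply: (L1_eq mT _ X3) => w _; rewrite tnth_mktuple.
by apply: (L1_eq mT _ l) => w _; rewrite tnth_mktuple add0r.
Qed.

Lemma E3_shift (s t r h : int) : E (fun w => X s w * X t w * X r w) =
  E (fun w => X (s + h) w * X (t + h) w * X (r + h) w).
Proof.
pose tt (j : 'I_3) := nth 0 [:: s; t; r] j.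
have mf : measurable_fun setT (fun x : 3.-tuple R => tnth x ord0 * tnth x (inord 1) * tnth x (inord 2)).
  by apply: measurable_funM; [apply: measurable_funM|]; exact: measurable_tnth.
have [|_] := @stationary_law 3 tt h _ mf.
  apply: (L1_eq mT _ (L3_prod (L3X s) (L3X t) (L3X r))) => w _.
  by rewrite !tnth_mktuple /tt !inordK.
rewrite (Rint_eq (g := fun w => X s w * X t w * X r w)); last first.
  by move=> w _; rewrite !tnth_mktuple /tt !inordK.
move=> ->; apply: Rint_eq => w _.
by rewrite !tnth_mktuple /tt !inordK.
Qed.

Lemma E2_shift (s t h : int) : E (fun w => X s w * X t w) = E (fun w => X (s + h) w * X (t + h) w).
Proof.
pose tt (j : 'I_2) := nth 0 [:: s; t] j.
have mf : measurable_fun setT (fun x : 2.-tuple R => tnth x ord0 * tnth x (inord 1)).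
  by apply: measurable_funM; exact: measurable_tnth.
have [|_] := @stationary_law 2 tt h _ mf.
  apply: (L1_eq mT _ (L2M mT (lX s) (lX t))) => w _.
  by rewrite !tnth_mktuple /tt !inordK.
rewrite (Rint_eq (g := fun w => X s w * X t w)); last first.
  by move=> w _; rewrite !tnth_mktuple /tt !inordK.
move=> ->; apply: Rint_eq => w _.
by rewrite !tnth_mktuple /tt !inordK.
Qed.

(** For second moments stationarity alone suffices: a shift by [- s - t] exchanges the two times up
    to sign. *)
Lemma E2_rev (s t : int) : E (fun w => X s w * X t w) = E (fun w => X (- s) w * X (- t) w).
Proof.
have a : s + (- s - t) = - t by lia.
have b : t + (- s - t) = - s by lia.
rewrite (E2_shift s t (- s - t)) a b.
by apply: Rint_eq => w _; rewrite mulrC.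
Qed.

Definition lc (l : seq (R * int)) (w : T) : R := \sum_(p <- l) p.1 * X p.2 w.
Definition rev_lc (l : seq (R * int)) := [seq (p.1, - p.2) | p <- l].

Lemma L2_lc l : L2 (lc l).
Proof. by apply: L2_sum => // p; apply: L2Z => //. Qed.

Lemma L3_lc l : L3 (lc l).
Proof. by apply: L3_sum => p; apply: L3Z; exact: L3X. Qed.

Lemma lc_cons p l w : lc (p :: l) w = p.1 * X p.2 w + lc l w.
Proof. by rewrite /lc big_cons. Qed.

Lemma clos_lc l : clos (lc l).
Proof.
elim: l => [|p l ih].
  have := closZ iidZ s2_neq0 0 (cX 0).
  have -> // : (fun w => 0 * X 0 w) = lc [::].
  by apply/funext => w; rewrite /lc big_nil mul0r.
have -> : lc (p :: l) = (fun w => p.1 * X p.2 w + lc l w) by exact/funext/lc_cons.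
exact: (closD iidZ s2_neq0 (closZ iidZ s2_neq0 p.1 (cX p.2)) ih).
Qed.

Lemma E_lc_X l h : E (fun w => lc l w * X h w) = \sum_(p <- l) p.1 * E (fun w => X p.2 w * X h w).
Proof.
rewrite (Rint_eq (g := fun w => \sum_(p <- l) p.1 * (X p.2 w * X h w))); last first.
  by move=> w _; rewrite /lc big_distrl/=; apply: eq_bigr => i _; ring.
have lXX p : L1 (fun w => X p w * X h w) by exact: L2M.
rewrite Rint_sum//; last by move=> p; exact: L1Z.
by apply: eq_bigr => p _; rewrite RintZ.
Qed.

Lemma E_lc_X_rev l h : E (fun w => lc l w * X h w) = E (fun w => lc (rev_lc l) w * X (- h) w).
Proof. by rewrite !E_lc_X big_map; apply: eq_bigr => p _; rewrite E2_rev. Qed.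

Lemma E_lc_lc l l' : E (fun w => lc l w * lc l' w) =
  \sum_(p <- l') p.1 * E (fun w => lc l w * X p.2 w).
Proof.
rewrite (Rint_eq (g := fun w => \sum_(p <- l') p.1 * (lc l w * X p.2 w))); last first.
  by move=> w _; rewrite [X in _ * X]/lc big_distrr/=; apply: eq_bigr => i _; ring.
have lXX p : L1 (fun w => lc l w * X p w) by apply: L2M => //; exact: L2_lc.
rewrite Rint_sum//; last by move=> p; exact: L1Z.
by apply: eq_bigr => p _; rewrite RintZ.
Qed.

(** Time reversal is an isometry on combinations of the series, as second moments are reversible. So
    closeness to [Z 0] yields control of the reversed combinations. *)
Lemma norm2_lc_rev l : n2 (lc (rev_lc l)) = n2 (lc l).
Proof.
have e k : E (fun w => lc k w ^+ 2) = E (fun w => lc k w * lc k w).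
  by apply: Rint_eq => w _; rewrite expr2.
rewrite /norm2 !e !E_lc_lc big_map; congr Num.sqrt; apply: eq_bigr => p _.
by rewrite /= -E_lc_X_rev.
Qed.

Lemma lcB l l' w : lc l w - lc l' w = lc (l ++ [seq (- p.1, p.2) | p <- l']) w.
Proof.
rewrite /lc big_cat big_map/= -sumrN; congr (_ + _).
by apply: eq_bigr => p _; rewrite mulNr.
Qed.

Lemma norm2_lcB_rev l l' : n2 (fun w => lc (rev_lc l) w - lc (rev_lc l') w) =
  n2 (fun w => lc l w - lc l' w).
Proof.
rewrite (norm2_eq (fun w _ => lcB l l' w)) -norm2_lc_rev; apply: norm2_eq => w _.
by rewrite lcB /rev_lc map_cat -!map_comp.
Qed.

Hypothesis X3_rev : forall t1 t2 : int, E (fun w => X 0 w * X t1 w * X t2 w) =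
  E (fun w => X 0 w * X (- t1) w * X (- t2) w).

(** Shift [s] to the origin, reverse there, and shift back. *)
Lemma E3_rev (s t r : int) : E (fun w => X s w * X t w * X r w) =
  E (fun w => X (- s) w * X (- t) w * X (- r) w).
Proof.
have a : s + - s = 0 by lia.
have b : - s + s = 0 by lia.
have e1 : - (t + - s) = - t + s by lia.
have e2 : - (r + - s) = - r + s by lia.
by rewrite (E3_shift s t r (- s)) (E3_shift (- s) (- t) (- r) s) a b X3_rev e1 e2.
Qed.

Lemma E_lc3_rev l : E (fun w => lc l w ^+ 3) = E (fun w => lc (rev_lc l) w ^+ 3).
Proof.
have e k : E (fun w => lc k w ^+ 3) = \sum_(p <- k) p.1 * (\sum_(q <- k) q.1 * (\sum_(r <- k) r.1 *
    E (fun w => X p.2 w * X q.2 w * X r.2 w))).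
  have l3 p q r : L1 (fun w => X p w * X q w * X r w) by exact: L3_prod (L3X p) (L3X q) (L3X r).
  rewrite (Rint_eq (g := fun w => \sum_(p <- k) p.1 * (\sum_(q <- k) q.1 * (\sum_(r <- k) r.1 *
    (X p.2 w * X q.2 w * X r.2 w))))).
    have lr p q : L1 (fun w => \sum_(r <- k) r.1 * (X p w * X q w * X r.2 w)).
      by apply: L1_sum => // r; exact: L1Z.
    have lq p : L1 (fun w => \sum_(q <- k) q.1 * (\sum_(r <- k) r.1 * (X p w * X q.2 w * X r.2 w))).
      by apply: L1_sum => // q; exact: L1Z.
    rewrite Rint_sum//; last by move=> p; exact: L1Z.
    apply: eq_bigr => p _; rewrite RintZ//; congr (_ * _).
    rewrite Rint_sum//; last by move=> q; exact: L1Z.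
    apply: eq_bigr => q _; rewrite RintZ//; congr (_ * _).
    rewrite Rint_sum//; last by move=> r; exact: L1Z.
    by apply: eq_bigr => r _; rewrite RintZ.
  move=> w _.
  have st x y : x * lc k w * y = \sum_(q <- k) q.1 * (x * X q.2 w * y).
    by rewrite /lc big_distrr big_distrl/=; apply: eq_bigr => q _; ring.
  rewrite (_ : lc k w ^+ 3 = 1 * lc k w * (lc k w * lc k w)); last by ring.
  rewrite st; apply: eq_bigr => p _; congr (_ * _).
  rewrite mul1r mulrA st; apply: eq_bigr => q _; congr (_ * _).
  by rewrite -[LHS]mulr1 st; apply: eq_bigr => r _; rewrite mulr1.
rewrite !e !big_map; apply: eq_bigr => p _; rewrite big_map; congr (_ * _).
apply: eq_bigr => q _; rewrite big_map; congr (_ * _).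
by apply: eq_bigr => r _; rewrite E3_rev.
Qed.

Hypothesis kappa3_neq0 : kappa3 Z != 0.
Hypothesis lZ3 : forall k, L3 (Z k).
Hypothesis spanX : forall e, 0 < e -> exists l, n2 (fun w => lc l w - Z 0 w) < e.

Let s0 : 0 < s2 Z := s2_gt0 s2_neq0.
Let sg := Num.sqrt (s2 Z).
Let sg0 : 0 < sg. Proof. by rewrite sqrtr_gt0. Qed.
Let sg2 : sg ^+ 2 = s2 Z. Proof. by rewrite sqr_sqrtr// ltW. Qed.

Lemma norm2_Z k : n2 (Z k) = sg.
Proof. by rewrite /norm2 E_innov_sqr. Qed.

Lemma norm2_ZB j k : j != k -> n2 (fun w => Z j w - Z k w) ^+ 2 = 2 * s2 Z.
Proof.
move=> jk; rewrite (norm2_eq (g := fun w => Z j w - comb Z [:: k] (fun=> 1) w)); last first.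
  by move=> w _; rewrite /comb big_seq1 mul1r.
rewrite norm2_sub_comb//; last exact: L2_innov.
have cjk : cf (Z j) k = 0 by rewrite cf_Z// (negbTE jk).
rewrite !big_seq1 cjk norm2_Z sg2; ring.
Qed.

(* The coefficients of [lc (rev_lc l)] have squares and cubes both summing to
   almost 1, which forces one of them to be almost 1. *)
Lemma near_shift z : 0 < z -> z <= 1 -> exists l m,
  n2 (fun w => lc l w - Z 0 w) <= z * sg /\ n2 (fun w => lc (rev_lc l) w - Z m w) <= z * sg.
Proof.
(* The squared distance at the end is at most [s2 * ((1 + h)^2 + 1 - 2 * (1 - 9 h)) = s2 * (20 h +
   h^2)], which is below [21 h * s2]. *)
move=> z0 z1; pose h := z ^+ 2 / 21.
have z2 : 0 < z ^+ 2 by rewrite exprn_gt0.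
have zz : z ^+ 2 <= z by rewrite expr2 ler_piMr// ltW.
have hz : h * 21 = z ^+ 2 by rewrite divfK.
have h0 : 0 < h by lra.
have h1 : h <= 1 / 21 by lra.
have [l ll] := spanX (mulr_gt0 h0 sg0).
set U := lc l in ll; set V := lc (rev_lc l).
have lU : L2 U by exact: L2_lc. have lV : L2 V by exact: L2_lc.
have cU : clos U by exact: clos_lc. have cV : clos V by exact: clos_lc.
have k0 : 0 < `|kappa3 Z| * h by rewrite mulr_gt0// normr_gt0.
have [s us hs] := cube_formula iidZ s2_neq0 cU (L3_lc l) lZ3 k0.
have [s' us' hs'] := cube_formula iidZ s2_neq0 cV (L3_lc _) lZ3 k0.
pose r := undup (s ++ s').
have ur : uniq r := undup_uniq _.
(* Index 0 is forced in because the dominant coefficient of [U] sits there. *)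
pose r0 := undup (0 :: r); have ur0 : uniq r0 := undup_uniq _.
have {}hs : `|E (fun w => U w ^+ 3) - kappa3 Z * \sum_(i <- r0) cf U i ^+ 3| < `|kappa3 Z| * h.
  by apply: hs => // i si; rewrite mem_undup inE mem_undup mem_cat si orbT.
have {}hs' : `|E (fun w => V w ^+ 3) - kappa3 Z * \sum_(i <- r0) cf V i ^+ 3| < `|kappa3 Z| * h.
  by apply: hs' => // i si; rewrite mem_undup inE mem_undup mem_cat si !orbT.
have dUV : `|\sum_(i <- r0) cf U i ^+ 3 - \sum_(i <- r0) cf V i ^+ 3| <= 2 * h.
  have := ler_normB (E (fun w => V w ^+ 3) - kappa3 Z * \sum_(i <- r0) cf V i ^+ 3)
    (E (fun w => U w ^+ 3) - kappa3 Z * \sum_(i <- r0) cf U i ^+ 3).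
  have e3 : E (fun w => V w ^+ 3) = E (fun w => U w ^+ 3) := esym (E_lc3_rev l).
  rewrite e3 in hs' *.
  rewrite (_ : _ - _ - (_ - _) = kappa3 Z * (\sum_(i <- r0) cf U i ^+ 3 - \sum_(i <- r0) cf V i ^+ 3)); last by ring.
  rewrite normrM => ub.
  rewrite -(@ler_pM2l _ `|kappa3 Z|) ?normr_gt0//.
  by apply: (le_trans ub); lra.
have bU : \sum_(i <- r0) (cf U i - (0 == i)%:R) ^+ 2 <= h ^+ 2.
  have := @bessel _ _ _ P Z iidZ s2_neq0 (fun w => U w - Z 0 w) r0 (L2B mT lU (L2_innov iidZ 0)) ur0.
  have lZ0 : L2 (Z 0) by exact: L2_innov.
  rewrite (eq_bigr (fun i => (cf U i - (0 == i)%:R) ^+ 2)); last first.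
    by move=> i _; rewrite cfB// cf_Z.
  have hsg : 0 <= h * sg by rewrite mulr_ge0// ltW.
  have le2 : n2 (fun w => U w - Z 0 w) ^+ 2 <= (h * sg) ^+ 2.
    by rewrite ler_sqr ?nnegrE ?norm2_ge0// ltW.
  move=> /le_trans /(_ le2).
  by rewrite exprMn sg2 mulrC ler_pM2r.
have r00 : 0 \in r0 by rewrite mem_undup inE eqxx.
have ti i : i \in r0 -> `|cf U i - (0 == i)%:R| <= h.
  move=> ir; rewrite -ler_sqr ?nnegrE ?(ltW h0)// real_normK ?num_real//.
  apply: le_trans bU; rewrite (bigD1_seq i)//= lerDl.
  by apply: sumr_ge0 => j _; exact: sqr_ge0.
(* The coefficient at 0 is at least [1 - h]; the others are at least [- h] with squares summing to
   at most [h^2], so their cubes lose at most [h^3]. *)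
have SU : (1 - h) ^+ 3 - h ^+ 3 <= \sum_(i <- r0) cf U i ^+ 3.
  move: bU; rewrite !(bigD1_seq 0 r00 ur0)/=.
  set q := \sum_(i <- r0 | i != 0) _; set q3 := \sum_(i <- r0 | i != 0) _ => bU.
  have qE : q = \sum_(i <- r0 | i != 0) cf U i ^+ 2.
    by apply: eq_bigr => i; rewrite eq_sym => /negbTE ->; rewrite subr0.
  have u0 : `|cf U 0 - 1| <= h := ti 0 r00.
  have u00 : 1 - h <= cf U 0 by move: u0; rewrite ler_norml => /andP[]; lra.
  have qh : q <= h ^+ 2 by apply: le_trans bU; rewrite lerDr sqr_ge0.
  have q3h : - h * q <= q3.
    rewrite qE /q3 big_distrr/= [leLHS]big_seq_cond [leRHS]big_seq_cond; apply: ler_sum => i /andP[ir i0].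
    have := ti i ir; rewrite eq_sym (negbTE i0) subr0 ler_norml => /andP[+ _].
    move: (cf U i) => x hi; rewrite [x ^+ 3]exprS.
    by apply: ler_wpM2r => //; exact: sqr_ge0.
  have c3 : (1 - h) ^+ 3 <= cf U 0 ^+ 3.
    by apply: lerXn2r => //; rewrite nnegrE; lra.
  have : - h * h ^+ 2 <= q3 by apply: le_trans q3h; rewrite ler_nM2l ?oppr_lt0.
  by rewrite exprS; lra.
have nV : n2 V <= (1 + h) * sg.
  rewrite /V norm2_lc_rev; apply: (le_trans (norm2_sub mT lU (L2_innov iidZ 0))).
  by rewrite norm2_Z; move: ll; lra.
have nV2 : n2 V ^+ 2 <= (1 + h) ^+ 2 * s2 Z.
  by rewrite -sg2 -exprMn ler_sqr ?nnegrE ?norm2_ge0// mulr_ge0 ?(ltW sg0)//; lra.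
have SV2 : \sum_(i <- r0) cf V i ^+ 2 <= (1 + h) ^+ 2.
  have := le_trans (bessel iidZ s2_neq0 lV ur0) nV2.
  by rewrite mulrC ler_pM2r.
(* Otherwise the cubes would sum to at most [1 - 9 h] times the sum of squares, hence to at most
   [(1 - 9 h) * (1 + h)^2], short of the known lower bound by [2 h + 20 h^2 + 7 h^3]. *)
have [m Vm] : exists m, 1 - 9 * h < cf V m.
  apply: contrapT => no.
  have le i : cf V i <= 1 - 9 * h by rewrite leNgt; apply/negP => lt; apply: no; exists i.
  have SV3 : \sum_(i <- r0) cf V i ^+ 3 <= (1 - 9 * h) * (1 + h) ^+ 2.
    apply: (@le_trans _ _ ((1 - 9 * h) * \sum_(i <- r0) cf V i ^+ 2)).
      rewrite big_distrr/=; apply: ler_sum => i _; rewrite exprS ler_wpM2r ?sqr_ge0//.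
    by rewrite ler_wpM2l//; lra.
  have /andP[_ d1] : true && (\sum_(i <- r0) cf U i ^+ 3 - \sum_(i <- r0) cf V i ^+ 3 <= 2 * h).
    by rewrite andTb; apply: le_trans dUV; exact: ler_norm.
  have : (1 - h) ^+ 3 - h ^+ 3 - 2 * h <= (1 - 9 * h) * (1 + h) ^+ 2 by lra.
  apply/negP; rewrite -ltNge.
  have hh : 0 <= h ^+ 2 by exact: sqr_ge0.
  have hhh : 0 <= h ^+ 3 by rewrite exprn_ge0// ltW.
  rewrite -subr_gt0 (_ : _ - _ = 2 * h + 20 * h ^+ 2 + 7 * h ^+ 3); last by ring.
  by lra.
exists l, m; split.
  by apply: (le_trans (ltW ll)); rewrite ler_wpM2r ?(ltW sg0)//; lra.
rewrite -ler_sqr ?nnegrE ?norm2_ge0 ?mulr_ge0 ?(ltW z0) ?(ltW sg0)// exprMn sg2 -hz.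
rewrite (norm2_eq (g := fun w => V w - comb Z [:: m] (fun=> 1) w)); last first.
  by move=> w _; rewrite /comb big_seq1 mul1r.
rewrite norm2_sub_comb// !big_seq1.
rewrite (_ : _ + _ = n2 V ^+ 2 + s2 Z * (1 - 2 * cf V m)); last by move: (cf V m) => x; ring.
apply: (@le_trans _ _ ((1 + h) ^+ 2 * s2 Z + s2 Z * (1 - 2 * (1 - 9 * h)))).
  by apply: lerD => //; rewrite ler_wpM2l ?(ltW s0)//; lra.
rewrite [X in X + _]mulrC -mulrDr mulrC ler_wpM2r ?(ltW s0)//.
have : h ^+ 2 <= h by rewrite expr2 ler_piMr ?(ltW h0)//; lra.
by rewrite sqrrD expr1n mul1r mulr2n; lra.
Qed.

(* All the [near_shift] indices agree since distinct innovations are [sqrt 2 sg] apart. *)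
Lemma coef_symmetric : exists m, forall h, c h = c (- h - m).
Proof.
(* At tolerance 1/5 the path from [Z m] to [Z m0] has length at most 4/5 of [sg]: two errors at its
   ends and two in the distance of the reversed combinations, which equals that of [lc l] and
   [lc l0]. *)
have z0 : 0 < (5%:R)^-1 :> R by rewrite invr_gt0.
have z1 : (5%:R)^-1 <= 1 :> R by rewrite invf_le1// ler1n.
have [l0 [m0 [h0 h0']]] := near_shift z0 z1.
exists m0 => h.
have key z : 0 < z -> z <= 5%:R^-1 -> `|s2 Z * (c h - c (- h - m0))| <= z * (sg * (n2 (X h) + n2 (X (- h)))).
  move=> zp z5; have [l [m [h1 h1']]] : exists l m, n2 (fun w => lc l w - Z 0 w) <= z * sg /\
      n2 (fun w => lc (rev_lc l) w - Z m w) <= z * sg by apply: near_shift => //; lra.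
  have mm : m = m0.
    apply/eqP/contraT => mm; have := norm2_ZB mm.
    have t : n2 (fun w => Z m w - Z m0 w) <= sg.
      have lV k : L2 (lc k) by exact: L2_lc.
      have lZ k : L2 (Z k) by exact: L2_innov.
      have t1 := norm2_dist mT (lZ m) (lZ m0) (lV (rev_lc l)).
      have t2 := norm2_dist mT (lV (rev_lc l)) (lZ m0) (lV (rev_lc l0)).
      have t3 := norm2_dist mT (lV l) (lV l0) (lZ 0).
      rewrite norm2_lcB_rev in t2.
      have d1 : n2 (fun w => Z m w - lc (rev_lc l) w) = n2 (fun w => lc (rev_lc l) w - Z m w).
        exact: norm2_distC.
      have d3 : n2 (fun w => Z 0 w - lc l0 w) = n2 (fun w => lc l0 w - Z 0 w) by exact: norm2_distC.
      have zs : z * sg <= 5%:R^-1 * sg by rewrite ler_wpM2r ?(ltW sg0).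
      have fs : 5 * (5%:R^-1 * sg) = sg by rewrite mulrA divff ?mul1r.
      have sgp := sg0.
      apply: (le_trans t1); rewrite d1; apply: (le_trans (lerD h1' t2)).
      rewrite d3 in t3; have t4 := le_trans t3 (lerD h1 h0).
      apply: (le_trans (lerD (lexx _) (lerD t4 h0'))).
      move: zs fs; move: (5%:R^-1 * sg) (z * sg) => q q' zs fs.
      lra.
    move=> e; have : n2 (fun w => Z m w - Z m0 w) ^+ 2 <= sg ^+ 2.
      by rewrite ler_sqr ?nnegrE ?norm2_ge0 ?(ltW sg0).
    rewrite e sg2; have sp := s0; lra.
  rewrite mm in h1'.
  have lU : L2 (lc l) by exact: L2_lc.
  have lV : L2 (lc (rev_lc l)) by exact: L2_lc.
  have lD1 : L2 (fun w => lc l w - Z 0 w) by apply: L2B => //; exact: L2_innov.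
  have lD2 : L2 (fun w => lc (rev_lc l) w - Z m0 w) by apply: L2B => //; exact: L2_innov.
  have c1 := cauchy_schwarz mT lD1 (lX h).
  have c2 := cauchy_schwarz mT lD2 (lX (- h)).
  (* Reversal identifies the covariance of [lc l] with [X h] and that of its reverse with [X (- h)].
     Replacing the combinations by [Z 0] and [Z m0] turns these into [s2 * c h] and
     [s2 * c (- h - m0)]. *)
  have e1 : E (fun w => (lc l w - Z 0 w) * X h w) = E (fun w => lc l w * X h w) - s2 Z * c h.
    have -> : c h = cf (X h) 0 by rewrite (cf_X iidZ Xlim s2_neq0) subr0.
    rewrite -cfE//.
    rewrite -RintB//; [|by apply: L2M => //; exact: L2_innov..].
    by apply: Rint_eq => w _; ring.
  have e2 : E (fun w => (lc (rev_lc l) w - Z m0 w) * X (- h) w) = E (fun w => lc l w * X h w) - s2 Z * c (- h - m0).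
    rewrite E_lc_X_rev -(cf_X iidZ Xlim s2_neq0) -cfE//.
    rewrite -RintB//; [|by apply: L2M => //; exact: L2_innov..].
    by apply: Rint_eq => w _; ring.
  have -> : s2 Z * (c h - c (- h - m0)) = E (fun w => (lc (rev_lc l) w - Z m0 w) * X (- h) w)
      - E (fun w => (lc l w - Z 0 w) * X h w) by rewrite e1 e2; ring.
  apply: (le_trans (ler_normB _ _)).
  have := ler_wpM2r (norm2_ge0 P setT (X h)) h1; have := ler_wpM2r (norm2_ge0 P setT (X (- h))) h1'.
  lra.
set C := sg * _ in key.
have C0 : 0 <= C by rewrite mulr_ge0 ?(ltW sg0)// addr_ge0 ?norm2_ge0.
apply/eqP; rewrite -subr_eq0 -[_ == _](mulrI_eq0 _ (lregP s2_neq0)) -normr_eq0.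
apply/eqP/le_anti/andP; split => //.
apply/ler_addgt0Pl => e e0; rewrite addr0.
have m0' : 0 < Num.min 5%:R^-1 (e / (C + 1)) by rewrite lt_min z0 divr_gt0// ltr_wpDl.
apply: (le_trans (key _ m0' _)); first by rewrite ge_min lexx.
apply: (@le_trans _ _ (e / (C + 1) * (C + 1))); last by rewrite divfK//; lra.
by apply: ler_pM => //; [exact: ltW|rewrite ge_min lexx orbT|lra].
Qed.

(** The relabelling reflects the block of times onto itself and corrects by [m]; it is an
    involution, and [coef_symmetric] is what matches the coefficients. *)
Lemma reversible_of_span : reversible P X.
Proof.
have [m cm] := coef_symmetric => k t A mA.
have := @same_law _ _ _ P Z iidZ k.+1 (fun j => X (t + j%:Z)) (fun j => X (t + k%:Z - j%:Z))
  (fun i => 2 * t + k%:Z - i + m) (fun i => 2 * t + k%:Z - i + m).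
move=> /(_ _ _ _ _ _ A mA) h.
rewrite [X in P X = _](_ : _ = (fun w => [tuple X (t + j%:Z) w | j < k.+1]) @^-1` A); last first.
  by apply/seteqP; split => w /=; rewrite in_setE.
rewrite [X in _ = P X](_ : _ = (fun w => [tuple X (t + k%:Z - j%:Z) w | j < k.+1]) @^-1` A); last first.
  by apply/seteqP; split => w /=; rewrite in_setE.
apply: h => //.
- by move=> i; lia.
- by move=> i; lia.
- by move=> j i; rewrite !(cf_X iidZ Xlim s2_neq0) [RHS]cm; congr c; lia.
Qed.

End Reversal.

(** * A multiplicative class theorem *)

Section Threshold.
Variable R : realType.
Implicit Types x y : R.

Lemma one_sub_exp_ge x n : 0 <= x -> x <= 1 -> 1 - n%:R * x <= (1 - x) ^+ n.
Proof.
move=> x0 x1; elim: n => [|n ih]; first by rewrite mul0r subr0 expr0.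
rewrite exprS -natr1; apply: (@le_trans _ _ ((1 - x) * (1 - n%:R * x))).
  have : 0 <= n%:R * x ^+ 2 by rewrite mulr_ge0 ?sqr_ge0.
  by rewrite expr2; nra.
by rewrite ler_wpM2l// subr_ge0.
Qed.

Lemma one_add_exp_ge x n : 0 <= x -> 1 + n%:R * x <= (1 + x) ^+ n.
Proof.
move=> x0; elim: n => [|n ih]; first by rewrite mul0r addr0 expr0.
rewrite exprS -natr1; apply: (@le_trans _ _ ((1 + x) * (1 + n%:R * x))).
  have : 0 <= n%:R * x ^+ 2 by rewrite mulr_ge0 ?sqr_ge0.
  by rewrite expr2; nra.
by rewrite ler_wpM2l// addr_ge0.
Qed.

(** From [(1 - x) * (1 + x) <= 1] and Bernoulli's inequality for [1 + x]. *)
Lemma one_sub_exp_le x n : 0 <= x -> x <= 1 -> (1 - x) ^+ n * (1 + n%:R * x) <= 1.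
Proof.
move=> x0 x1; apply: (@le_trans _ _ ((1 - x) ^+ n * (1 + x) ^+ n)).
  by rewrite ler_wpM2l ?exprn_ge0 ?subr_ge0//; exact: one_add_exp_ge.
rewrite -exprMn exprn_ile1//; first by rewrite mulr_ge0 ?subr_ge0// addr_ge0.
have := sqr_ge0 x; rewrite expr2; nra.
Qed.

(* Polynomials in y converging on [0, 1] to the indicator of y > 1/2. *)
Definition threshold n y := 1 - (1 - y ^+ (n * n)) ^+ (2 ^ (n * n - n)).

Lemma threshold_itv n y : 0 <= y -> y <= 1 -> 0 <= threshold n y <= 1.
Proof.
move=> y0 y1; have h0 : 0 <= y ^+ (n * n) by rewrite exprn_ge0.
have h1 : y ^+ (n * n) <= 1 by rewrite exprn_ile1.
rewrite /threshold subr_ge0 exprn_ile1 ?subr_ge0//=; last by rewrite gerBl.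
by rewrite gerBl exprn_ge0// subr_ge0.
Qed.

Lemma half_cvg0 : (2^-1 : R) ^+ n @[n --> \oo] --> (0 : R).
Proof.
have := @cvg_geometric R 1 2^-1; rewrite (_ : geometric 1 2^-1 = fun n => 2^-1 ^+ n).
  by apply; rewrite ger0_norm ?invr_ge0// invf_lt1// ltr1n.
by apply/funext => n; rewrite /= mul1r.
Qed.

(** The exponents are chosen so that their product term is [2^(n^2 - n) * y^(n^2) = (2 y)^(n^2) /
    2^n]. For [y <= 1/2] this is at most [2^-n], and Bernoulli bounds the polynomial by it. For
    [y > 1/2] it is at least [2^n] as soon as [(2 y)^n >= 4], and [one_sub_exp_le] makes the
    distance to 1 at most [2^-n]. *)
Lemma threshold_cvg y : 0 <= y -> y <= 1 ->
  threshold n y @[n --> \oo] --> ((2^-1 < y)%R%:R : R).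
Proof.
move=> y0 y1.
have y0n n : 0 <= y ^+ (n * n) by rewrite exprn_ge0.
have y1n n : y ^+ (n * n) <= 1 by rewrite exprn_ile1.
have nn n : (n <= n * n)%N by case: n => // n; rewrite leq_pmulr.
have e n : ((2 ^ (n * n - n))%:R : R) = 2 ^+ (n * n) * (2^-1) ^+ n.
  by rewrite natrX -[in RHS](subnK (nn n)) exprD -mulrA -exprMn divff// expr1n mulr1.
have e' n : ((2 ^ (n * n - n))%:R * y ^+ (n * n) : R) = (2 * y) ^+ (n * n) * (2^-1) ^+ n.
  by rewrite e mulrAC exprMn.
case: (ltP 2^-1 y) => hy.
  have [N hN] : exists N, forall n, (N <= n)%N -> 4 <= (2 * y) ^+ n.
    have q0 : 0 < 2 * y - 1 by lra.
    pose N := (Num.truncn (3 / (2 * y - 1))).+1.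
    exists N => n Nn; have -> : 2 * y = 1 + (2 * y - 1) by ring.
    apply: le_trans (one_add_exp_ge n (ltW q0)).
    have : 3 / (2 * y - 1) <= n%:R.
      by apply: (le_trans (ltW (truncnS_gt _))); rewrite ler_nat.
    by rewrite ler_pdivrMr//; lra.
  apply/cvgrPdist_le => eps eps0.
  have /cvgrPdist_le/(_ _ eps0)[N' _ hN'] := half_cvg0.
  exists (maxn N N') => // n /=; rewrite geq_max => /andP[n1 n2].
  have := hN' n n2; rewrite /= sub0r normrN ger0_norm ?exprn_ge0 ?invr_ge0// => h.
  apply: le_trans h; rewrite /threshold opprB addrC subrK.
  rewrite ger0_norm; last by rewrite exprn_ge0// subr_ge0.
  have := one_sub_exp_le (2 ^ (n * n - n)) (y0n n) (y1n n).
  rewrite e' [(2 * y) ^+ _]exprM -exprMn => h.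
  have b : 2 ^+ n <= 1 + ((2 * y) ^+ n / 2) ^+ n :> R.
    apply: (@le_trans _ _ (((2 * y) ^+ n / 2) ^+ n)); last by rewrite lerDr.
    apply: lerXn2r; rewrite ?nnegrE//; first by have := hN n n1; lra.
    by have := hN n n1; lra.
  rewrite exprVn -[leRHS]mul1r ler_pdivlMr ?exprn_gt0//.
  apply: le_trans h; rewrite ler_wpM2l// exprn_ge0// subr_ge0//.
apply/cvgrPdist_le => eps eps0.
have /cvgrPdist_le/(_ _ eps0)[N' _ hN'] := half_cvg0.
exists N' => // n /= n2.
have := hN' n n2; rewrite /= !sub0r !normrN ger0_norm ?exprn_ge0 ?invr_ge0// => h.
apply: le_trans h; have /andP[t0 _] := threshold_itv n y0 y1.
rewrite ger0_norm// /threshold.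
have := one_sub_exp_ge (2 ^ (n * n - n)) (y0n n) (y1n n); rewrite e' => h.
have : (2 * y) ^+ (n * n) * (2^-1) ^+ n <= (2^-1 : R) ^+ n.
  rewrite ler_piMl ?exprn_ge0 ?invr_ge0// exprn_ile1//; lra.
lra.
Qed.

End Threshold.


Section MultiplicativeClass.
Import HBNNSimple.
Context d (T : measurableType d) (R : realType) (D : set T).
Variables (A F : set (T -> R)).
Hypothesis Acst : forall a, A (fun=> a).
Hypothesis AD : forall f g, A f -> A g -> A (fun x => f x + g x).
Hypothesis AM : forall f g, A f -> A g -> A (fun x => f x * g x).
Hypothesis Abd : forall f, A f -> exists M : R, forall x, D x -> `|f x| <= M.

Lemma algebra_exp f n : A f -> A (fun x => f x ^+ n).
Proof.
move=> Af; elim: n => [|n ih]; first by under eq_fun do rewrite expr0; exact: Acst.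
by under eq_fun do rewrite exprS; exact: AM.
Qed.

Lemma algebra_compl f : A f -> A (fun x => 1 - f x).
Proof.
move=> Af; have := AD (Acst 1) (AM (Acst (- 1)) Af).
by under eq_fun do rewrite mulN1r.
Qed.

(** Approximation is required on [D] only, so sets with the same trace on [D] are interchangeable.
    The bounds in [0, 1] make products stay bounded, giving a pi-system, and allow bounded
    limits. *)
Definition lim_set (B : set T) := exists h : nat -> T -> R,
  [/\ forall n, A (h n), forall n x, D x -> 0 <= h n x <= 1 &
      forall x, D x -> h n x @[n --> \oo] --> (\1_B x : R)].

Lemma lim_setI : setI_closed lim_set.
Proof.
move=> B B' [h [Ah h1 hB]] [h' [Ah' h1' hB']].
exists (fun n x => h n x * h' n x); split.
- by move=> n; exact: AM.
- move=> n x Dx; have /andP[a b] := h1 n x Dx; have /andP[a' b'] := h1' n x Dx.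
  by rewrite mulr_ge0//= mulr_ile1.
- move=> x Dx; rewrite indicI; apply: cvgM; [exact: hB|exact: hB'].
Qed.

Lemma lim_set_trace B B' : (forall x, D x -> B x <-> B' x) -> lim_set B -> lim_set B'.
Proof.
move=> BB' [h [Ah h1 hB]]; exists h; split => // x Dx.
rewrite (_ : \1_B' x = \1_B x)//; first exact: hB.
by rewrite !indicE; congr (_%:R); congr nat_of_bool; apply/idP/idP; rewrite !inE => /BB'; exact.
Qed.

(** An affine map sends the values of [f] on [D] into [0, 1] and the level 0 to 1/2, where the
    threshold polynomials separate. *)
Lemma lim_set_pos f : A f -> lim_set [set x | 0 < f x].
Proof.
move=> Af; have [M0 hM0] := Abd Af.
pose M := `|M0| + 1; have Mp : 0 < M by rewrite /M ltr_wpDl.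
have hM x : D x -> `|f x| <= M.
  by move=> /hM0 /le_trans; apply; rewrite /M (le_trans (ler_norm _))// lerDl.
pose y x := 2^-1 + (2 * M)^-1 * f x.
have Ay : A y by apply: AD; [exact: Acst|apply: AM => //; exact: Acst].
have y01 x : D x -> 0 <= y x <= 1.
  move=> /hM; rewrite ler_norml => /andP[a b].
  have : - 2^-1 <= (2 * M)^-1 * f x by rewrite mulrC ler_pdivlMr; lra.
  have : (2 * M)^-1 * f x <= 2^-1 by rewrite mulrC ler_pdivrMr; lra.
  by move=> *; apply/andP; split; rewrite /y; lra.
exists (fun n x => threshold n (y x)); split.
- move=> n; rewrite /threshold; apply: algebra_compl; apply: algebra_exp; apply: algebra_compl; exact: algebra_exp.
- by move=> n x /y01/andP[? ?]; exact: threshold_itv.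
- move=> x Dx; have /andP[a b] := y01 x Dx.
  rewrite (_ : \1__ x = (2^-1 < y x)%R%:R); first exact: threshold_cvg.
  rewrite indicE; congr (_%:R); congr nat_of_bool; rewrite /y ltrDl pmulr_rgt0.
    by apply/idP/idP; rewrite inE.
  by rewrite invr_gt0 mulr_gt0.
Qed.

Hypothesis AF : A `<=` F.
Hypothesis FD : forall f g, F f -> F g -> F (fun x => f x + g x).
Hypothesis FZ : forall a f, F f -> F (fun x => a * f x).
Hypothesis Flim : forall (g : nat -> T -> R) (f : T -> R) (M : R), (forall n, F (g n)) ->
  (forall n x, D x -> `|g n x| <= M) -> (forall x, D x -> g n x @[n --> \oo] --> f x) -> F f.

Lemma class_sum (J : Type) (s : seq J) (h : J -> T -> R) : (forall j, F (h j)) ->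
  F (fun x => \sum_(j <- s) h j x).
Proof.
move=> Fh; elim: s => [|j s ih].
  by under eq_fun do rewrite big_nil; exact/AF/Acst.
by under eq_fun do rewrite big_cons; exact: FD.
Qed.

(** Sets with indicator in [F] form a Dynkin system: complements by linearity, disjoint unions by
    bounded limits. It contains the pi-system [lim_set]. *)
Lemma class_indic B : <<s lim_set >> B -> F (\1_B).
Proof.
rewrite -setI_closed_g_dynkin_g_sigma_algebra; last exact: lim_setI.
move=> /(_ [set B | F (\1_B)]); apply; split; first split.
- rewrite /= (_ : \1_setT = fun=> 1); first exact/AF/Acst.
  by apply/funext => x; rewrite indicT.
- move=> C /= FC; have -> : \1_(~` C) = (fun x => 1 + (- 1) * \1_C x : R).
    apply/funext => x; rewrite !indicE in_setC.
    by case: (x \in C); rewrite mulN1r ?subrr ?subr0.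
  by apply: FD; [exact/AF/Acst|exact: FZ].
- move=> C tC FC /=.
  have e n : (fun x => \sum_(k < n) \1_(C k) x) = (\1_(\big[setU/set0]_(k < n) C k) : T -> R).
    apply/funext => x; elim: n => [|n ih]; first by rewrite !big_ord0 indic0.
    rewrite !big_ord_recr/= ih !indicE in_setU.
    have [xC|] := boolP (x \in C n); last by rewrite orbF addr0.
    case: (boolP (x \in \big[setU/set0]_(i < n) C i)) => [|_]; last by rewrite add0r.
    rewrite inE -bigcup_mkord => -[i /= ni xi]; rewrite inE in xC.
    have := tC i n Logic.I Logic.I (ex_intro _ x (conj xi xC)) => ii.
    by rewrite ii ltnn in ni.
  apply: (Flim (g := fun n x => \sum_(k < n) \1_(C k) x) (M := 1)).
  + by move=> n; apply: class_sum => k; exact: FC.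
  + move=> n x _; have -> := congr1 (fun f => f x) (e n).
    by rewrite indicE normr_nat; case: (x \in _); rewrite ?ler01.
  + move=> x _; apply: cvg_near_cst.
    have [xC|xC] := pselect ((\bigcup_k C k) x).
      have [k _ Ck] := xC; exists k.+1 => // n /= kn.
      have -> := congr1 (fun f => f x) (e n).
      rewrite !indicE !mem_set// -bigcup_mkord; by exists k.
    apply: nearW => n; have -> := congr1 (fun f => f x) (e n).
    rewrite !indicE !memNset// -bigcup_mkord => -[k _ Ck]; apply: xC; by exists k.
- by move=> C [h [Ah h1 hC]]; apply: (Flim (M := 1) _ _ hC) => [n|n x Dx]; [exact/AF/Ah|have /andP[a b] := h1 n x Dx; rewrite ger0_norm].
Qed.

Lemma class_bounded (g : T -> R) M : (@measurable _ T `<=` <<s lim_set >>) ->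
  measurable_fun setT g -> (forall x, 0 <= g x <= M) -> F g.
Proof.
move=> mG mg gM.
have mg' : measurable_fun setT (EFin \o g) by exact/measurable_EFinP.
pose s := nnsfun_approx measurableT mg'.
have g0 x : setT x -> (0 <= (EFin \o g) x)%E.
  by move=> _; rewrite lee_fin; have /andP[] := gM x.
apply: (Flim (g := fun n x => s n x) (M := M)).
- move=> n; rewrite (_ : (fun x => s n x) = fun x => \sum_(y <- finmap.enum_fset (fset_set (range (s n))))
     y * \1_(s n @^-1` [set y]) x); last first.
    by apply/funext => x; rewrite fimfunE fsbig_finite.
  apply: class_sum => y; apply: FZ; apply: class_indic; apply: mG; exact: measurable_funPTI.
- move=> n x _; have /andP[a b] := gM x.
  rewrite ger0_norm//; apply: le_trans b.
  have := congr1 (fun h : T -> R => h x) (nnsfun_approxE measurableT mg' n) => /= ->.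
  by have := @le_approx _ _ _ setT (EFin \o g) n x g0 Logic.I; rewrite lee_fin.
- by move=> x _; have /fine_cvgP[_] := cvg_nnsfun_approx measurableT mg' g0 (Logic.I : setT x).
Qed.

End MultiplicativeClass.

(** * Density of cosine polynomials *)

Section TrigIntegrals.
Variable R : realType.
Notation lam := (@lebesgue_measure R).
Notation TR := (measurableTypeR R).

Lemma sin_nat_pi n : sin (n%:R * pi) = 0 :> R.
Proof.
elim: n => [|n ih]; first by rewrite mul0r sin0.
by rewrite -natr1 mulrDl mul1r sinDpi ih oppr0.
Qed.

Lemma sin_int_pi (h : int) : sin (h%:~R * pi) = 0 :> R.
Proof.
case: h => n; first exact: sin_nat_pi.
by rewrite NegzE mulrNz mulNr sinN (sin_nat_pi n.+1) oppr0.
Qed.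

Lemma cos_int_pi (h : int) : cos (h%:~R * (2 * pi)) = 1 :> R.
Proof.
rewrite (_ : h%:~R * (2 * pi) = (h%:~R * pi) + h%:~R * pi); last by ring.
rewrite cosD sin_int_pi mul0r subr0 -expr2.
by have := @cos2Dsin2 R (h%:~R * pi); rewrite sin_int_pi expr0n addr0.
Qed.

Lemma sin_int_2pi (h : int) : sin (h%:~R * (2 * pi)) = 0 :> R.
Proof.
rewrite (_ : h%:~R * (2 * pi) = (h%:~R * pi) + h%:~R * pi); last by ring.
by rewrite sinD sin_int_pi !mul0r mulr0 addr0.
Qed.

(** Orthogonality on the half period: it identifies a constant density on (0, pi) with white
    noise. *)
Lemma Rint_cos (h : int) :
  Rintegral lam (`]0, pi[%classic : set TR) (fun x : TR => cos (h%:~R * (x : R)) : R) = pi *+ (h == 0).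
Proof.
have [->|h0] := eqVneq h 0.
  rewrite (Rint_eq (g := fun=> 1)); last by move=> x _; rewrite mul0r cos0.
  rewrite Rintegral_cst//= lebesgue_measure_itv/= lte_fin pi_gt0.
  by rewrite -EFinB /= subr0 mul1r mulr1n.
have k0 : h%:~R != 0 :> R by rewrite intr_eq0.
set k : R := h%:~R in k0 *.
have dk x : is_derive x (1 : R) (fun y : R => k^-1 * sin (k * y)) (cos (k * x)).
  have h1 : is_derive x (1 : R) (k \*: (id : R -> R)) (k *: (1 : R)) := @is_deriveZ R R^o R^o id k x 1 1 (@is_derive_id R R^o x 1).
  have h2 := @is_derive1_comp R (@sin R) (k \*: (id : R -> R)) x _ _ (is_derive_sin _) h1.
  have h3 := @is_deriveZ R R^o R^o (@sin R \o (k \*: (id : R -> R))) k^-1 x 1 _ h2.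
  apply: (is_derive_eq h3).
  by rewrite -[_ *: _]/(k^-1 * (cos (k * x) * (k * 1))) mulr1 mulrCA mulVf// mulr1.
have ck : continuous (fun y : R => k^-1 * sin (k * y)).
  by move=> x; apply/differentiable_continuous/derivable1_diffP; apply: ex_derive.
have cc : continuous (fun y : R => cos (k * y)).
  move=> x; apply: continuous_comp; last exact: continuous_cos.
  by apply: continuousM; [exact: cst_continuous|exact: id].
rewrite /Rintegral mulr0n.
rewrite integral_itv_bndo_bndc; last first.
  by apply/measurable_EFinP; apply: measurable_funS measurableT _ _ => //; exact: continuous_measurable_fun.
rewrite integral_itv_obnd_cbnd; last first.
  by apply/measurable_EFinP; apply: measurable_funS measurableT _ _ => //; exact: continuous_measurable_fun.
rewrite (@continuous_FTC2 R _ (fun y => k^-1 * sin (k * y))) ?pi_gt0//.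
- by rewrite /k sin_int_pi !mulr0 sin0 mulr0 -EFinB subrr.
- exact/continuous_subspaceT.
- split.
  + by move=> x _; apply: ex_derive.
  + by apply: cvg_at_right_filter; exact: ck.
  + by apply: cvg_at_left_filter; exact: ck.
- by move=> x _; rewrite derive1E; apply: derive_val.
Qed.

Lemma cosM (x y : R) : cos x * cos y = 2^-1 * (cos (x + y) + cos (x - y)).
Proof. by rewrite cosD cosB; field. Qed.

End TrigIntegrals.

Section CosineDensity.
Variable R : realType.
Notation lam := (@lebesgue_measure R).
Notation TR := (measurableTypeR R).
Notation J := (`]0, pi[%classic : set TR).
Implicit Types x : TR.
Variable F : TR -> R.
Hypothesis mF : measurable_fun setT F.
Hypothesis F0 : forall x, 0 < F x.
Hypothesis iF : lam.-integrable J (EFin \o F).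

Let lF : mem_L1 lam J F. Proof. exact: iF. Qed.
Let mJ : measurable J. Proof. exact: measurable_itv. Qed.
Let w (x : TR) : R := Num.sqrt (F x).
Let mw D : measurable_fun D w.
Proof.
apply: measurable_funS (measurableT) _ _ => //.
by apply: measurableT_comp mF; apply: continuous_measurable_fun; exact: sqrt_continuous.
Qed.
Let w2 x : w x ^+ 2 = F x. Proof. by rewrite sqr_sqrtr// ltW. Qed.
Let w0 x : 0 < w x. Proof. by rewrite sqrtr_gt0. Qed.
Let lw : mem_L2 lam J w.
Proof. by split => //; apply: (L1_eq mJ _ lF) => x _; rewrite w2. Qed.

Lemma measurable_cosTR (D : set TR) : measurable_fun D (@cos R : TR -> R).
Proof.
apply: measurable_funS measurableT _ _ => //.
exact: (continuous_measurable_fun (@continuous_cos R)).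
Qed.

Lemma measurable_cospoly (q : {poly R}) (D : set TR) : measurable_fun D (fun x : TR => q.[cos x] : R).
Proof.
rewrite (_ : (fun x : TR => _) = fun x : TR => \sum_(i < size q) q`_i * (cos (x : R)) ^+ i); last first.
  by apply/funext => x; rewrite horner_coef.
apply: measurable_sum => i; apply: measurable_funM; first exact: measurable_cst.
by apply: measurable_funX; exact: measurable_cosTR.
Qed.

Lemma cospoly_bounded (q : {poly R}) : exists M : R, forall x : TR, `|q.[cos x]| <= M.
Proof.
exists (\sum_(i < size q) `|q`_i|) => x; rewrite horner_coef.
apply: (le_trans (ler_norm_sum _ _ _)); apply: ler_sum => i _.
by rewrite normrM ler_piMr// normrX exprn_ile1// ler_norml cos_geN1 cos_le1.
Qed.

Let A : set (TR -> R) := [set f | exists q : {poly R}, f = fun x : TR => q.[cos x]].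
(** The class fed to the multiplicative class theorem: multipliers of [w = sqrt F] that cosine
    polynomials approximate in L2. The weight turns convergence in L2 of the density [F] into plain
    L2 convergence. *)
Let Fc : set (TR -> R) := [set g | mem_L2 lam J (fun x => g x * w x) /\
  forall e, 0 < e -> exists q : {poly R}, norm2 lam J (fun x : TR => q.[cos x] * w x - g x * w x) < e].

Let Acst a : A (fun=> a).
Proof. by exists a%:P; apply/funext => x; rewrite hornerC. Qed.
Let AD f g : A f -> A g -> A (fun x => f x + g x).
Proof. by move=> [q ->] [r ->]; exists (q + r); apply/funext => x; rewrite hornerD. Qed.
Let AM f g : A f -> A g -> A (fun x => f x * g x).
Proof. by move=> [q ->] [r ->]; exists (q * r); apply/funext => x; rewrite hornerM. Qed.
Let Abd f : A f -> exists M : R, forall x, J x -> `|f x| <= M.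
Proof. by move=> [q ->]; have [M hM] := cospoly_bounded q; exists M. Qed.

Let lq (q : {poly R}) : mem_L2 lam J (fun x : TR => q.[cos x] * w x).
Proof.
have [M hM] := cospoly_bounded q.
exact: (L2_bounded mJ (@measurable_cospoly q J) (fun x _ => hM x) lw).
Qed.

Let AF : A `<=` Fc.
Proof.
move=> f [q ->]; split => [//|e e0]; exists q.
by rewrite /norm2 (Rint_eq (g := fun=> 0)) ?Rint0 ?sqrtr0// => x _; rewrite subrr expr0n.
Qed.

Let FD f g : Fc f -> Fc g -> Fc (fun x => f x + g x).
Proof.
move=> [lf hf] [lg hg]; split.
  by apply: (L2_eq mJ _ (L2D mJ lf lg)) => x _; rewrite mulrDl.
move=> e e0; have e20 : 0 < e / 2 by lra.
have [q hq] := hf _ e20; have [r hr] := hg _ e20; exists (q + r).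
rewrite (norm2_eq (g := fun x => (q.[cos x] * w x - f x * w x) + (r.[cos x] * w x - g x * w x))); last first.
  by move=> x _; rewrite hornerD; ring.
apply: (le_lt_trans (norm2_triangle mJ (L2B mJ (lq q) lf) (L2B mJ (lq r) lg))); lra.
Qed.

Let FZ a f : Fc f -> Fc (fun x => a * f x).
Proof.
move=> [lf hf]; split.
  by apply: (L2_eq mJ _ (L2Z mJ a lf)) => x _; rewrite mulrA.
move=> e e0; have a0 : 0 < `|a| + 1 by rewrite ltr_wpDl.
have [q hq] := hf _ (divr_gt0 e0 a0); exists (a *: q).
rewrite (norm2_eq (g := fun x => a * (q.[cos x] * w x - f x * w x))); last first.
  by move=> x _; rewrite hornerZ; ring.
rewrite norm2Z//; last exact: L2B.
rewrite ltr_pdivlMr// in hq; apply: le_lt_trans hq.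
by rewrite mulrC ler_wpM2l ?norm2_ge0// lerDl.
Qed.

Let Flim (g : nat -> TR -> R) (f : TR -> R) (M : R) : (forall n, Fc (g n)) ->
  (forall n x, J x -> `|g n x| <= M) -> (forall x, J x -> g n x @[n --> \oo] --> f x) -> Fc f.
Proof.
move=> Fg gM gf.
have fM x : J x -> `|f x| <= M.
  move=> Jx; have h : `|g n x| @[n --> \oo] --> `|f x| by apply: cvg_norm; exact: gf.
  rewrite -(cvg_lim _ h)//; apply: limr_le; first by apply/cvg_ex; exists `|f x|.
  by apply: nearW => n; exact: gM.
have mgw n : measurable_fun J (fun x => g n x * w x) by case: (Fg n) => -[].
have gfw x : J x -> g n x * w x @[n --> \oo] --> f x * w x.
  by move=> Jx; apply: cvgM; [exact: gf|exact: cvg_cst].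
have mfw : measurable_fun J (fun x => f x * w x) by exact: measurable_fun_cvg mgw gfw.
have lfw : mem_L2 lam J (fun x => f x * w x).
  split => //; apply: (L1_le mJ (g := fun x => M ^+ 2 * F x)).
  - exact: measurable_funX.
  - exact: L1Z.
  - move=> x Jx; rewrite exprMn w2 normrM (gtr0_norm (F0 x)) ler_wpM2r ?(ltW (F0 x))//.
    have M0 : 0 <= M := le_trans (normr_ge0 _) (fM x Jx).
    by rewrite normrX ler_sqr ?nnegrE// fM.
split => // e e0.
have lD n : mem_L2 lam J (fun x => g n x * w x - f x * w x) by apply: L2B => //; case: (Fg n).
have [] := @Rint_dct _ _ _ lam J mJ (fun n x => (g n x * w x - f x * w x) ^+ 2) (fun=> 0) (fun x => 4 * M ^+ 2 * F x).
- by move=> n; apply: measurable_funX; case: (lD n).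
- exact: L1Z.
- move=> n x Jx; rewrite -mulrBl exprMn w2 normrM (gtr0_norm (F0 x)) ler_wpM2r ?(ltW (F0 x))//.
  have M0 : 0 <= M := le_trans (normr_ge0 _) (fM x Jx).
  rewrite normrX (_ : 4 * M ^+ 2 = (2 * M) ^+ 2); last by ring.
  rewrite ler_sqr ?nnegrE ?mulr_ge0//; apply: (le_trans (ler_normB _ _)).
  by have := gM n x Jx; have := fM x Jx; lra.
- move=> x Jx.
  have h : g n x * w x - f x * w x @[n --> \oo] --> (0 : R).
    by rewrite -(subrr (f x * w x)); apply: cvgB; [exact: gfw|exact: cvg_cst].
  have h2 : (g n x * w x - f x * w x) * (g n x * w x - f x * w x) @[n --> \oo] --> (0 * 0 : R).
    exact: cvgM.
  by rewrite mulr0 in h2; under eq_fun do rewrite expr2.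
move=> _; rewrite (Rint0 lam mJ) => /cvgrPdist_lt/(_ ((e / 2) ^+ 2)).
case; first by rewrite exprn_gt0// divr_gt0.
move=> N _ /(_ N (leqnn N)); rewrite /= sub0r normrN -sqr_norm2// => hN.
have nN : norm2 lam J (fun x => g N x * w x - f x * w x) < e / 2.
  rewrite -ltr_sqr ?nnegrE ?norm2_ge0//; last by rewrite ltW// divr_gt0.
  exact: le_lt_trans (ler_norm _) hN.
have [lgN /(_ (e / 2))[]] := Fg N; first by rewrite divr_gt0.
move=> q hq; exists q.
apply: (le_lt_trans (norm2_dist mJ (lq q) lfw lgN)); lra.
Qed.

(** On (0, pi) the cosine decreases strictly, so a ray is where [cos x - cos (- b)] is positive.
    Rays that miss or cover the interval are treated separately. *)
Lemma rays_cosine_lim (b : R) : lim_set J A [set x : TR | b < - (x : R)].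
Proof.
have [b0|b0] := leP 0 b.
  apply: (lim_set_trace (B := [set x : TR | 0 < 0 :> R])).
    by move=> x /=; rewrite in_itv/= ltxx => /andP[x0 _]; split => // bx; lra.
  by apply: (@lim_set_pos _ _ _ J A Acst AD AM Abd (fun=> 0)); exact: Acst.
have [bp|bp] := leP (- b) pi; last first.
  apply: (lim_set_trace (B := [set x : TR | 0 < 1 :> R])).
    by move=> x /=; rewrite in_itv/= ltr01 => /andP[_ xp]; split => // _; lra.
  by apply: (@lim_set_pos _ _ _ J A Acst AD AM Abd (fun=> 1)); exact: Acst.
apply: (lim_set_trace (B := [set x : TR | 0 < cos (x:R) - cos (- b)])).
  move=> x /=; rewrite in_itv/= => /andP[x0 xp]; rewrite subr_gt0 ltr_cos ?in_itv/=; last 2 first.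
  - by rewrite (ltW xp) andbT; lra.
  - by rewrite bp andbT; lra.
  by split; lra.
apply: (@lim_set_pos _ _ _ J A Acst AD AM Abd (fun x => cos x - cos (- b))).
by exists ('X - (cos (- b))%:P); apply/funext => x; rewrite hornerXsubC.
Qed.

Lemma borel_cosine_lim : @measurable _ TR `<=` <<s lim_set J A >>.
Proof.
have -> : @measurable _ TR = <<s @RGenInftyO.G R >> by exact: (@RGenInftyO.measurableE R).
apply: smallest_sub; first exact: smallest_sigma_algebra.
move=> _ [b ->]; apply: sub_gen_smallest.
rewrite (_ : `]-oo, b[%classic = [set x : TR | - b < - (x : R)]); first exact: rays_cosine_lim.
by apply/seteqP; split => x /=; rewrite in_itv/= ltrN2.
Qed.

(** The ideal multiplier [a / sqrt F] is unbounded where [F] is small. Capped at [n] it lies in the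
    class, and the caps converge with error dominated by [a]. *)
Lemma cosine_dense (a : R) : 0 <= a -> forall e, 0 < e ->
  exists q : {poly R}, norm2 lam J (fun x => q.[cos x] * w x - a) < e.
Proof.
move=> a0 e e0; have e20 : 0 < e / 2 by lra.
pose g x := a * (F x `^ (- 2^-1)).
have gw x : g x * w x = a.
  rewrite /g /w -powR12_sqrt; last exact: ltW.
  rewrite -mulrA -powRD; first by rewrite addNr powRr0 mulr1.
  by rewrite (gt_eqF (F0 x)) implybT.
have g0 x : 0 <= g x by rewrite mulr_ge0// powR_ge0.
have mg : measurable_fun setT g.
  apply: measurable_funM; first exact: measurable_cst.
  exact: (measurableT_comp (measurable_powR _) mF).
pose gn n x := Num.min (g x) n%:R.
have Fgn n : Fc (gn n).
  apply: (@class_bounded _ TR R J A Fc Acst AM AF FD FZ Flim (gn n) n%:R borel_cosine_lim).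
    by apply: measurable_minr => //; exact: measurable_cst.
  by move=> x; rewrite le_min g0 ler0n ge_min lexx orbT.
have gnw n x : `|gn n x * w x - a| <= a.
  rewrite -(gw x) -mulrBl normrM (gtr0_norm (w0 x)) ler_wpM2r ?(ltW (w0 x))//.
  rewrite /gn; case: (leP (g x) n%:R) => h; first by rewrite subrr normr0.
  by rewrite ler_norml; have := g0 x; have := ler0n R n; lra.
have mgn n : measurable_fun setT (gn n).
  by apply: measurable_minr => //; exact: measurable_cst.
have lJ (k : R) : mem_L1 lam J (fun=> k).
  apply/integrableP; split; first exact: measurable_cst.
  rewrite integral_cst//= lebesgue_measure_itv/= lte_fin pi_gt0 -EFinB -EFinM ltry//.
have mD n : measurable_fun J (fun x => gn n x * w x - a).
  apply: measurable_funB; last exact: measurable_cst.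
  by apply: measurable_funM => //; apply: measurable_funS (mgn n).
have sq n x : `|(gn n x * w x - a) ^+ 2| <= a ^+ 2.
  by rewrite normrX ler_sqr ?nnegrE.
have lD n : mem_L2 lam J (fun x => gn n x * w x - a).
  split => //; apply: (L1_le mJ (g := fun=> a ^+ 2)) => //.
  exact: measurable_funX.
have [] := @Rint_dct _ _ _ lam J mJ (fun n x => (gn n x * w x - a) ^+ 2) (fun=> 0) (fun=> a ^+ 2).
- by move=> n; apply: measurable_funX.
- exact: lJ.
- by move=> n x _; exact: sq.
- move=> x _; apply: cvg_near_cst.
  exists (Num.truncn (g x)).+1 => // n /= gn_; apply/eqP; rewrite sqrf_eq0 subr_eq0 -(gw x).
  apply/eqP; congr (_ * _); rewrite /gn; apply/min_idPl.
  by apply: le_trans (ltW (truncnS_gt _)) _; rewrite ler_nat.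
move=> _; rewrite (Rint0 lam mJ) => /cvgrPdist_lt/(_ ((e / 2) ^+ 2)).
case; first by rewrite exprn_gt0.
move=> N _ /(_ N (leqnn N)); rewrite /= sub0r normrN -sqr_norm2// => hN.
have nN : norm2 lam J (fun x => gn N x * w x - a) < e / 2.
  rewrite -ltr_sqr ?nnegrE ?norm2_ge0//; last exact: ltW.
  exact: le_lt_trans (ler_norm _) hN.
have [lgN /(_ _ e20)[q hq]] := Fgn N; exists q.
have lc : mem_L2 lam J (fun=> a) by split; [exact: measurable_cst|exact: lJ].
apply: (le_lt_trans (norm2_dist mJ (lq q) lc lgN)); lra.
Qed.

End CosineDensity.

(** * The innovations in the closed span of the series *)

Section Span.
Context d (T : measurableType d) (R : realType) (P : probability T R).
Variable Z : int -> {RV P >-> R}.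
Hypothesis iidZ : iid_innovations P Z.
Hypothesis s2_neq0 : s2 Z != 0.
Variables (c : int -> R) (X : int -> {RV P >-> R}).
Hypothesis Xlim : forall t : int,
  (\int[P]_w (((X t w - ma_partial_sum P c Z t n w) ^+ 2)%:E))%E @[n --> \oo] --> 0%E.

Let mT : measurable [set: T] := measurableT.
Notation L1 := (mem_L1 P setT).
Notation L2 := (mem_L2 P setT).
Notation E := (Rintegral P setT).
Notation n2 := (norm2 P setT).
Notation cf := (cf Z).
Notation clos := (clos Z).
Notation lam := (@lebesgue_measure R).
Notation TR := (measurableTypeR R).
Notation J := (`]0, pi[%classic : set TR).
Implicit Types (U V W : T -> R) (x : TR).

Variable F : TR -> R.
Hypothesis mF : measurable_fun setT F.
Hypothesis F0 : forall x, 0 < F x.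
Hypothesis iF : lam.-integrable J (EFin \o F).
Hypothesis E2F : forall s t : int, E (fun w => X s w * X t w) =
  Rintegral lam J (fun x => cos ((s - t)%:~R * (x : R)) * F x).

Let lF : mem_L1 lam J F. Proof. exact: iF. Qed.
Let mJ : measurable J. Proof. exact: measurable_itv. Qed.
Let lX t : L2 (X t) := L2X iidZ Xlim t.
Let cX t : clos (X t) := clos_X iidZ Xlim s2_neq0 t.

(* [spec Y y]: the stationary family [Y] in the span of [X] has transfer
   function [y] relative to the spectral density [F]. *)
Inductive spec : (int -> T -> R) -> (TR -> R) -> Prop :=
| spec_X : spec (fun h => X h) (fun=> 1)
| spec_M Y y : spec Y y ->
    spec (fun h w => 2^-1 * (Y (h + 1) w + Y (h - 1) w)) (fun x => cos (x : R) * y x)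
| spec_D Y y Y' y' : spec Y y -> spec Y' y' ->
    spec (fun h w => Y h w + Y' h w) (fun x => y x + y' x)
| spec_Z a Y y : spec Y y -> spec (fun h w => a * Y h w) (fun x => a * y x).

Lemma spec_L2 Y y : spec Y y -> forall h, L2 (Y h).
Proof.
elim=> [|{}Y {}y _ ih|{}Y {}y Y' y' _ ih _ ih'|a {}Y {}y _ ih] h //.
- by apply: L2Z => //; exact: L2D.
- exact: L2D.
- exact: L2Z.
Qed.

Lemma spec_clos Y y : spec Y y -> forall h, clos (Y h).
Proof.
elim=> [|{}Y {}y _ ih|{}Y {}y Y' y' _ ih _ ih'|a {}Y {}y _ ih] h //.
- exact: (closZ iidZ s2_neq0 2^-1 (closD iidZ s2_neq0 (ih (h + 1)) (ih (h - 1)))).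
- exact: (closD iidZ s2_neq0 (ih h) (ih' h)).
- exact: (closZ iidZ s2_neq0 a (ih h)).
Qed.

Lemma lc_cat l l' w : lc X (l ++ l') w = lc X l w + lc X l' w.
Proof. by rewrite /lc big_cat. Qed.

Lemma lc_scale a l w : lc X [seq (a * p.1, p.2) | p <- l] w = a * lc X l w.
Proof. by rewrite /lc big_map big_distrr/=; apply: eq_bigr => p _; rewrite mulrA. Qed.

Lemma spec_lc Y y : spec Y y -> forall h, exists l, forall w, Y h w = lc X l w.
Proof.
elim=> [|{}Y {}y _ ih|{}Y {}y Y' y' _ ih _ ih'|a {}Y {}y _ ih] h.
- by exists [:: (1, h)] => w; rewrite /lc big_seq1 mul1r.
- have [l e] := ih (h + 1); have [l' e'] := ih (h - 1).
  exists [seq (2^-1 * p.1, p.2) | p <- l ++ l'] => w.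
  by rewrite lc_scale lc_cat e e'.
- have [l e] := ih h; have [l' e'] := ih' h; exists (l ++ l') => w.
  by rewrite lc_cat e e'.
- by have [l e] := ih h; exists [seq (a * p.1, p.2) | p <- l] => w; rewrite lc_scale e.
Qed.

Lemma spec_bounded Y y : spec Y y ->
  measurable_fun J y /\ exists M : R, forall x, `|y x| <= M.
Proof.
elim=> [|{}Y {}y _ [m [M hM]]|{}Y {}y Y' y' _ [m [M hM]] _ [m' [M' hM']]|a {}Y {}y _ [m [M hM]]].
- by split; [exact: measurable_cst|exists 1 => x; rewrite normr1].
- split; first by apply: measurable_funM => //; exact: measurable_cosTR.
  exists M => x; rewrite normrM; apply: le_trans (hM x).
  by rewrite ler_piMl// ler_norml cos_geN1 cos_le1.
- split; first exact: measurable_funD.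
  by exists (M + M') => x; rewrite (le_trans (ler_normD _ _))// lerD.
- split; first by apply: measurable_funM => //; exact: measurable_cst.
  by exists (`|a| * M) => x; rewrite normrM ler_wpM2l.
Qed.

Let mcosh (k : R) (D : set TR) : measurable_fun D (fun x => cos (k * (x : R)) : R).
Proof.
apply: measurable_funS measurableT _ _ => //.
apply: (@measurableT_comp _ _ _ TR R R (@cos R) _ (fun x => k * (x : R))).
  exact: continuous_measurable_fun (@continuous_cos R).
have h : continuous (fun x : R => k * x).
  by move=> x; apply: continuousM; [exact: cst_continuous|exact: id].
exact: (continuous_measurable_fun h).
Qed.

Let L1_spec Y y Y' y' (k : R) : spec Y y -> spec Y' y' ->
  mem_L1 lam J (fun x => y x * y' x * cos (k * (x : R)) * F x).
Proof.
move=> /spec_bounded[m [M hM]] /spec_bounded[m' [M' hM']].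
apply: (@L1_bounded _ _ _ lam J mJ (fun x => y x * y' x * cos (k * (x : R))) F (M * M')) => //.
  by apply: measurable_funM; [exact: measurable_funM|exact: mcosh].
move=> x _; rewrite !normrM -[leRHS]mulr1.
have c1 : `|cos (k * (x : R))| <= 1 by rewrite ler_norml cos_geN1 cos_le1.
have yy : `|y x| * `|y' x| <= M * M' by exact: ler_pM.
by apply: ler_pM => //; rewrite mulr_ge0.
Qed.

Notation K y k := (Rintegral lam J (fun x => y x * cos (k%:~R * (x : R)) * F x)).

(** Averaging the two neighbouring shifts multiplies the kernel by [cos x]; this is why [spec_M]
    uses a symmetric average and transfer functions stay real. *)
Lemma cos_shift (h k : int) (x : R) :
  2^-1 * (cos ((h + 1 - k)%:~R * x) + cos ((h - 1 - k)%:~R * x)) = cos x * cos ((h - k)%:~R * x).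
Proof.
have -> : h + 1 - k = (h - k) + 1 by lia.
have -> : h - 1 - k = (h - k) - 1 by lia.
rewrite [((h - k) + 1)%:~R]intrD [((h - k) - 1)%:~R]intrB mulrDl mulrBl mul1r.
by rewrite -cosM mulrC.
Qed.

Lemma spec_corr Y y Y' y' : spec Y y -> spec Y' y' -> forall h k : int,
  E (fun w => Y h w * Y' k w) = Rintegral lam J (fun x => y x * y' x * cos ((h - k)%:~R * (x : R)) * F x).
Proof.
move=> sY.
have L2Y := spec_L2 sY.
(* The induction runs on one factor at a time, first against [X] itself. *)
have main Y0 y0 : spec Y0 y0 -> (forall h k, E (fun w => Y0 h w * X k w) =
    Rintegral lam J (fun x => y0 x * 1 * cos ((h - k)%:~R * (x : R)) * F x)).
  elim=> [|{}Y0 {}y0 s ih|{}Y0 {}y0 Y1 y1 s ih s' ih'|a {}Y0 {}y0 s ih] h k.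
  - by rewrite E2F; apply: Rint_eq => x _; rewrite !mul1r.
  - have l := spec_L2 s.
    rewrite (Rint_eq (g := fun w => 2^-1 * (Y0 (h + 1) w * X k w + Y0 (h - 1) w * X k w))); last first.
      by move=> w _; ring.
    rewrite RintZ//; last by apply: L1D => //; exact: L2M.
    rewrite RintD//; [|exact: L2M..].
    rewrite !ih -RintD//; [|exact: (L1_spec _ s spec_X)..].
    rewrite -RintZ//; last by apply: L1D => //; exact: (L1_spec _ s spec_X).
    apply: Rint_eq => x _; rewrite -[in RHS]mulrA [in RHS]mulr1.
    transitivity (y0 x * (2^-1 * (cos ((h + 1 - k)%:~R * (x : R)) + cos ((h - 1 - k)%:~R * (x : R)))) * F x).
      by ring.
    by rewrite cos_shift; ring.
  - have l := spec_L2 s; have l' := spec_L2 s'.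
    rewrite (Rint_eq (g := fun w => Y0 h w * X k w + Y1 h w * X k w)); last by move=> w _; ring.
    rewrite RintD//; [|exact: L2M..].
    rewrite ih ih' -RintD//; [|exact: (L1_spec _ s spec_X)|exact: (L1_spec _ s' spec_X)].
    by apply: Rint_eq => x _; ring.
  - have l := spec_L2 s.
    rewrite (Rint_eq (g := fun w => a * (Y0 h w * X k w))); last by move=> w _; ring.
    rewrite RintZ//; last exact: L2M.
    rewrite ih -RintZ//; last exact: (L1_spec _ s spec_X).
    by apply: Rint_eq => x _; ring.
elim=> [|{}Y' {}y' s ih|{}Y' {}y' Y1 y1 s ih s' ih'|a {}Y' {}y' s ih] h k.
- exact: main.
- have l := spec_L2 s.
  rewrite (Rint_eq (g := fun w => 2^-1 * (Y h w * Y' (k + 1) w + Y h w * Y' (k - 1) w))); last first.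
    by move=> w _; ring.
  rewrite RintZ//; last by apply: L1D => //; exact: L2M.
  rewrite RintD//; [|exact: L2M..].
  rewrite !ih -RintD//; [|exact: (L1_spec _ sY s)..].
  rewrite -RintZ//; last by apply: L1D => //; exact: (L1_spec _ sY s).
  apply: Rint_eq => x _.
  transitivity (y x * y' x * (2^-1 * (cos ((h + 1 - k)%:~R * (x : R)) + cos ((h - 1 - k)%:~R * (x : R)))) * F x).
    rewrite (_ : h + 1 - k = h - (k - 1)); last by lia.
    rewrite (_ : h - 1 - k = h - (k + 1)); last by lia.
    by ring.
  by rewrite cos_shift; ring.
- have l := spec_L2 s; have l' := spec_L2 s'.
  rewrite (Rint_eq (g := fun w => Y h w * Y' k w + Y h w * Y1 k w)); last by move=> w _; ring.
  rewrite RintD//; [|exact: L2M..].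
  rewrite ih ih' -RintD//; [|exact: (L1_spec _ sY s)|exact: (L1_spec _ sY s')].
  by apply: Rint_eq => x _; ring.
- have l := spec_L2 s.
  rewrite (Rint_eq (g := fun w => a * (Y h w * Y' k w))); last by move=> w _; ring.
  rewrite RintZ//; last exact: L2M.
  rewrite ih -RintZ//; last exact: (L1_spec _ sY s).
  by apply: Rint_eq => x _; ring.
Qed.

Lemma spec_cf Y y : spec Y y -> forall h k s : int, cf (Y (h + s)) (k + s) = cf (Y h) k.
Proof.
elim=> [|{}Y {}y sp ih|{}Y {}y Y' y' sp ih sp' ih'|a {}Y {}y sp ih] h k s.
- by rewrite !(cf_X iidZ Xlim s2_neq0); congr c; lia.
- have l := spec_L2 sp.
  rewrite !cfZ//; [|exact: L2D..]; rewrite !cfD//.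
  have -> : h + s + 1 = h + 1 + s by lia.
  have -> : h + s - 1 = h - 1 + s by lia.
  by rewrite !ih.
- by have l := spec_L2 sp; have l' := spec_L2 sp'; rewrite !cfD// ih ih'.
- by have l := spec_L2 sp; rewrite !cfZ// ih.
Qed.

Lemma spec_poly (q : {poly R}) : exists Y, spec Y (fun x => q.[cos (x : R)]).
Proof.
elim/poly_ind: q => [|q a [Y sY]].
  exists (fun h w => 0 * X h w).
  rewrite (_ : (fun x => _) = fun x => 0 * 1); first exact: spec_Z spec_X.
  by apply/funext => x; rewrite horner0 mul0r.
exists (fun h w => 2^-1 * (Y (h + 1) w + Y (h - 1) w) + a * X h w).
rewrite (_ : (fun x => _) = fun x => cos (x : R) * q.[cos (x : R)] + a * 1).
  by apply: spec_D; [exact: spec_M|exact: spec_Z spec_X].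
by apply/funext => x; rewrite hornerMXaddC mulr1 mulrC.
Qed.

Let s0 : 0 < s2 Z := s2_gt0 s2_neq0.
Let sg := Num.sqrt (s2 Z).
Let sg0 : 0 < sg. Proof. by rewrite sqrtr_gt0. Qed.
Let sg2 : sg ^+ 2 = s2 Z. Proof. by rewrite sqr_sqrtr// ltW. Qed.
Let w x : R := Num.sqrt (F x).
Let w2 x : w x ^+ 2 = F x. Proof. by rewrite sqr_sqrtr// ltW. Qed.
(** The constant density [a^2] on (0, pi) is that of white noise with variance [s2 Z]. *)
Let a : R := Num.sqrt (s2 Z / pi).
Let a2 : a ^+ 2 = s2 Z / pi. Proof. by rewrite sqr_sqrtr// divr_ge0 ?pi_ge0// ltW. Qed.
Let mw D : measurable_fun D w.
Proof.
apply: measurable_funS (measurableT) _ _ => //.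
by apply: measurableT_comp mF; apply: continuous_measurable_fun; exact: sqrt_continuous.
Qed.
Notation n2J := (norm2 lam J).
Notation L2J := (mem_L2 lam J).

Let L1Jcst (k : R) : mem_L1 lam J (fun=> k).
Proof.
apply/integrableP; split; first exact: measurable_cst.
by rewrite integral_cst//= lebesgue_measure_itv/= lte_fin pi_gt0 -EFinB -EFinM ltry.
Qed.

Let L2a : L2J (fun=> a). Proof. by split; [exact: measurable_cst|exact: L1Jcst]. Qed.

Let L2w : L2J w.
Proof. by split => //; apply: (L1_eq mJ _ lF) => x _; rewrite w2. Qed.

Let L2spec Y y : spec Y y -> L2J (fun x => y x * w x).
Proof. by move=> /spec_bounded[m [M hM]]; exact: (L2_bounded mJ m (fun x _ => hM x) L2w). Qed.

Let n2a : n2J (fun=> a) = sg.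
Proof.
rewrite /norm2 (Rint_eq (g := fun x => (s2 Z / pi) * cos ((0 : int)%:~R * (x : R)))); last first.
  by move=> x _; rewrite a2 mul0r cos0 mulr1.
rewrite RintZ//; last first.
  by apply: (L1_eq mJ _ (L1Jcst 1)) => x _; rewrite mul0r cos0.
by rewrite Rint_cos eqxx mulr1n divfK// gt_eqF ?pi_gt0.
Qed.

Lemma spec_n2 Y y : spec Y y -> forall h, n2 (Y h) = n2J (fun x => y x * w x).
Proof.
move=> sY h; congr Num.sqrt.
rewrite (Rint_eq (g := fun w => Y h w * Y h w)); last by move=> z _; rewrite expr2.
rewrite (spec_corr sY sY); apply: Rint_eq => x _.
by rewrite subrr mul0r cos0 mulr1 exprMn w2 expr2.
Qed.

(** Since [y^2 F - a^2 = (y w - a) * (y w + a)], Cauchy-Schwarz applies; the second factor has norm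
    at most [dl + 2 sg <= 3 sg]. *)
Lemma spec_corr_near Y y dl : spec Y y -> 0 <= dl -> dl <= sg ->
  n2J (fun x => y x * w x - a) <= dl ->
  forall h k, `|E (fun v => Y h v * Y k v) - s2 Z * (h == k)%:R| <= 3 * sg * dl.
Proof.
move=> sY d0 ds hd h k.
have lY := L2spec sY.
have mc D : measurable_fun D (fun x => cos ((h - k)%:~R * (x : R)) : R) by exact: mcosh.
have cb x : `|cos ((h - k)%:~R * (x : R))| <= 1 by rewrite ler_norml cos_geN1 cos_le1.
have lm : L2J (fun x => y x * w x - a) by exact: L2B.
have lp : L2J (fun x => y x * w x + a) by exact: L2D.
have lcm : L2J (fun x => cos ((h - k)%:~R * (x : R)) * (y x * w x - a)).
  exact: (L2_bounded mJ (mc J) (fun x _ => cb x) lm).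
have e1 : s2 Z * (h == k)%:R = Rintegral lam J (fun x => a ^+ 2 * cos ((h - k)%:~R * (x : R))).
  rewrite RintZ//; last first.
    by apply: (L1_le mJ (mc J) (L1Jcst 1)) => x _; exact: cb.
  rewrite Rint_cos a2 subr_eq0; case: (h == k); last by rewrite !mulr0.
  by rewrite mulr1n divfK ?mulr1// gt_eqF ?pi_gt0.
rewrite (spec_corr sY sY) e1 -RintB//; last 2 first.
- exact: (L1_spec _ sY sY).
- by apply: L1Z => //; apply: (L1_le mJ (mc J) (L1Jcst 1)) => x _; exact: cb.
rewrite (Rint_eq (g := fun x => (cos ((h - k)%:~R * (x : R)) * (y x * w x - a)) * (y x * w x + a))); last first.
  by move=> x _; rewrite -w2; ring.
apply: (le_trans (cauchy_schwarz mJ lcm lp)).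
have n1 : n2J (fun x => cos ((h - k)%:~R * (x : R)) * (y x * w x - a)) <= dl.
  apply: le_trans hd; rewrite /norm2 ler_wsqrtr//; apply: Rint_le => //; [exact: L2_sqr|exact: L2_sqr|].
  move=> x _; rewrite exprMn; apply: ler_piMl; first exact: sqr_ge0.
  by rewrite -[leLHS]real_normK ?num_real// exprn_ile1.
have n2' : n2J (fun x => y x * w x + a) <= 3 * sg.
  rewrite (norm2_eq (g := fun x => (y x * w x - a) + 2 * a)); last by move=> x _; ring.
  apply: (le_trans (norm2_triangle mJ lm (L2Z mJ 2 L2a))).
  by rewrite norm2Z// n2a ger0_norm//; lra.
by rewrite mulrC ler_pM ?norm2_ge0.
Qed.

Let dense_arith (ww sv s v eta cc dd ee : R) : ww <= sv + cc -> s - v <= eta ->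
  v - sv <= 9 * dd -> eta + cc <= ee / 2 -> dd <= ee / 5 ^+ 2 -> 0 < ee ->
  ww - 2 * sv + s < ee.
Proof. by move=> *; lra. Qed.

(** For an almost white [Y] with coefficients [v_k] at time 0, the combination [W] of the
    [v_k Y_(-k)] satisfies [E (W * Z 0) = s2 * sum v_k^2], and its second moment is almost the same.
    Since [Y 0] lies in the closed span and has variance near [s2], the sum of squares is near 1, so
    [W] is near [Z 0]. The error in the second moment grows with the squared number of terms, so the
    index list [s] must precede the choice of [Y]: a coarse [Y0] fixes [s], then [Y] is taken white
    enough for that many terms. *)
Lemma span_dense e : 0 < e -> exists l, n2 (fun v => lc X l v - Z 0 v) < e.
Proof.
move=> e0.
pose d0 := Num.min (sg / 2) (e / 5).
have d00 : 0 < d0 by rewrite lt_min !divr_gt0.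
have d0s : d0 <= sg / 2 by rewrite ge_min lexx.
have d0e : d0 <= e / 5 by rewrite ge_min lexx orbT.
have [q0 hq0] := cosine_dense mF F0 iF (sqrtr_ge0 (s2 Z / pi)) d00.
have [Y0 sY0] := spec_poly q0.
have [lV0 /(_ _ d00)[s us hs]] := spec_clos sY0 0.
have {}hs := hs s us (fun _ => id).
set S := comb Z s (cf (Y0 0)) in hs.
have lS : L2 S by exact: L2comb.
pose N : R := (size s)%:R.
have N0 : 0 <= N by [].
(* One [eta] for the variance of [Y 0], and [N^2] error terms in the double sum, each with two
   coefficients of size at most 2. *)
pose C := 1 + 4 * N ^+ 2.
have C0 : 0 < C by rewrite /C ltr_wpDr// mulr_ge0// sqr_ge0.
pose dl := Num.min d0 (e ^+ 2 / 2 / (3 * sg * C)).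
have e2 : 0 < e ^+ 2 by rewrite exprn_gt0.
have sC : 0 < 3 * sg * C by rewrite !mulr_gt0.
have dl0 : 0 < dl by rewrite lt_min d00 divr_gt0// divr_gt0.
have dl1 : dl <= d0 by rewrite ge_min lexx.
have dls : dl <= sg by lra.
have dl2 : 3 * sg * dl * C <= e ^+ 2 / 2.
  rewrite mulrAC mulrC -ler_pdivlMr//; by rewrite ge_min lexx orbT.
have [q hq] := cosine_dense mF F0 iF (sqrtr_ge0 (s2 Z / pi)) dl0.
have [Y sY] := spec_poly q.
have lY := spec_L2 sY; have lY0 := spec_L2 sY0.
set y := (fun x => q.[cos (x : R)]) in sY; set y0 := (fun x => q0.[cos (x : R)]) in sY0.
have near := @spec_corr_near Y y dl sY (ltW dl0) (_ : dl <= sg) (ltW hq).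
have {}near : forall h k, `|E (fun v => Y h v * Y k v) - s2 Z * (h == k)%:R| <= 3 * sg * dl.
  exact: near.
set eta := 3 * sg * dl in near dl2.
have eta0 : 0 <= eta by rewrite /eta !mulr_ge0// ltW.
pose V := Y 0.
have VV0 : n2 (fun v => V v - Y0 0 v) <= 2 * d0.
  have sD := spec_D sY (spec_Z (- 1) sY0).
  have := spec_n2 sD 0.
  rewrite (norm2_eq (g := fun v => V v - Y0 0 v)); last by move=> v _; rewrite mulN1r.
  move=> ->; rewrite (norm2_eq (g := fun x => y x * w x - y0 x * w x)); last by move=> x _; ring.
  apply: (le_trans (norm2_dist mJ (L2spec sY) (L2spec sY0) L2a)).
  rewrite [X in _ + X]norm2_distC.
  have h1 : n2J (fun x => y x * w x - a) <= d0 by apply: le_trans dl1; exact: ltW.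
  have h2 : n2J (fun x => y0 x * w x - a) <= d0 by exact: ltW.
  lra.
(* The list chosen for [Y0] also serves [Y], because the projection is optimal and [Y 0] is within
   [2 * d0] of [Y0 0]. *)
have projV : n2 (fun v => V v - comb Z s (cf V) v) <= 3 * d0.
  apply: (le_trans (norm2_proj_le iidZ s2_neq0 (cf (Y0 0)) (lY 0) us us (fun _ => id))).
  apply: (le_trans (norm2_dist mT (lY 0) lS (lY0 0))).
  by have := ltW hs; rewrite -/V; lra.
have nV : n2 V ^+ 2 = E (fun v => Y 0 v * Y 0 v).
  by rewrite sqr_norm2//; apply: Rint_eq => v _; rewrite expr2.
have nV1 := near 0 0; rewrite eqxx mulr1 -nV ler_norml in nV1.
have /andP[nV2 nV3] := nV1.
pose Sv := \sum_(k <- s) cf V k ^+ 2.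
have SvE : n2 V ^+ 2 - s2 Z * Sv <= 9 * d0 ^+ 2.
  have := norm2_sub_comb iidZ s2_neq0 (cf V) (lY 0) us.
  rewrite [X in _ - _ + s2 Z * X]big1 ?mulr0 ?addr0; last first.
    by move=> i _; rewrite subrr expr0n.
  rewrite -/V -/Sv => <-; rewrite (_ : 9 * d0 ^+ 2 = (3 * d0) ^+ 2); last by ring.
  by rewrite ler_sqr ?nnegrE ?norm2_ge0// mulr_ge0// ltW.
have cfV k : `|cf V k| <= 2.
  have n2V : n2 V <= 2 * sg.
    have := spec_n2 sY 0; rewrite -/V => ->.
    rewrite (norm2_eq (g := fun x => (y x * w x - a) + a)); last by move=> x _; ring.
    apply: (le_trans (norm2_triangle mJ (L2B mJ (L2spec sY) L2a) L2a)).
    by rewrite n2a (_ : 2 * sg = sg + sg) ?lerD2r; [exact: le_trans (ltW hq) dls|ring].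
  have := cf_le iidZ s2_neq0 k (lY 0); rewrite -/V => h.
  have h2 : s2 Z * cf V k ^+ 2 <= s2 Z * 2 ^+ 2.
    apply: (le_trans h); rewrite -sg2 -exprMn [sg * 2]mulrC.
    by rewrite ler_sqr ?nnegrE ?norm2_ge0// mulr_ge0// ltW.
  move: h2; rewrite ler_pM2l// -[leLHS]real_normK ?num_real//.
  by rewrite ler_sqr ?nnegrE.
(* By shift covariance, [Z 0] has in [Y (- k)] the coefficient that [Z k] has in [Y 0]. *)
pose W v := \sum_(k <- s) cf V k * Y (- k) v.
have lW : L2 W by apply: L2_sum => // k; exact: L2Z.
have EZW : E (fun v => W v * Z 0 v) = s2 Z * Sv.
  rewrite (Rint_eq (g := fun v => \sum_(k <- s) cf V k * (Y (- k) v * Z 0 v))); last first.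
    by move=> v _; rewrite big_distrl/=; apply: eq_bigr => k _; ring.
  have lYZ k : L1 (fun v => Y (- k) v * Z 0 v) by apply: L2M => //; exact: L2_innov.
  rewrite Rint_sum//; last by move=> k; exact: L1Z.
  rewrite big_distrr/=; apply: eq_bigr => k _; rewrite RintZ// cfE//.
  have := spec_cf sY (- k) 0 k; rewrite addNr add0r -/V => <-.
  by move: (cf V k) => u; ring.
have EWW : E (fun v => W v ^+ 2) <= s2 Z * Sv + 4 * N ^+ 2 * eta.
  have lYY k j : L1 (fun v => Y (- k) v * Y (- j) v) by exact: L2M.
  have l1 k : L1 (fun v => \sum_(j <- s) cf V j * (Y (- k) v * Y (- j) v)).
    by apply: L1_sum => // j; exact: L1Z.
  rewrite (Rint_eq (g := fun v => \sum_(k <- s) cf V k * (\sum_(j <- s) cf V j * (Y (- k) v * Y (- j) v)))); last first.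
    move=> v _; rewrite expr2 /W big_distrl/=; apply: eq_bigr => k _.
    rewrite -mulrA; congr (_ * _); rewrite big_distrr/=; apply: eq_bigr => j _; ring.
  rewrite Rint_sum//; last by move=> k; exact: L1Z.
  have bound k : k \in s -> cf V k * (\sum_(j <- s) cf V j * E (fun v => Y (- k) v * Y (- j) v))
      <= s2 Z * cf V k ^+ 2 + 4 * N * eta.
    move=> ks.
    have -> : \sum_(j <- s) cf V j * E (fun v => Y (- k) v * Y (- j) v) =
        s2 Z * cf V k + \sum_(j <- s) cf V j * (E (fun v => Y (- k) v * Y (- j) v) - s2 Z * (- k == - j)%:R).
      under [X in _ = _ + X]eq_bigr do rewrite mulrBr.
      rewrite sumrB [X in _ = _ + (_ - X)](bigD1_seq k)//= eqxx mulr1.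
      rewrite [X in _ - (_ + X)]big1 ?addr0; last first.
        by move=> j jk; rewrite eqr_opp eq_sym (negbTE jk) !mulr0.
      by rewrite [cf V k * s2 Z]mulrC addrC subrK.
    rewrite mulrDr; apply: lerD; first by move: (cf V k) => u; rewrite mulrCA expr2.
    apply: (le_trans (ler_norm _)); rewrite normrM.
    apply: (@le_trans _ _ (2 * (N * (2 * eta)))); last by rewrite le_eqVlt; apply/orP; left; apply/eqP; ring.
    apply: ler_pM => //; apply: (le_trans (ler_norm_sum _ _ _)).
    rewrite /N mulr_natl -sum1_size -sumrMnr.
    apply: ler_sum => j _; rewrite mulr1n normrM; apply: ler_pM => //.
  apply: (@le_trans _ _ (\sum_(k <- s) (s2 Z * cf V k ^+ 2 + 4 * N * eta))).
    rewrite big_seq [leRHS]big_seq; apply: ler_sum => k ks; rewrite RintZ//.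
    apply: le_trans (bound k ks); rewrite Rint_sum//; last by move=> j; exact: L1Z.
    by under eq_bigr => j _ do rewrite RintZ//.
  rewrite big_split/= -big_distrr/= -/Sv lerD2l big_const_seq count_predT iter_addr addr0.
  by rewrite -mulr_natl -/N expr2 le_eqVlt; apply/orP; left; apply/eqP; ring.
have [l hl] : exists l, forall v, W v = lc X l v.
  rewrite /W; elim: (s) => [|k r [l ih]].
    by exists [::] => v; rewrite /lc !big_nil.
  have [l' e'] := spec_lc sY (- k).
  exists ([seq (cf V k * p.1, p.2) | p <- l'] ++ l) => v.
  by rewrite lc_cat lc_scale big_cons ih e'.
exists l; rewrite (norm2_eq (g := fun v => W v - Z 0 v)); last by move=> v _; rewrite hl.
rewrite -ltr_sqr ?nnegrE ?norm2_ge0// ?(ltW e0)// sqr_norm2//.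
have lZ0 : L2 (Z 0) by exact: L2_innov.
have -> : E (fun v => (W v - Z 0 v) ^+ 2) = E (fun v => W v ^+ 2) - 2 * (s2 Z * Sv) + s2 Z.
  rewrite -(E_innov_sqr iidZ 0) -EZW -RintZ//; last exact: L2M.
  rewrite -RintB//; [|exact: L2_sqr|by apply: L1Z => //; exact: L2M].
  rewrite -RintD//; [|apply: L1B => //; [exact: L2_sqr|by apply: L1Z => //; exact: L2M]|exact: L2_sqr].
  by apply: Rint_eq => v _; ring.
have dd : d0 ^+ 2 <= (e / 5) ^+ 2 by rewrite ler_sqr ?nnegrE ?(ltW d00)// divr_ge0 ?(ltW e0).
rewrite expr_div_n in dd.
have CE : eta * C = eta + 4 * N ^+ 2 * eta by rewrite /C; ring.
rewrite CE in dl2.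
apply: (dense_arith EWW _ SvE dl2 dd e2).
by rewrite -opprB lerNl; exact: nV2.
Qed.

End Span.

(** * Uniqueness of Fourier coefficients on the square *)

Section FourierUniqueness.
Variable R : realType.
Notation TR := (measurableTypeR R).
Notation mu := (@lebesgue_measure R \x @lebesgue_measure R)%E.
Notation D := (Sq2pi R : set (TR * TR)).
Implicit Types p : (TR * TR)%type.

Let th (t : int * int) p : R := t.1%:~R * (p.1 : R) + t.2%:~R * (p.2 : R).

(** Real trigonometric polynomials on the torus; the product formulas make them an algebra. *)
Inductive trig : (TR * TR -> R) -> Prop :=
| trig_cos t : trig (fun p => cos (th t p))
| trig_sin t : trig (fun p => sin (th t p))
| trig_D f g : trig f -> trig g -> trig (fun p => f p + g p)
| trig_Z a f : trig f -> trig (fun p => a * f p).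

Lemma trig_ext f g : (forall p, f p = g p) -> trig f -> trig g.
Proof. by move=> /funext ->. Qed.

Lemma thD t t' p : th (t.1 + t'.1, t.2 + t'.2) p = th t p + th t' p.
Proof. by rewrite /th /= !intrD; ring. Qed.

Lemma thB t t' p : th (t.1 - t'.1, t.2 - t'.2) p = th t p - th t' p.
Proof. by rewrite /th /= !intrB; ring. Qed.

Lemma trig_M f g : trig f -> trig g -> trig (fun p => f p * g p).
Proof.
have base t t' : [/\ trig (fun p => cos (th t p) * cos (th t' p)),
   trig (fun p => sin (th t p) * sin (th t' p)) & trig (fun p => sin (th t p) * cos (th t' p))].
  split.
  - apply: (@trig_ext (fun p => 2^-1 * (cos (th (t.1 - t'.1, t.2 - t'.2) p) + cos (th (t.1 + t'.1, t.2 + t'.2) p)))).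
      by move=> p; rewrite thB thD cosB cosD; field.
    by apply: trig_Z; apply: trig_D; exact: trig_cos.
  - apply: (@trig_ext (fun p => 2^-1 * (cos (th (t.1 - t'.1, t.2 - t'.2) p) + (- 1) * cos (th (t.1 + t'.1, t.2 + t'.2) p)))).
      by move=> p; rewrite thB thD cosB cosD; field.
    by apply: trig_Z; apply: trig_D; [|apply: trig_Z]; exact: trig_cos.
  - apply: (@trig_ext (fun p => 2^-1 * (sin (th (t.1 - t'.1, t.2 - t'.2) p) + sin (th (t.1 + t'.1, t.2 + t'.2) p)))).
      by move=> p; rewrite thB thD sinB sinD; field.
    by apply: trig_Z; apply: trig_D; exact: trig_sin.
move=> tf; elim=> [t'|t'|{}g g' _ ih _ ih'|a {}g _ ih].
- elim: tf => [t|t|{}f f' _ ih _ ih'|a {}f _ ih]; [by have [] := base t t'|by have [] := base t t'| |].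
    by apply: trig_ext (trig_D ih ih') => p; ring.
  by apply: trig_ext (trig_Z a ih) => p; ring.
- elim: tf => [t|t|{}f f' _ ih _ ih'|a {}f _ ih]; [|by have [] := base t t'| |].
  + by have [_ _ h] := base t' t; apply: trig_ext h => p; ring.
  + by apply: trig_ext (trig_D ih ih') => p; ring.
  + by apply: trig_ext (trig_Z a ih) => p; ring.
- by apply: trig_ext (trig_D ih ih') => p; ring.
- by apply: trig_ext (trig_Z a ih) => p; ring.
Qed.

Lemma trig_cst a : trig (fun=> a).
Proof.
apply: trig_ext (trig_Z a (trig_cos (0, 0))) => p.
by rewrite /th /= !mul0r addr0 cos0 mulr1.
Qed.

Lemma trig_bounded f : trig f -> exists M : R, forall p, D p -> `|f p| <= M.
Proof.
elim=> [t|t|{}f f' _ [M h] _ [M' h']|a {}f _ [M h]].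
- by exists 1 => p _; rewrite ler_norml cos_geN1 cos_le1.
- by exists 1 => p _; rewrite ler_norml sin_geN1 sin_le1.
- by exists (M + M') => p Dp; rewrite (le_trans (ler_normD _ _))// lerD ?h ?h'.
- by exists (`|a| * M) => p Dp; rewrite normrM ler_wpM2l ?h.
Qed.

(** The difference is [2 * sin (x / 2) * sin ((x - a) / 2)], whose first factor is nonnegative on
    [0, 2 pi). As a function of [x] it is a trigonometric polynomial of degree 1, so it detects the
    arc from [a] to [2 pi]. *)
Lemma arc_pos (a x : R) : 0 <= a -> a < 2 * pi -> 0 <= x -> x < 2 * pi ->
  (0 < cos (a / 2) - cos (x - a / 2)) = (a < x).
Proof.
move=> a0 a2 x0 x2.
have -> : cos (a / 2) - cos (x - a / 2) = 2 * (sin (x / 2) * sin ((x - a) / 2)).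
  have e1 : a / 2 = x / 2 - (x - a) / 2 by field.
  have e2 : x - a / 2 = x / 2 + (x - a) / 2 by field.
  by rewrite e2 [in cos (a / 2)]e1 cosB cosD; ring.
rewrite pmulr_rgt0//; apply/idP/idP => [|ax].
  apply: contraTT; rewrite -!leNgt => xa.
  have s1 : 0 <= sin (x / 2) by apply: sin_ge0_pi; apply/andP; split; lra.
  have s2 : 0 <= sin (- ((x - a) / 2)) by apply: sin_ge0_pi; apply/andP; split; lra.
  by rewrite sinN in s2; nra.
by rewrite mulr_gt0// sin_gt0_pi//; apply/andP; split; lra.
Qed.

Lemma rays_trig (i : bool) (a : R) :
  lim_set D trig [set p | a < (if i then p.1 else p.2 : R)].
Proof.
pose A : set (TR * TR -> R) := trig.
have Acst b : A (fun=> b) by exact: trig_cst.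
have AD f g : A f -> A g -> A (fun p => f p + g p) by exact: trig_D.
have AM f g : A f -> A g -> A (fun p => f p * g p) by exact: trig_M.
have Abd f : A f -> exists M : R, forall p, D p -> `|f p| <= M by exact: trig_bounded.
pose x p : R := if i then p.1 else p.2.
have Dx p : D p -> 0 <= x p < 2 * pi.
  by move=> -[/=]; rewrite /I2pi /= !in_itv/= /x; case: (i).
have [a0|a0] := ltP a 0.
  apply: (lim_set_trace (B := [set p | 0 < 1 :> R])).
    by move=> p /Dx/andP[x0 _] /=; rewrite ltr01; split => // _; exact: lt_le_trans x0.
  by apply: (@lim_set_pos _ _ _ D A Acst AD AM Abd (fun=> 1)).
have [a2|a2] := ltP a (2 * pi); last first.
  apply: (lim_set_trace (B := [set p | 0 < 0 :> R])).
    move=> p /Dx/andP[_ x2] /=; rewrite ltxx; split => // ax.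
    by have := lt_trans x2 (le_lt_trans a2 ax); rewrite ltxx.
  by apply: (@lim_set_pos _ _ _ D A Acst AD AM Abd (fun=> 0)).
apply: (lim_set_trace (B := [set p | 0 < cos (a / 2) - cos (x p - a / 2)])).
  by move=> p /Dx/andP[x0 x2] /=; rewrite arc_pos.
apply: (@lim_set_pos _ _ _ D A Acst AD AM Abd (fun p => cos (a / 2) - cos (x p - a / 2))).
pose t : int * int := if i then (1, 0) else (0, 1).
have tx p : th t p = x p.
  by rewrite /th /t /x; case: (i); rewrite /= !mul0r ?addr0 ?add0r mul1r.
apply: (@trig_ext (fun p => cos (a / 2) + ((- cos (a / 2)) * cos (th t p) + (- sin (a / 2)) * sin (th t p)))).
  by move=> p; rewrite tx cosB; ring.
apply: trig_D; first exact: trig_cst.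
by apply: trig_D; apply: trig_Z; [exact: trig_cos|exact: trig_sin].
Qed.

(** Both coordinates are measurable for the generated sigma-algebra, as their rays are; hence so is
    the identity map into the product. *)
Lemma borel_trig : @measurable _ (TR * TR)%type `<=` <<s lim_set D trig >>.
Proof.
pose Gt := g_sigma_algebraType (lim_set D trig).
have m1 (i : bool) : measurable_fun setT ((fun p => if i then p.1 else p.2) : Gt -> TR).
  apply: (@measurability _ _ Gt TR setT _ (@RGenOInfty.G R)).
    by exact: (@RGenOInfty.measurableE R).
  move=> _ [_ [a ->] <-]; rewrite setTI; apply: sub_sigma_algebra.
  rewrite (_ : _ @^-1` _ = [set p | a < (if i then p.1 else p.2 : R)]); first exact: rays_trig.
  by apply/seteqP; split => p /=; rewrite in_itv/= andbT.
have mid : measurable_fun setT ((fun p => (p.1, p.2)) : Gt -> (TR * TR)%type).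
  by apply: measurable_fun_pair; [exact: (m1 true)|exact: (m1 false)].
move=> E mE; have := mid (@measurableT _ Gt) E mE; rewrite setTI.
by rewrite (_ : _ @^-1` _ = E)//; apply/seteqP; split => -[].
Qed.

Let mD : measurable D.
Proof. by apply: measurableX; exact: measurable_itv. Qed.

Let mth t (E : set (TR * TR)) : measurable_fun E (th t).
Proof.
apply: measurable_funS measurableT _ _ => //.
have m (k : int) : measurable_fun setT ((fun x : TR => k%:~R * (x : R)) : TR -> R).
  have h : continuous (fun x : R => k%:~R * x).
    by move=> x; apply: continuousM; [exact: cst_continuous|exact: id].
  exact: (continuous_measurable_fun h).
apply: measurable_funD.
  exact: (measurableT_comp (m t.1) measurable_fst).
exact: (measurableT_comp (m t.2) measurable_snd).
Qed.

Lemma trig_measurable f : trig f -> measurable_fun D f.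
Proof.
elim=> [t|t|{}f g _ ? _ ?|a {}f _ ?].
- apply: measurableT_comp; last exact: mth.
  exact: (continuous_measurable_fun (@continuous_cos R)).
- apply: measurableT_comp; last exact: mth.
  exact: (continuous_measurable_fun (@continuous_sin R)).
- exact: measurable_funD.
- exact: measurable_funM.
Qed.

Lemma L1_trig f B : trig f -> mem_L1 mu D B -> mem_L1 mu D (fun p => f p * B p).
Proof.
move=> tf lB; have [M fM] := trig_bounded tf.
by apply: (L1_bounded mD (M := M)) => //; exact: trig_measurable.
Qed.

Variable B : TR * TR -> R.
Hypothesis lB : mem_L1 mu D B.
Hypothesis Bcos : forall t1 t2 : int, Rintegral mu D (fun p => cos (t1%:~R * (p.1 : R) + t2%:~R * (p.2 : R)) * B p) = 0.
Hypothesis Bsin : forall t1 t2 : int, Rintegral mu D (fun p => sin (t1%:~R * (p.1 : R) + t2%:~R * (p.2 : R)) * B p) = 0.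

Let Fc : set (TR * TR -> R) := [set g | mem_L1 mu D (fun p => g p * B p) /\ Rintegral mu D (fun p => g p * B p) = 0].

Let trigF : (trig : set _) `<=` Fc.
Proof.
move=> f tf; split; first exact: L1_trig.
elim: tf => [t|t|{}f g tf ef tg eg|a {}f tf ef].
- exact: Bcos.
- exact: Bsin.
- rewrite (Rint_eq (g := fun p => f p * B p + g p * B p)); last by move=> p _; rewrite mulrDl.
  by rewrite RintD ?ef ?eg ?addr0//; exact: L1_trig.
- rewrite (Rint_eq (g := fun p => a * (f p * B p))); last by move=> p _; rewrite mulrA.
  by rewrite RintZ ?ef ?mulr0//; exact: L1_trig.
Qed.

Let FD f g : Fc f -> Fc g -> Fc (fun p => f p + g p).
Proof.
move=> [lf ef] [lg eg]; split; first by apply: (L1_eq mD _ (L1D mD lf lg)) => p _; rewrite mulrDl.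
rewrite (Rint_eq (g := fun p => f p * B p + g p * B p)); last by move=> p _; rewrite mulrDl.
by rewrite RintD// ef eg addr0.
Qed.

Let FZ a f : Fc f -> Fc (fun p => a * f p).
Proof.
move=> [lf ef]; split; first by apply: (L1_eq mD _ (L1Z mD a lf)) => p _; rewrite mulrA.
rewrite (Rint_eq (g := fun p => a * (f p * B p))); last by move=> p _; rewrite mulrA.
by rewrite RintZ// ef mulr0.
Qed.

Let Flim (g : nat -> TR * TR -> R) (f : TR * TR -> R) (M : R) : (forall n, Fc (g n)) ->
  (forall n p, D p -> `|g n p| <= M) -> (forall p, D p -> g n p @[n --> \oo] --> f p) -> Fc f.
Proof.
move=> Fg gM gf.
have [] := @Rint_dct _ _ _ mu D mD (fun n p => g n p * B p) (fun p => f p * B p) (fun p => M * `|B p|).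
- by move=> n; have [l _] := Fg n; exact: L1_meas l.
- by apply: L1Z => //; exact: L1_norm.
- by move=> n p Dp; rewrite normrM ler_wpM2r// gM.
- by move=> p Dp; apply: cvgM; [exact: gf|exact: cvg_cst].
move=> l cv; split => //; apply/esym/(cvg_unique _ _ cv) => //.
rewrite (_ : (fun n : nat => _) = fun=> 0); first exact: cvg_cst.
by apply/funext => n; have [] := Fg n.
Qed.

(** The functions whose product with [B] has integral 0 form a class closed under bounded limits and
    containing the trigonometric polynomials. *)
Lemma integral_indic0 (E : set (TR * TR)) : measurable E ->
  mem_L1 mu D (fun p => \1_E p * B p) /\ Rintegral mu D (fun p => \1_E p * B p) = 0.
Proof.
move=> /borel_trig mE.
apply: (@class_indic _ (TR * TR)%type R D trig Fc trig_cst trig_M trigF FD FZ Flim E mE).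
Qed.

(** Applied to the sets where [B] is positive and negative, [integral_indic0] makes the integral of
    the absolute value vanish. *)
Lemma fourier_unique : {ae mu, forall p, D p -> B p = 0}.
Proof.
have mB : measurable_fun D B by exact: L1_meas lB.
pose E1 := D `&` B @^-1` `]0, +oo[; pose E2 := D `&` B @^-1` `]-oo, 0[.
have mE1 : measurable E1 by apply: mB => //; exact: measurable_itv.
have mE2 : measurable E2 by apply: mB => //; exact: measurable_itv.
have [l1 e1] := integral_indic0 mE1; have [l2 e2] := integral_indic0 mE2.
have e : Rintegral mu D (fun p => `|B p|) = 0.
  rewrite (Rint_eq (g := fun p => \1_E1 p * B p - \1_E2 p * B p)); first by rewrite RintB// e1 e2 subr0.
  move=> p Dp; rewrite !indicE.
  case: (ltrgt0P (B p)) => Bp.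
  - rewrite mem_set; last by split => //=; rewrite in_itv/= andbT.
    rewrite memNset ?mul0r ?mul1r ?subr0// => -[_ /=]; rewrite in_itv/= => Bn.
    by have := lt_trans Bp Bn; rewrite ltxx.
  - rewrite memNset; last first.
      by move=> -[_ /=]; rewrite in_itv/= andbT => Bn; have := lt_trans Bp Bn; rewrite ltxx.
    by rewrite mem_set ?mul0r ?mul1r ?sub0r//; split => //=; rewrite in_itv.
  - by rewrite Bp !mulr0 subrr.
have := ae_eq_integral_abs mu mD (f := EFin \o B).
move=> /(_ _)[|h _]; first exact/measurable_EFinP.
have : (\int[mu]_(p in D) `|(EFin \o B) p| = 0)%E.
  have fi : (\int[mu]_(p in D) (`|B p|)%:E \is a fin_num)%E.
    by apply: integrable_fin_num => //; exact: L1_norm lB.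
  by rewrite -[LHS](fineK fi); congr EFin.
move=> /h; apply: filterS => p /= hp Dp; have := hp Dp; by case.
Qed.

End FourierUniqueness.

(** * Folding the spectral density *)

Section Reflection.
Variable R : realType.
Notation lam := (@lebesgue_measure R).
Notation TR := (measurableTypeR R).
Variable a : R.
Let r (x : TR) : TR := a - (x : R).

Let mr : measurable_fun setT r.
Proof.
have h : continuous (fun x : R => a - x) by move=> x; apply: cvgB; [exact: cvg_cst|exact: cvg_id].
exact: (continuous_measurable_fun h).
Qed.

Let rK x : r (r x) = x. Proof. by rewrite /r subKr. Qed.

Let nu := measure_function_pushforward__canonical__measure_function_Measure lam mr.

Lemma lebesgue_measure_reflection (A : set TR) : measurable A ->
  lam ((fun x : TR => a - (x : R) : TR) @^-1` A) = lam A.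
Proof.
move=> mA; apply/esym; apply: (lebesgue_measure_unique (mu := nu)) => // _ [[u v]] _ <-.
rewrite /= /pushforward.
rewrite (_ : r @^-1` _ = `[a - v, a - u[%classic); last first.
  by apply/seteqP; split => x /=; rewrite !in_itv/= /r => /andP[? ?]; apply/andP; split; lra.
by rewrite !lebesgue_measure_itv/= !lte_fin ltrD2l ltrN2; congr (if _ then _ else _); rewrite -!EFinB; congr EFin; ring.
Qed.

Lemma ae_reflection (Q : TR -> Prop) : {ae lam, forall x, Q x} -> {ae lam, forall x : TR, Q (a - (x : R))}.
Proof.
move=> [N [mN N0 sN]]; exists (r @^-1` N); split.
- by rewrite -[X in measurable X]setTI; exact: mr.
- by rewrite lebesgue_measure_reflection.
- by move=> x /= nQ; exact: sN.
Qed.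

Lemma Rint_reflection (D : set TR) (g : TR -> R) : measurable D -> measurable_fun setT g -> mem_L1 lam D g ->
  mem_L1 lam (r @^-1` D) (fun x => g (r x)) /\ Rintegral lam (r @^-1` D) (fun x => g (r x)) = Rintegral lam D g.
Proof.
move=> mD mg lg.
have mrD : measurable (r @^-1` D) by rewrite -[X in measurable X]setTI; exact: mr.
have mgr : measurable_fun setT (fun x => g (r x)) by exact: measurableT_comp.
have rD : r @^-1` (r @^-1` D) = D by apply/seteqP; split => x /=; rewrite rK.
have inu : nu.-integrable (r @^-1` D) (fun x => (g (r x))%:E).
  apply: integrable_pushforward => //; first exact/measurable_EFinP.
  by rewrite rD; apply: eq_integrable lg => // x _ /=; rewrite rK.
have enu (h : TR -> \bar R) : (\int[nu]_(x in r @^-1` D) h x = \int[lam]_(x in r @^-1` D) h x)%E.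
  by apply: eq_measure_integral => A mA _; exact: lebesgue_measure_reflection.
split.
  apply/integrableP; split; first by apply/measurable_EFinP; exact: measurable_funS mgr.
  by case/integrableP : inu => _; rewrite enu.
rewrite /Rintegral -enu; congr fine.
rewrite (@integral_pushforward _ _ _ _ _ r)//=; first by rewrite rD; apply: eq_integral => x _ /=; rewrite rK.
  exact/measurable_EFinP.
by rewrite rD; apply: eq_integrable lg => // x _ /=; rewrite rK.
Qed.

End Reflection.

Section Folding.
Variable R : realType.
Notation lam := (@lebesgue_measure R).
Notation TR := (measurableTypeR R).
Notation J := (`]0, pi[%classic : set TR).
Notation J' := (`]pi, 2 * pi[%classic : set TR).
Notation I2 := (I2pi R : set TR).
Variable f : TR -> R.
Hypothesis lf : mem_L1 lam I2 f.
Hypothesis f_gt0 : {ae lam, forall x : TR, I2 x -> 0 < f x}.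

Let mI2 : measurable I2. Proof. exact: measurable_itv. Qed.
Let mJ : measurable J. Proof. exact: measurable_itv. Qed.
Let f1 : TR -> R := f \_ I2.
Let r (x : TR) : TR := 2 * pi - (x : R).
Let G x := f1 x + f1 (r x).
Let S : set TR := J `&` [set x | 0 < G x].
(** The folded density is positive only almost everywhere; replacing it by 1 elsewhere changes no
    integral on (0, pi) and gives the pointwise positivity that division by [sqrt F] requires. *)
Let F x : R := if x \in S then G x else 1.

Let mf1 : measurable_fun setT f1.
Proof. by apply/(measurable_restrictT _ mI2); exact: L1_meas lf. Qed.

Let mG : measurable_fun setT G.
Proof.
apply: measurable_funD => //; apply: measurableT_comp => //.
have h : continuous (fun x : R => 2 * pi - x) by move=> x; apply: cvgB; [exact: cvg_cst|exact: cvg_id].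
exact: (continuous_measurable_fun h).
Qed.

Let mF : measurable_fun setT F.
Proof.
apply: measurable_fun_ifT => //.
apply: (measurable_fun_bool true).
rewrite setTI (_ : _ @^-1` _ = S).
  apply: measurableI => //; rewrite (_ : [set x | _] = G @^-1` `]0, +oo[).
    by rewrite -[X in measurable X]setTI; apply: mG => //; exact: measurable_itv.
  by apply/seteqP; split => x /=; rewrite in_itv/= andbT.
by apply/seteqP; split => x /=; [move/set_mem|move/mem_set ->].
Qed.

Let F_gt0 x : 0 < F x.
Proof. by rewrite /F; case: ifPn => // /set_mem[]. Qed.

Let FG : {ae lam, forall x : TR, J x -> F x = G x}.
Proof.
have h := @ae_reflection _ (2 * pi) _ f_gt0.
apply: filterS2 f_gt0 h => x /= fx fr Jx.
have xI : I2 x by move: Jx; rewrite /I2pi /= !in_itv/= => /andP[? ?]; apply/andP; split; lra.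
have rI : I2 (r x) by move: Jx; rewrite /I2pi /r /= !in_itv/= => /andP[? ?]; apply/andP; split; lra.
rewrite /F mem_set//; split => //=.
by rewrite /G /f1 !patchE !mem_set// addr_gt0 ?fx// fr.
Qed.

Let lJ1 (k : R) : mem_L1 lam J (fun=> k).
Proof.
apply/integrableP; split; first exact: measurable_cst.
by rewrite integral_cst//= lebesgue_measure_itv/= lte_fin pi_gt0 -EFinB -EFinM ltry.
Qed.

Let lf1 (A : set TR) : measurable A -> mem_L1 lam A f1.
Proof.
move=> mA; apply: (integrableS measurableT) => //.
have := (integrable_restrict lam mI2 measurableT (EFin \o f)).1.
rewrite setTI => /(_ lf); apply: eq_integrable => // x _ /=.
by rewrite /f1 !patchE; case: ifP.
Qed.

Let rJ : r @^-1` J' = J.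
Proof. by apply/seteqP; split => x /=; rewrite !in_itv/= /r => /andP[? ?]; apply/andP; split; lra. Qed.

Let mJ' : measurable J'. Proof. exact: measurable_itv. Qed.

Let lf1r : mem_L1 lam J (fun x => f1 (r x)).
Proof.
have [] := @Rint_reflection R (2 * pi) J' f1 mJ' mf1 (lf1 mJ').
by rewrite -/r -[_ @^-1` _]/(r @^-1` J') rJ.
Qed.

Let lG : mem_L1 lam J G.
Proof. by apply: L1D => //; exact: lf1. Qed.

Let lF : mem_L1 lam J F.
Proof.
apply: (L1_le mJ _ (L1D mJ (L1_norm lG) (lJ1 1))).
  exact: measurable_funS mF.
move=> x _; rewrite /F; case: ifP => _; first by rewrite lerDl.
by rewrite normr1 lerDr normr_ge0.
Qed.

Let mcosh (k : R) (D : set TR) : measurable_fun D (fun x => cos (k * (x : R)) : R).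
Proof.
apply: measurable_funS measurableT _ _ => //.
have h : continuous (fun y : R => cos (k * y)).
  move=> x; apply: continuous_comp; last exact: continuous_cos.
  by apply: continuousM; [exact: cst_continuous|exact: id].
exact: (continuous_measurable_fun h).
Qed.

Let lcos (h : int) (g : TR -> R) (A : set TR) : measurable A -> mem_L1 lam A g ->
  mem_L1 lam A (fun x => cos (h%:~R * (x : R)) * g x).
Proof.
move=> mA lg; apply: (L1_bounded mA (M := 1)) => //.
by move=> x _; rewrite ler_norml cos_geN1 cos_le1.
Qed.

(** Since [cos (h * (2 pi - x)) = cos (h * x)], the mass on (pi, 2 pi) can be reflected onto (0, pi)
    without changing any cosine integral. *)
Lemma fold_density : exists F : TR -> R, [/\ measurable_fun setT F, forall x, 0 < F x,
  mem_L1 lam J F & forall h : int, Rintegral lam I2 (fun x => cos (h%:~R * (x : R)) * f x) =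
    Rintegral lam J (fun x => cos (h%:~R * (x : R)) * F x)].
Proof.
exists F; split => // h.
pose g (x : TR) := cos (h%:~R * (x : R)) * f1 x.
have lg A : measurable A -> mem_L1 lam A g by move=> mA; apply: lcos => //; exact: lf1.
have mg : measurable_fun setT g by apply: measurable_funM.
have -> : Rintegral lam I2 (fun x => cos (h%:~R * (x : R)) * f x) = Rintegral lam I2 g.
  by apply: Rint_eq => x Ix; rewrite /g /f1 patchE mem_set.
have -> : Rintegral lam I2 g = Rintegral lam J g + Rintegral lam J' g.
  rewrite /I /I2pi (@itv_bndbnd_setU _ _ _ (BLeft pi)); last 2 first.
  - by rewrite bnd_simp pi_ge0.
  - by rewrite bnd_simp; have := pi_ge0 R; lra.
  rewrite Rintegral_setU//; last 2 first.
  - by apply: lg; apply: measurableU; exact: measurable_itv.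
  - by apply/disj_set2P; apply/seteqP; split => // x [/=]; rewrite !in_itv/= => /andP[_ ?] /andP[? _]; lra.
  rewrite -Rintegral_itv_obnd_cbnd; last by apply: lg; exact: measurable_itv.
  by rewrite -Rintegral_itv_obnd_cbnd//; apply: lg; exact: measurable_itv.
have [_ <-] := @Rint_reflection R (2 * pi) J' g mJ' mg (lg _ mJ').
rewrite -/r -[_ @^-1` _]/(r @^-1` J') rJ.
have e : Rintegral lam J (fun x => g (r x)) = Rintegral lam J (fun x => cos (h%:~R * (x : R)) * f1 (r x)).
  apply: Rint_eq => x _; rewrite /g /r mulrBr cosB cos_int_pi sin_int_2pi.
  by rewrite mul1r mul0r addr0.
rewrite [X in _ + X]e -RintD//; last 2 first.
- exact: lg.
- exact: lcos.
transitivity (Rintegral lam J (fun x : TR => cos (h%:~R * (x : R)) * G x)).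
  by apply: Rint_eq => x _; rewrite mulrDr.
rewrite /Rintegral; congr fine; apply: ae_eq_integral => //.
- by apply/measurable_EFinP; apply: L1_meas (lcos h mJ lG).
- by apply/measurable_EFinP; apply: L1_meas (lcos h mJ lF).
by apply: filterS FG => x /= FGx Jx; rewrite FGx.
Qed.

End Folding.

(** * Consequences of the bispectrum, and the conclusion *)

Section Bispectrum.
Context d (T : measurableType d) (R : realType) (P : probability T R).
Notation E := (Rintegral P setT).
Notation TR := (measurableTypeR R).
Notation mu := (@lebesgue_measure R \x @lebesgue_measure R)%E.
Notation D := (Sq2pi R : set (TR * TR)).

Lemma ExE (f : T -> R) : Ex P f = E f.
Proof. by rewrite /Ex unlock. Qed.

Lemma real_bispectrum (X : int -> {RV P >-> R}) (Br Bi : TR * TR -> R) :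
  is_bispectrum P X Br Bi -> {ae mu, forall p, D p -> Bi p = 0} ->
  [/\ mem_L1 mu D Br,
    forall t1 t2 : int, cum3 P (X 0) (X t1) (X t2) =
      Rintegral mu D (fun p : TR * TR => cos (t1%:~R * (p.1 : R) + t2%:~R * (p.2 : R)) * Br p) &
    forall t1 t2 : int,
      Rintegral mu D (fun p : TR * TR => sin (t1%:~R * (p.1 : R) + t2%:~R * (p.2 : R)) * Br p) = 0].
Proof.
move=> [lBr lBi hB] Bi0.
have mD : measurable D by apply: measurableX; exact: measurable_itv.
have lr : mem_L1 mu D Br := lBr.
have li : mem_L1 mu D Bi := lBi.
have lc (t1 t2 : int) (B : TR * TR -> R) : mem_L1 mu D B ->
    mem_L1 mu D (fun p => cos (t1%:~R * (p.1 : R) + t2%:~R * (p.2 : R)) * B p).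
  exact: (L1_trig (trig_cos _ (t1, t2))).
have ls (t1 t2 : int) (B : TR * TR -> R) : mem_L1 mu D B ->
    mem_L1 mu D (fun p => sin (t1%:~R * (p.1 : R) + t2%:~R * (p.2 : R)) * B p).
  exact: (L1_trig (trig_sin _ (t1, t2))).
split => // t1 t2; have [h1 h2] := hB t1 t2.
  apply: (etrans h1).
  apply: (@Rint_ae_eq _ _ _ mu D mD _ _ (L1B mD (lc t1 t2 _ lr) (ls t1 t2 _ li)) (lc t1 t2 _ lr)).
  by apply: filterS Bi0 => p /= hp Dp; rewrite hp// mulr0 subr0.
apply/esym/(etrans h2).
apply: (@Rint_ae_eq _ _ _ mu D mD _ _ (L1D mD (ls t1 t2 _ lr) (lc t1 t2 _ li)) (ls t1 t2 _ lr)).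
by apply: filterS Bi0 => p /= hp Dp; rewrite hp// mulr0 addr0.
Qed.

Variable Z : int -> {RV P >-> R}.
Hypothesis iidZ : iid_innovations P Z.
Hypothesis s2_neq0 : s2 Z != 0.
Hypothesis lZ3 : forall k, L3 P (Z k).

(** Polarisation: [6 U V W] is a signed sum of cubes of partial sums of [U], [V], [W], and each cube
    has mean 0 by [cube_formula]. *)
Lemma E_triple0 U V W : kappa3 Z = 0 -> clos Z U -> clos Z V -> clos Z W ->
  L3 P U -> L3 P V -> L3 P W -> E (fun w => U w * V w * W w) = 0.
Proof.
move=> k0 cU cV cW lU lV lW.
have mT : measurable [set: T] := measurableT.
have cube0 S : clos Z S -> L3 P S -> E (fun w => S w ^+ 3) = 0.
  move=> cS lS; apply/eqP; rewrite -normr_eq0; apply/eqP/le_anti/andP; split => //.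
  apply/ler_addgt0Pl => e e0; rewrite addr0.
  have [s us /(_ s us (fun _ => id))] := cube_formula iidZ s2_neq0 cS lS lZ3 e0.
  by rewrite k0 mul0r subr0 => /ltW.
have cUV := closD iidZ s2_neq0 cU cV; have lUV := L3D lU lV.
have cUW := closD iidZ s2_neq0 cU cW; have lUW := L3D lU lW.
have cVW := closD iidZ s2_neq0 cV cW; have lVW := L3D lV lW.
have cS := closD iidZ s2_neq0 cUV cW; have lS := L3D lUV lW.
have l3 := @L3_cube _ _ _ P.
pose f1 w := (U w + V w + W w) ^+ 3.
pose f2 w := U w ^+ 3 + V w ^+ 3 + W w ^+ 3.
pose f3 w := (U w + V w) ^+ 3 + (U w + W w) ^+ 3 + (V w + W w) ^+ 3.
have [m1 e1] : mem_L1 P setT f1 /\ E f1 = 0 by split; [exact: (l3 _ lS)|exact: (cube0 _ cS lS)].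
have [m2 e2] : mem_L1 P setT f2 /\ E f2 = 0.
  split; first exact: (L1D mT (L1D mT (l3 _ lU) (l3 _ lV)) (l3 _ lW)).
  rewrite RintD ?RintD ?cube0 ?addr0//; [exact: l3..| |exact: l3].
  exact: (L1D mT (l3 _ lU) (l3 _ lV)).
have [m3 e3] : mem_L1 P setT f3 /\ E f3 = 0.
  split; first exact: (L1D mT (L1D mT (l3 _ lUV) (l3 _ lUW)) (l3 _ lVW)).
  rewrite RintD ?RintD ?(cube0 _ cUV lUV) ?(cube0 _ cUW lUW) ?(cube0 _ cVW lVW) ?addr0//.
  - exact: (l3 _ lUV).
  - exact: (l3 _ lUW).
  - exact: (L1D mT (l3 _ lUV) (l3 _ lUW)).
  - exact: (l3 _ lVW).
rewrite (Rint_eq (g := fun w => 6^-1 * (f1 w + f2 w - f3 w))); last first.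
  by move=> w _; rewrite /f1 /f2 /f3; field.
rewrite RintZ//; last exact: (L1B mT (L1D mT m1 m2) m3).
rewrite RintB//; last exact: L1D.
by rewrite RintD// e1 e2 e3 addr0 subr0 mulr0.
Qed.

End Bispectrum.

Section Main.
Context d (T : measurableType d) (R : realType) (P : probability T R).
Notation E := (Rintegral P setT).
Notation TR := (measurableTypeR R).
Notation lam := (@lebesgue_measure R).
Notation J := (`]0, pi[%classic : set TR).

Lemma Rint_gt0 (F : TR -> R) : (forall x, 0 < F x) -> mem_L1 lam J F -> 0 < Rintegral lam J F.
Proof.
move=> F0 lF; have mJ : measurable J by exact: measurable_itv.
rewrite lt_neqAle Rint_ge0 ?andbT; last by move=> x _; exact: ltW.
apply/negP => /eqP F_0.
have h : (\int[lam]_(x in J) `|(EFin \o F) x| = 0)%E.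
  have fi : (\int[lam]_(x in J) (`|F x|)%:E \is a fin_num)%E.
    by apply: integrable_fin_num => //; exact: L1_norm lF.
  rewrite -[LHS](fineK fi); congr EFin; rewrite [RHS]F_0.
  by apply: Rint_eq => x _; rewrite ger0_norm// ltW.
have [N [mN N0 sN]] := (ae_eq_integral_abs lam mJ (f := EFin \o F) (measurable_int lam lF)).1 h.
have : (lam J <= lam N)%E.
  apply: le_measure; rewrite ?inE// => x Jx; apply: sN => /= /(_ Jx)[] Fx0.
  by have := F0 x; rewrite Fx0 ltxx.
by rewrite N0 lebesgue_measure_itv/= lte_fin pi_gt0 -EFinB lee_fin subr0 leNgt pi_gt0.
Qed.
End Main.

Unset Implicit Arguments.

Theorem theorem1 (d : measure_display) (T : measurableType d) (R : realType)
  (P : probability T R) (X : int -> {RV P >-> R}) :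
  linear_time_series P X ->
  P.-integrable setT (fun w => (`|X 0 w| ^+ 3)%:E) ->
  (exists f : R -> R, is_spectral_density P X f /\
     {ae leb R, forall w, I2pi R w -> 0 < f w}) ->
  (exists Br Bi : (R * R)%type -> R, [/\ is_bispectrum P X Br Bi,
     {ae leb2 R, forall w, Sq2pi R w -> Bi w = 0} &
     ~ {ae leb2 R, forall w, Sq2pi R w -> Br w = 0}]) ->
  reversible P X.
Proof.
move=> [c [Z [iidZ _ Xlim]]] X3 [f [[lf hf] f0]] [Br [Bi [hB Bi0 nBr]]].
have [F [mF F0 lF eF]] := @fold_density R f lf f0.
have acF h : autocov P X h = Rintegral (@lebesgue_measure R) `]0, pi[%classic
    (fun x : measurableTypeR R => cos (h%:~R * (x : R)) * F x).
  by have [-> _] := hf h; exact: eF.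
have lX := L2X iidZ Xlim.
(* The mean of [X 0] is not yet known to vanish, as that uses [s2 Z != 0]. With zero norm,
   [autocov P X 0] would be minus the square of the mean, against the positive integral of [F]. *)
have nX : norm2 P setT (X 0) != 0.
  apply/eqP => n0; have := acF 0; rewrite /autocov !ExE.
  have -> : Rintegral P setT (fun w => X 0 w * X 0 w) = norm2 P setT (X 0) ^+ 2.
    by rewrite sqr_norm2.
  rewrite n0 expr0n/= sub0r => h.
  have := Rint_gt0 F0 lF.
  have -> : Rintegral (@lebesgue_measure R) `]0, pi[%classic F = autocov P X 0.
    by rewrite acF; apply: Rint_eq => x _; rewrite mul0r cos0 mul1r.
  by rewrite acF -h oppr_gt0 ltNge -expr2 sqr_ge0.
have s2_neq0 : s2 Z != 0 by apply: contra_neq nX; exact: (X_norm0 iidZ Xlim).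
have cX := clos_X iidZ Xlim s2_neq0.
have mean0 t : Rintegral P setT (X t) = 0 by exact: (clos_mean iidZ (cX t)).
have lX3 := L3X iidZ s2_neq0 Xlim X3.
have [lBr hcos hsin] := @real_bispectrum _ _ _ P X Br Bi hB Bi0.
have cumE t1 t2 : cum3 P (X 0) (X t1) (X t2) = Rintegral P setT (fun w => X 0 w * X t1 w * X t2 w).
  by rewrite /cum3 !ExE !mean0 !mul0r mulr0 !subr0 addr0.
have E2F s t : Rintegral P setT (fun w => X s w * X t w) =
    Rintegral (@lebesgue_measure R) `]0, pi[%classic
      (fun x : measurableTypeR R => cos ((s - t)%:~R * (x : R)) * F x).
  rewrite -acF /autocov !ExE !mean0 mulr0 subr0 (E2_shift iidZ s2_neq0 Xlim X3 s t (- t)) subrr.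
  by apply: Rint_eq => w _; rewrite mulrC.
(* With no imaginary part the cumulants are cosine integrals, and the cosine is even. *)
have X3_rev t1 t2 : Rintegral P setT (fun w => X 0 w * X t1 w * X t2 w) =
    Rintegral P setT (fun w => X 0 w * X (- t1) w * X (- t2) w).
  rewrite -!cumE !hcos; apply: Rint_eq => p _.
  by rewrite -cosN !intrN !mulNr -opprD.
(* If all coefficients were 0, every Fourier sum of [X 0] would vanish and so would its norm. A
   nonzero coefficient passes the third moment of [X 0] on to the innovations. *)
have [k ck] : exists k, c k != 0.
  apply: contrapT => c0; move/eqP: nX; apply.
  apply/le_anti; rewrite norm2_ge0 andbT; apply/ler_addgt0Pl => e e0; rewrite addr0.
  have [_ /(_ e e0)[s us /(_ s us (fun _ => id))/ltW]] := cX 0; apply: le_trans.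
  rewrite (norm2_eq (g := fun w => X 0 w - comb Z s (cf Z (X 0)) w))// => w _.
  rewrite /comb big1 ?subr0// => i _; rewrite (cf_X iidZ Xlim s2_neq0).
  by case: (eqVneq (c (0 - i)) 0) => [->|ci]; [rewrite mul0r|case: c0; exists (0 - i)].
have lZ3 j : L3 P (Z j).
  apply: (@L3_innov _ _ _ P Z iidZ (X 0) (- k) j (cX 0) (lX3 0)).
  by rewrite (cf_X iidZ Xlim s2_neq0) opprK add0r.
(* The cosine integrals of [Br] are the cumulants, which would all vanish; the sine integrals vanish
   because cumulants are real. Fourier uniqueness then contradicts [nBr]. *)
have k3_neq0 : kappa3 Z != 0.
  apply/eqP => k0; apply: nBr.
  apply: (@fourier_unique R Br lBr) => t1 t2; last exact: hsin.
  by rewrite -hcos cumE (E_triple0 iidZ s2_neq0 lZ3).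
apply: (reversible_of_span iidZ s2_neq0 Xlim X3 X3_rev k3_neq0 lZ3).
exact: (span_dense iidZ s2_neq0 Xlim mF F0 lF E2F).
Qed.
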